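(* The \textsc{Well-Covered Graph} problem (given a graph $G$, decide whether $G$ is well-covered) is fixed-parameter tractable when parameterized by the clique-width of $G$.
   Context: A graph is well-covered if all its maximal independent sets have the same cardinality. The clique-width of $G$ is the minimum number of labels needed to construct $G$ using the operations: create a single vertex with an integer label; take the disjoint union of two labeled graphs; add all edges between vertices labeled $i$ and vertices labeled $j$ ($i\neq j$); relabel all vertices of label $i$ to label $j$. A parameterized problem is FPT if it can be solved in time $f(k)\,n^{O(1)}$ for a computable $f$, where $k$ is the parameter and $n$ the input size. *)

(* Defs.v *)
From mathcomp Require Import all_boot all_fingroup.
Set Implicit Arguments. Unset Strict Implicit. Unset Printing Implicit Defensive.

Definition simple_graph (n : nat) (E : rel 'I_n) : Prop :=
  (forall x y, E x y = E y x) /\ (forall x, E x x = false).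

Definition independent (n : nat) (E : rel 'I_n) (S : {set 'I_n}) : bool :=
  [forall x in S, forall y in S, ~~ E x y].

Definition maximal_independent (n : nat) (E : rel 'I_n) (S : {set 'I_n}) : Prop :=
  maxset (independent E) S.

Definition well_covered (n : nat) (E : rel 'I_n) : Prop :=
  forall S T : {set 'I_n}, maximal_independent E S -> maximal_independent E T ->
    #|S| = #|T|.

Inductive kexp : Type :=
| KVtx  of nat
| KUnion of kexp & kexp
| KJoin of nat & nat & kexp
| KRelab of nat & nat & kexp.

(* vertices of the constructed graph are 0 .. kv e - 1 (leaves left to right) *)
Fixpoint kv (e : kexp) : nat :=
  match e with
  | KVtx _ => 1
  | KUnion a b => kv a + kv b
  | KJoin _ _ a => kv a
  | KRelab _ _ a => kv a
  end.

Fixpoint klab (e : kexp) (u : nat) : nat :=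
  match e with
  | KVtx l => l
  | KUnion a b => if u < kv a then klab a u else klab b (u - kv a)
  | KJoin _ _ a => klab a u
  | KRelab i j a => if klab a u == i then j else klab a u
  end.

Fixpoint kedge (e : kexp) (u v : nat) : bool :=
  match e with
  | KVtx _ => false
  | KUnion a b =>
      if (u < kv a) && (v < kv a) then kedge a u v
      else if (kv a <= u) && (kv a <= v) then kedge b (u - kv a) (v - kv a)
      else false
  | KJoin i j a =>
      kedge a u v ||
      [&& u < kv a, v < kv a &
          ((klab a u == i) && (klab a v == j)) || ((klab a u == j) && (klab a v == i))]
  | KRelab _ _ a => kedge a u v
  end.

Fixpoint valid_kexp (k : nat) (e : kexp) : bool :=
  match e with
  | KVtx l => l < k
  | KUnion a b => valid_kexp k a && valid_kexp k b
  | KJoin i j a => [&& i < k, j < k, i != j & valid_kexp k a]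
  | KRelab i j a => [&& i < k, j < k & valid_kexp k a]
  end.

Definition cw_le (n : nat) (E : rel 'I_n) (k : nat) : Prop :=
  exists e : kexp, valid_kexp k e /\ kv e = n /\
    exists s : {perm 'I_n}, forall x y : 'I_n, E x y = kedge e (s x) (s y).

Definition is_cliquewidth (n : nat) (E : rel 'I_n) (k : nat) : Prop :=
  if n == 0 then k = 0
  else cw_le E k /\ (forall k', cw_le E k' -> k <= k').

Inductive move : Type := MoveL | MoveR | Stay.

Definition sym := option bool.   (* None = blank *)

Record TM : Type := MkTM {
  tm_n : nat;                                   (* states are 'I_(tm_n.+1); ord0 = start *)
  tm_delta : 'I_tm_n.+1 -> sym -> option ('I_tm_n.+1 * sym * move);  (* None = halt *)
  tm_acc : 'I_tm_n.+1 -> bool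
}.

Record config (M : TM) : Type := Config {
  c_state : 'I_(tm_n M).+1;
  c_left : seq sym;     (* cells to the left of the head, nearest first *)
  c_head : sym;
  c_right : seq sym     (* cells to the right of the head, nearest first *)
}.

Definition init_config (M : TM) (w : seq bool) : config M :=
  match w with
  | [::] => Config (ord0 : 'I_(tm_n M).+1) [::] None [::]
  | b :: w' => Config (ord0 : 'I_(tm_n M).+1) [::] (Some b) (map Some w')
  end.

Definition halted (M : TM) (c : config M) : bool :=
  if tm_delta (c_state c) (c_head c) is None then true else false.

Definition step (M : TM) (c : config M) : config M :=
  match tm_delta (c_state c) (c_head c) with
  | None => c
  | Some (q, s, d) =>
      match d with
      | Stay => Config q (c_left c) s (c_right c)
      | MoveL => match c_left c with
                 | [::] => Config q [::] None (s :: c_right c)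
                 | a :: l => Config q l a (s :: c_right c)
                 end
      | MoveR => match c_right c with
                 | [::] => Config q (s :: c_left c) None [::]
                 | a :: r => Config q (s :: c_left c) a r
                 end
      end
  end.

Definition runs_within (M : TM) (w : seq bool) (t : nat) (b : bool) : bool :=
  let c := iter t (@step M) (init_config M w) in
  halted c && (tm_acc (c_state c) == b).

Definition computable (f : nat -> nat) : Prop :=
  exists M : TM, forall k m : nat, exists t : nat,
    runs_within M (nseq k true ++ false :: nseq m true) t (f k == m).

Definition encode_graph (n : nat) (E : rel 'I_n) : seq bool :=
  nseq n true ++ false :: [seq E i j | i <- enum 'I_n, j <- enum 'I_n].

(* Main.v *)
(* The clique-width expression is not part of the input, and it is replaced by a
   layout tree of bounded GF(2) cut-rank, found by iterative compression.  When a
   vertex is added to a layout of width at most 3k + 1, the layout with the new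
   leaf at the root has width at most 3k + 2.  A layout of width at most 3k + 1 is
   rebuilt top-down: each set B of low cut-rank is split into two parts of low
   cut-rank.  Such a split exists by submodularity of the cut-rank, applied to B
   and to a minimal subterm of the clique-width expression whose cut with B has
   rank above k, and it is found by dynamic programming over the wider layout,
   where a guessed vector for each vertex and each part factorizes the cut.  As k
   is unknown, r = 0, 1, 2, ... is tried in place of 3k + 1.  On the last layout,
   the same dynamic programming lists the possible sizes of maximal independent
   sets; its state is the set of pairs of a twin class and a status of a vertex.

   The algorithm is a program of a first-order language over binary trees, which
   is compiled to a Turing machine whose running time is polynomial in the size
   of the largest accumulator of a fold, hence in n and a doubly exponential
   function of k.  A second program in that language computes this function. *)

Require Import Defs.
From HB Require Import structures.
From mathcomp Require Import all_boot all_order all_algebra all_fingroup zify.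
From Stdlib Require Import FunctionalExtensionality.
Set Implicit Arguments. Unset Strict Implicit. Unset Printing Implicit Defensive.

(** * Turing machines with an abstract transition function *)

(** The constant in 3k + 1 comes from weighing a set Z by the rank between its part outside B and B.
    If the whole outside has weight R > 3k, subadditivity yields a subterm of weight above k and at
    most 2k, and the rest of the outside still weighs more than k. Both sides thus exceed the rank
    of the cut of the subterm, which is at most k, and this is what submodularity needs to make both
    halves of B no more expensive than B. Rank over the two-element field has two further virtues: a
    cut of rank r has at most 2^r twin classes, and the vectors of a factorization can be
    enumerated. The obstacle is the time bound. It concerns every value computed, also in attempts
    that fail, while the machine knows neither k nor a bound for r. Programs are therefore
    accompanied by realizability statements that carry a predicate on fold accumulators along the
    branches actually taken. An attempt with r is bounded because all smaller ones have failed,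
    which keeps r at most 3k + 2. *)

Definition upd (A : Type) (T : nat -> A) (x : nat) (s : A) : nat -> A :=
  fun y => if y == x then s else T y.

Lemma upd_same (A : Type) (T : nat -> A) x : upd T x (T x) = T.
Proof. by apply: functional_extensionality => y; rewrite /upd; case: eqP => [->|]. Qed.

Section AbstractMachine.
Variables (Q : eqType) (q0 : Q) (qs : seq Q).
Variables (delta : Q -> sym -> option (Q * sym * move)) (acc : Q -> bool).
Hypothesis delta_closed : forall q s q' s' d,
  q \in q0 :: qs -> delta q s = Some (q', s', d) -> q' \in q0 :: qs.

Definition state_of (q : Q) : 'I_(size qs).+1 := inord (index q (q0 :: qs)).
Definition of_state (i : 'I_(size qs).+1) : Q := nth q0 (q0 :: qs) i.

Lemma of_stateK q : q \in q0 :: qs -> of_state (state_of q) = q.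
Proof.
move=> qq; rewrite /of_state /state_of inordK; first by rewrite nth_index.
by have := qq; rewrite -index_mem.
Qed.

Lemma state_of_q0 : state_of q0 = ord0.
Proof. by apply: val_inj; rewrite /= inordK /= eqxx. Qed.

Definition machine : TM := @MkTM (size qs)
  (fun i s => omap (fun p => (state_of p.1.1, p.1.2, p.2)) (delta (of_state i) s))
  (fun i => acc (of_state i)).

(* The coordinate of a cell grows to the left, so that the tape to the left of
   the input is indexed by the natural numbers. *)
Definition repr (c : config machine) (q : Q) (T : nat -> sym) (x : nat) : Prop :=
  [/\ q \in q0 :: qs, c_state c = state_of q, c_head c = T x,
      (forall j, nth None (c_left c) j = T (x + j.+1)) &
      (forall j, nth None (c_right c) j = if j < x then T (x - j.+1) else None)].

(** [MoveR] lowers the coordinate and has no rule at coordinate 0: the runs below never pass the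
    blank after the last input symbol, so the tape further to the right stays blank, as [repr]
    demands. *)
Inductive areach : Q -> (nat -> sym) -> nat -> Q -> (nat -> sym) -> nat -> nat -> Prop :=
| AStop q T x : areach q T x q T x 0
| AStay q T x q' s q'' T' x' t : delta q (T x) = Some (q', s, Stay) ->
    areach q' (upd T x s) x q'' T' x' t -> areach q T x q'' T' x' t.+1
| ALeft q T x q' s q'' T' x' t : delta q (T x) = Some (q', s, MoveL) ->
    areach q' (upd T x s) x.+1 q'' T' x' t -> areach q T x q'' T' x' t.+1
| ARight q T x q' s q'' T' x' t : delta q (T x.+1) = Some (q', s, MoveR) ->
    areach q' (upd T x.+1 s) x q'' T' x' t -> areach q T x.+1 q'' T' x' t.+1.

Lemma areach_trans q T x q' T' x' t q'' T'' x'' t' :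
  areach q T x q' T' x' t -> areach q' T' x' q'' T'' x'' t' ->
  areach q T x q'' T'' x'' (t + t').
Proof.
move=> H; elim: H => {q T x q' T' x' t} //.
- by move=> q T x q' s q1 T' x' t dq _ IH H; apply: AStay dq _; apply: IH.
- by move=> q T x q' s q1 T' x' t dq _ IH H; apply: ALeft dq _; apply: IH.
- by move=> q T x q' s q1 T' x' t dq _ IH H; apply: ARight dq _; apply: IH.
Qed.

Lemma areach_repr q T x q' T' x' t : areach q T x q' T' x' t ->
  forall c, repr c q T x -> repr (iter t (@step machine) c) q' T' x'.
Proof.
move=> H; elim: H => {q T x q' T' x' t} // [] q T x q' s q1 T' x' t dq _ IH c;
  rewrite iterSr => rc; apply: IH; move: rc => [qq cs ch cl cr];
  split; try exact: delta_closed qq dq;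
  rewrite /step /= cs of_stateK // ch dq //=; rewrite /upd.
- by rewrite eqxx.
- by move=> j; rewrite cl; case: eqP => // ?; lia.
- by move=> j; rewrite cr; case: eqP => // ?; case: ltnP => // ?; lia.
- by case: (c_left c).
- by move: (cl 0); rewrite addn1; case: (c_left c) => [|a l] /= ->; case: eqP => //; lia.
- move=> j; move: (cl j.+1); rewrite addSnnS.
  by case: (c_left c) => [|a l] /=; rewrite ?nth_nil => ->; case: eqP => //; lia.
- case: (c_left c) => [|a l] [|j] /=; rewrite ?subSS ?subn0 ?eqxx // cr ltnS;
  by case: ltnP => // ?; case: eqP => // ?; lia.
- by case: (c_right c).
- by move: (cr 0); rewrite ltnS subSS subn0; case: (c_right c) => [|a l] /= ->; case: eqP => //; lia.
- by case: (c_right c) => [|a l] [|j] /=; rewrite ?cl ?addn1 ?eqxx -?addSnnS //; case: eqP => //; lia.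
- move=> j; move: (cr j.+1); rewrite ltnS subSS.
  case: (c_right c) => [|a l] /=; rewrite ?nth_nil => ->; case: ltnP => // ?;
  by case: eqP => //; lia.
Qed.

(** The first symbol has coordinate [size w] and the last one coordinate 1; coordinate 0 is the
    blank at which a walk to the right end of the input stops. *)
Definition input_tape (w : seq bool) : nat -> sym := fun x =>
  if (0 < x) && (x <= size w) then Some (nth false (rev w) x.-1) else None.

Lemma repr_init (w : seq bool) :
  repr (init_config machine w) q0 (input_tape w) (size w).
Proof.
split; first by rewrite inE eqxx.
- by rewrite state_of_q0; case: w.
- rewrite /input_tape; case: w => [|b w'] //=.
  by rewrite leqnn rev_cons nth_rcons size_rev ltnn eqxx.
- move=> j; rewrite /input_tape; case: w => [|b w'] /=; rewrite ?nth_nil;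
  by rewrite //= ifF //; lia.
- move=> j; rewrite /input_tape; case: w => [|b w'] /=; first by rewrite nth_nil.
  rewrite subSS; case: (ltnP j (size w')) => H; last first.
    by rewrite nth_default ?size_map //; case: ifP => //; rewrite ifF //; lia.
  rewrite (nth_map false) // !ifT; try lia.
  congr Some; rewrite rev_cons nth_rcons size_rev ifT; last lia.
  by rewrite nth_rev; [congr nth|]; lia.
Qed.

(** [step] fixes a halted configuration, so a run that halts early is in the same state at any later
    time; this turns exact step counts into upper bounds. *)
Lemma runs_within_machine w q T x t t' :
  areach q0 (input_tape w) (size w) q T x t -> delta q (T x) = None -> t <= t' ->
  runs_within machine w t' (acc q).
Proof.
move=> /areach_repr H dq tt'.
have [qq cs ch _ _] := H _ (repr_init w).
set c := iter t _ _ in cs ch.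
have dc : tm_delta (c_state c) (c_head c) = None by rewrite /= cs of_stateK // ch dq.
have sc : forall i, iter i (@step machine) c = c.
  by elim=> //= i ->; rewrite /step dc.
have -> : t' = (t' - t) + t by lia.
by rewrite /runs_within iterD -/c sc /halted dc /= cs of_stateK // eqxx.
Qed.

End AbstractMachine.

(** * Flowcharts over stacks *)

(** The addresses in [IPop] are the successors for an empty stack, a popped 0 and a popped 1. The
    flowchart halts at an address outside its code. *)
Inductive instr :=
| IPush of nat & bool & nat
| IPop of nat & nat & nat & nat
| IGo of nat.

Definition stacks := nat -> seq bool.

Definition istep (P : seq instr) (c : nat * stacks) : nat * stacks :=
  let: (pc, s) := c in
  match onth P pc with
  | None => c
  | Some (IPush r b nx) => (nx, upd s r (b :: s r))
  | Some (IPop r e z o) =>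
      if s r is b :: l then (if b then o else z, upd s r l) else (e, s)
  | Some (IGo nx) => (nx, s)
  end.

Definition reg_of (i : instr) : nat :=
  match i with IPush r _ _ => r | IPop r _ _ _ => r | IGo _ => 0 end.

Definition target (i : instr) (f : nat) : nat :=
  match i with
  | IPush _ _ nx | IGo nx => nx
  | IPop _ e z o => match f with 0 => e | 1 => z | _ => o end
  end.

(** Stack 0 occupies the cells of the input word and can only shrink, so it must not be pushed
    on. *)
Definition wf_instr (m B : nat) (i : instr) : bool :=
  [&& reg_of i <= m, if i is IPush 0 _ _ then false else true
    & all (fun f => target i f < B) (iota 0 3)].

Lemma onth_all (A : Type) (a : pred A) (s : seq A) i x :
  all a s -> onth s i = Some x -> a x.
Proof. by elim: s i => [|y s IH] [|i] //= /andP[ay as_] => [[<-]|/(IH _ as_)]. Qed.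

Section Simulation.
Variables (P : seq instr) (m B : nat) (acc : nat -> bool).
Hypothesis B0 : 0 < B.
Hypothesis wfP : all (wf_instr m B) P.

Local Notation state := (nat * nat * nat * nat)%type.
Local Notation W := m.+1.

(* Stack [r > 0] is written on every [m + 1]-st cell to the left of the home
   cell, bottom first; track 0 carries a single mark, next to the home cell.
   Stack 0 is the input, whose top is its last symbol.  A state consists of a
   program counter, a phase, a counter of remaining moves and the outcome of
   the current instruction. *)
Definition tdelta (q : state) (s : sym) : option (state * sym * move) :=
  let: (pc, ph, c, f) := q in
  match ph with
  | 7 => Some (0, 8, 0, 0, s, MoveL)
  | 8 => Some (0, 9, 0, 0, s, MoveL)
  | 9 => Some (0, 0, 0, 0, Some true, MoveR)
  | _ =>
    if onth P pc is Some i then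
      match ph with
      | 0 => match i with
             | IGo nx => Some (nx, 0, 0, 0, s, Stay)
             | IPop 0 _ _ _ => Some (pc, 4, 0, 0, s, MoveR)
             | _ => Some (pc, 1, reg_of i, 0, s, MoveL)
             end
      | 1 => if c is c'.+1 then Some (pc, 1, c', f, s, MoveL)
             else if s is Some _ then Some (pc, 1, m, 1, s, MoveL)
             else if i is IPush r b _ then Some (pc, 2, r, 0, Some b, Stay)
             else if f is 0 then Some (pc, 2, reg_of i, 0, s, Stay)
             else Some (pc, 3, m, 0, s, MoveR)
      | 2 => if c is c'.+1 then Some (pc, 2, c', f, s, MoveR)
             else if s is Some _ then Some (target i f, 0, 0, 0, s, MoveR)
             else Some (pc, 2, m, f, s, MoveR)
      | 3 => if c is c'.+1 then Some (pc, 3, c', f, s, MoveR)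
             else Some (pc, 2, reg_of i, if s is Some true then 2 else 1, None, Stay)
      | 4 => if s is Some _ then Some (pc, 4, 0, 0, s, MoveR)
             else Some (pc, 5, 0, 0, s, MoveL)
      | 5 => if s is Some b then Some (pc, 6, 0, if b then 2 else 1, None, MoveL)
             else Some (target i 0, 0, 0, 0, s, Stay)
      | 6 => if s is Some _ then Some (pc, 6, 0, f, s, MoveL)
             else Some (target i f, 0, 0, 0, s, Stay)
      | _ => None
      end
    else None
  end.

Definition box : seq state :=
  [seq (x, f) | x <- [seq (x, c) | x <- [seq (pc, ph) | pc <- iota 0 B, ph <- iota 0 10],
     c <- iota 0 W], f <- iota 0 3].

Lemma mem_box pc ph c f :
  ((pc, ph, c, f) \in box) = [&& pc < B, ph < 10, c <= m & f < 3].
Proof.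
have mem_pairs (A C : eqType) (s : seq A) (t : seq C) x y :
    ((x, y) \in [seq (a, b) | a <- s, b <- t]) = (x \in s) && (y \in t).
  apply/allpairsP/andP => [[[a b] [/= ? ? [-> ->]]]|[? ?]] //.
  by exists (x, y).
by rewrite !mem_pairs !mem_iota /= !add0n ltnS -!andbA.
Qed.

Definition tstart : state := (0, 7, 0, 0).

Lemma tdelta_closed q s q' s' d : q \in tstart :: box ->
  tdelta q s = Some (q', s', d) -> q' \in tstart :: box.
Proof.
move=> qq H; rewrite inE; apply/orP; right.
have {}qq : q \in box by move: qq; rewrite inE => /orP[/eqP ->|//]; rewrite mem_box B0.
move: q qq H => [[[pc ph] c] f]; rewrite mem_box => /and4P[pcB ph9 cm f3] H.
have wfi i : onth P pc = Some i -> wf_instr m B i.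
  exact: onth_all.
move: H; case: ph ph9 => [|[|[|[|[|[|[|[|[|[|ph]]]]]]]]]] //= _;
  try (by case=> <- _ _; rewrite mem_box B0);
  case: (onth P pc) wfi => [i|] // /(_ i erefl) /and3P[rm _ /and4P[t0 t1 t2 _]].
- case: i rm t0 t1 t2 => [r b nx|[|r] e z o|nx] /= rm t0 t1 t2 [<- _ _];
  by rewrite mem_box ?pcB ?t0 ?rm.
- case: c cm => [|c] cm; last by case=> <- _ _; rewrite mem_box pcB f3 (ltnW cm).
  case: s => [b [<- _ _]|]; first by rewrite mem_box pcB leqnn.
  case: i rm t0 t1 t2 => [r b nx|r e z o|nx] /= rm t0 t1 t2.
  + by case=> <- _ _; rewrite mem_box pcB rm.
  + by case: f f3 => [|f] _ [<- _ _]; rewrite mem_box pcB ?rm ?leqnn.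
  + by case: f f3 => [|f] _ [<- _ _]; rewrite mem_box pcB ?rm ?leqnn.
- case: c cm => [|c] cm; last by case=> <- _ _; rewrite mem_box pcB f3 (ltnW cm).
  case: s => [b [<- _ _]|[<- _ _]]; rewrite mem_box ?pcB ?leqnn ?f3 // andbT.
  by case: f f3 => [|[|[|f]]].
- case: c cm => [|c] cm; case=> <- _ _; rewrite mem_box pcB ?f3 ?(ltnW cm) ?rm //.
  by case: s => [[]|].
- by case: s => [b|] [<- _ _]; rewrite mem_box pcB.
- by case: s => [b|] [<- _ _]; rewrite mem_box ?pcB ?t0 //; case: b.
- case: s => [b|] [<- _ _]; rewrite mem_box ?pcB ?f3 // andbT.
  by case: f f3 => [|[|[|f]]].
Qed.

Definition tm_of : TM := machine tstart box tdelta (fun q => acc q.1.1.1).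

Definition tape (H : nat) (s : stacks) : nat -> sym := fun x =>
  if x < H then
    if H - size (s 0) <= x then nth None (map Some (s 0)) (x - (H - size (s 0))) else None
  else if x == H then None
  else let y := x - H.+1 in
    if y %% W == 0 then (if y %/ W == 0 then Some true else None)
    else nth None (map Some (rev (s (y %% W)))) (y %/ W).

Definition cell (H r j : nat) : nat := H.+1 + (j * W + r).

Lemma tape_cell H s r j : r <= m -> tape H s (cell H r j) =
  if r == 0 then (if j == 0 then Some true else None)
  else nth None (map Some (rev (s r))) j.
Proof.
move=> rm; rewrite /tape /cell ltnNge ltnW ?ltnS ?leq_addr //= ifF; last by lia.
by rewrite addKn modnMDl modn_small // divnMDl // divn_small // addn0.
Qed.

Lemma cellP H x : H < x -> exists r j, r <= m /\ x = cell H r j.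
Proof.
move=> Hx; exists ((x - H.+1) %% W), ((x - H.+1) %/ W); split.
  by rewrite -ltnS ltn_pmod.
by rewrite /cell -divn_eq subnKC.
Qed.

Lemma cell_inj H r j r' j' : r <= m -> r' <= m ->
  (cell H r j == cell H r' j') = (r == r') && (j == j').
Proof.
move=> rm rm'; apply/eqP/andP => [|[/eqP -> /eqP ->]] // /addnI E.
have := congr1 (fun x => x %% W) E; rewrite !modnMDl !modn_small // => Er.
have := congr1 (fun x => x %/ W) E; rewrite !divnMDl // !divn_small // !addn0 => ->.
by rewrite Er.
Qed.

Lemma tape_upd H s r l j v : 0 < r <= m ->
  (forall i, nth None (map Some (rev l)) i =
     if i == j then v else nth None (map Some (rev (s r))) i) ->
  tape H (upd s r l) = upd (tape H s) (cell H r j) v.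
Proof.
move=> /andP[r0 rm] E; apply: functional_extensionality => x.
case: (ltngtP x H) => Hx.
- rewrite /upd ifF; last by rewrite /cell; lia.
  by rewrite /tape Hx /= /upd; case: r r0 {E rm}.
- have [r' [j' [rm' ->]]] := cellP Hx.
  rewrite [RHS]/upd cell_inj // !tape_cell // [in LHS]/upd.
  case: (eqVneq r' r) => [->|] /=; last by [].
  by rewrite eqn0Ngt r0 /= E.
- by rewrite /upd ifF; [rewrite Hx /tape ltnn eqxx|rewrite /cell; lia].
Qed.

Lemma tape_push H s r b : 0 < r <= m ->
  tape H (upd s r (b :: s r)) = upd (tape H s) (cell H r (size (s r))) (Some b).
Proof.
move=> r0; apply: tape_upd => // i.
rewrite rev_cons map_rcons nth_rcons size_map size_rev.
by case: ltngtP => // Hi; rewrite nth_default // size_map size_rev ltnW.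
Qed.

Lemma tape_pop H s r b l : 0 < r <= m -> s r = b :: l ->
  tape H (upd s r l) = upd (tape H s) (cell H r (size l)) None.
Proof.
move=> r0 E; apply: tape_upd => // i; rewrite E.
rewrite rev_cons map_rcons nth_rcons size_map size_rev.
by case: ltngtP => // Hi; apply: nth_default; rewrite size_map size_rev ?Hi // ltnW.
Qed.

Lemma out_moves pc i f T x c : onth P pc = Some i ->
  areach tdelta (pc, 1, c, f) T x (pc, 1, 0, f) T (x + c) c.
Proof.
move=> Pi; elim: c x => [|c IH] x; first by rewrite addn0; apply: AStop.
by apply: ALeft; [by rewrite /= Pi|rewrite upd_same -addSnnS; apply: IH].
Qed.

Lemma back_moves pc i ph f T x c : onth P pc = Some i -> (ph == 2) || (ph == 3) ->
  areach tdelta (pc, ph, c, f) T (x + c) (pc, ph, 0, f) T x c.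
Proof.
move=> Pi Hph; elim: c => [|c IH]; first by rewrite addn0; apply: AStop.
rewrite addnS; apply: (ARight (q' := (pc, ph, c, f)) (s := T (x + c).+1)).
  by case/orP: Hph => /eqP ->; rewrite /= Pi.
by rewrite upd_same; apply: IH.
Qed.

Lemma cellE H r j : cell H r j = cell H 0 j + r.
Proof. by rewrite /cell addn0 addnA. Qed.

Lemma cellS H r j : cell H r j.+1 = (cell H r j).+1 + m.
Proof. by rewrite /cell mulSn; lia. Qed.

Lemma out_scan pc i f H s r j : onth P pc = Some i -> 0 < r <= m -> j <= size (s r) ->
  areach tdelta (pc, 1, 0, f) (tape H s) (cell H r j)
    (pc, 1, 0, if j < size (s r) then 1 else f) (tape H s) (cell H r (size (s r)))
    ((size (s r) - j) * W).
Proof.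
move=> Pi /andP[r0 rm] js; move Ek: (size (s r) - j) => k.
elim: k j f js Ek => [|k IH] j f js Ek.
  by rewrite (_ : j = size (s r)) ?ltnn; [apply: AStop|lia].
rewrite ifT; last lia.
have -> : k.+1 * W = (m + k * W).+1 by rewrite mulSn addSn.
have c0 : tape H s (cell H r j) = Some (nth false (rev (s r)) j).
  by rewrite tape_cell // eqn0Ngt r0 /= (nth_map false) // size_rev; lia.
apply: (ALeft (s := Some _)); first by rewrite /= Pi c0.
rewrite -c0 upd_same; apply: areach_trans (out_moves _ _ _ _ Pi) _; rewrite -cellS.
by have := IH j.+1 1 ltac:(lia) ltac:(lia); case: ifP.
Qed.

Lemma back_scan pc i f H s j : onth P pc = Some i ->
  areach tdelta (pc, 2, 0, f) (tape H s) (cell H 0 j) (target i f, 0, 0, 0) (tape H s) H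
    (j * W).+1.
Proof.
move=> Pi; elim: j => [|j IH].
  rewrite /cell mul0n !addn0; apply: (ARight (s := Some true)).
    by have := @tape_cell H s 0 0 isT; rewrite /cell mul0n !addn0 /= Pi => ->.
  have <- : tape H s H.+1 = Some true by have := @tape_cell H s 0 0 isT; rewrite /cell mul0n !addn0.
  by rewrite upd_same; apply: AStop.
have -> : (j.+1 * W).+1 = (m + (j * W).+1).+1 by rewrite mulSn; lia.
have c0 := @tape_cell H s 0 j.+1 isT; rewrite /= in c0.
rewrite cellS addSn in c0 *; apply: (ARight (s := None)).
  by rewrite c0 /= Pi.
by rewrite -c0 upd_same; apply: areach_trans IH; apply: back_moves Pi _.
Qed.

Lemma tape_input H s b l : s 0 = b :: l -> size (s 0) < H ->
  tape H (upd s 0 l) = upd (tape H s) (H - size (s 0)) None.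
Proof.
move=> E Hs; apply: functional_extensionality => x.
rewrite [RHS]/upd; rewrite E /= in Hs *; case: eqP => [->|Hx].
  by rewrite /tape {1}/upd /= ifT ?ifF //; lia.
rewrite /tape {1 2 3}/upd /= E /=.
case: (ltngtP x H) => HxH //.
  case: (leqP (H - (size l).+1) x) => H1; last by rewrite ifF //; lia.
  rewrite ifT; last lia.
  by rewrite (_ : x - (H - (size l).+1) = (x - (H - size l)).+1) //; lia.
by rewrite /upd; case: eqP.
Qed.

Definition instr_cost (h : nat) : nat := 4 * W * (h + 2).

(** Phase 1 walks outward on track [r] in strides of [m + 1] cells up to the first blank, where the
    bit is written; phase 2 shifts to track 0 and strides home until it meets the mark. *)
Lemma sim_push pc H s r b nx h : onth P pc = Some (IPush r b nx) -> size (s r) <= h ->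
  exists2 t, t <= instr_cost h &
  areach tdelta (pc, 0, 0, 0) (tape H s) H (nx, 0, 0, 0) (tape H (upd s r (b :: s r))) H t.
Proof.
move=> Pi sh; have /and3P[/= rm rn0 _] := onth_all wfP Pi.
have r0m : 0 < r <= m by case: r rm rn0 {Pi sh}.
have H1 : areach tdelta (pc, 0, 0, 0) (tape H s) H (pc, 1, 0, 0) (tape H s) (cell H r 0) r.+1.
  apply: ALeft; first by rewrite /= Pi.
  by rewrite upd_same /cell mul0n add0n; apply: out_moves Pi.
have H2 := out_scan 0 H Pi r0m (leq0n (size (s r))).
set f := if _ then _ else _ in H2.
have H3 : areach tdelta (pc, 1, 0, f) (tape H s) (cell H r (size (s r)))
    (pc, 2, 0, 0) (tape H (upd s r (b :: s r))) (cell H 0 (size (s r))) r.+1.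
  apply: AStay.
    rewrite /= Pi tape_cell // ifF; last by lia.
    by rewrite nth_default // size_map size_rev.
  by rewrite -tape_push // (cellE H r); apply: back_moves Pi _.
have H4 := back_scan 0 H (upd s r (b :: s r)) (size (s r)) Pi.
exists (r.+1 + ((size (s r) - 0) * W + (r.+1 + (size (s r) * W).+1))).
  rewrite /instr_cost subn0; have : size (s r) * W <= h * W by rewrite leq_mul2r sh orbT.
  by lia.
by do 3 (apply: areach_trans; first by eassumption).
Qed.

(** The outward walk stops one stride beyond the top symbol, and its outcome flag tells whether any
    symbol was met. If so, phase 3 goes back one stride, reads and erases the top, and the flag then
    carries the popped bit home. *)
Lemma sim_pop pc H s r e z o h : onth P pc = Some (IPop r e z o) -> 0 < r ->
  size (s r) <= h ->
  exists2 t, t <= instr_cost h &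
  areach tdelta (pc, 0, 0, 0) (tape H s) H
    ((istep P (pc, s)).1, 0, 0, 0) (tape H (istep P (pc, s)).2) H t.
Proof.
move=> Pi r0 sh; have /and3P[/= rm _ _] := onth_all wfP Pi.
have r0m : 0 < r <= m by rewrite r0.
have rn0 : (r == 0) = false by lia.
have H1 : areach tdelta (pc, 0, 0, 0) (tape H s) H (pc, 1, 0, 0) (tape H s) (cell H r 0) r.+1.
  apply: ALeft; first by rewrite /= Pi; case: r r0 {Pi sh rm r0m rn0}.
  by rewrite upd_same /cell mul0n add0n; apply: out_moves Pi.
have H2 := out_scan 0 H Pi r0m (leq0n (size (s r))).
have c0 : tape H s (cell H r (size (s r))) = None.
  by rewrite tape_cell // rn0 nth_default // size_map size_rev.
rewrite /= Pi; case E: (s r) => [|b l] in H2 c0 sh *.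
  have H3 : areach tdelta (pc, 1, 0, 0) (tape H s) (cell H r 0)
      (pc, 2, 0, 0) (tape H s) (cell H 0 0) r.+1.
    apply: AStay; first by rewrite /= Pi c0.
    by rewrite -c0 upd_same (cellE H r); apply: back_moves Pi _.
  exists (r.+1 + (r.+1 + 1)); first by rewrite /instr_cost; lia.
  apply: areach_trans H1 _; apply: areach_trans H3 _.
  exact: back_scan 0 H s 0 Pi.
have c1 : tape H s (cell H r (size l)) = Some b.
  rewrite tape_cell // rn0 E rev_cons map_rcons nth_rcons size_map size_rev.
  by rewrite ltnn eqxx.
set f := if b then 2 else 1.
have H3 : areach tdelta (pc, 1, 0, 1) (tape H s) (cell H r (size l).+1)
    (pc, 3, 0, 0) (tape H s) (cell H r (size l)) W.
  have c0' := c0; rewrite /= cellS addSn in c0' *.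
  apply: (ARight (s := None)); first by rewrite /= Pi c0'.
  by rewrite -c0' upd_same; apply: back_moves Pi _.
have H4 : areach tdelta (pc, 3, 0, 0) (tape H s) (cell H r (size l))
    (pc, 2, 0, f) (tape H (upd s r l)) (cell H 0 (size l)) r.+1.
  apply: (AStay (s := None) (q' := (pc, 2, r, f))); first by rewrite /= Pi c1 /f; case: (b).
  by rewrite -(tape_pop _ _ E) // (cellE H r); apply: back_moves Pi _.
have H5 := back_scan f H (upd s r l) (size l) Pi.
have tf : target (IPop r e z o) f = if b then o else z by rewrite /f; case: (b).
rewrite tf in H5.
exists (r.+1 + (((size l).+1 - 0) * W + (W + (r.+1 + (size l * W).+1)))).
  rewrite /instr_cost subn0 mulSn; have : (size l).+1 * W <= h * W by rewrite leq_mul2r sh orbT.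
  by rewrite mulSn; lia.
by do 4 (apply: areach_trans; first by eassumption).
Qed.

(** Phase 4 runs right to the blank after the remaining input, phase 5 erases the last symbol, phase
    6 returns to the blank home cell. The bound [size (s 0) < H] leaves room for the blank on the
    right. *)
Lemma sim_input pc H s e z o h : onth P pc = Some (IPop 0 e z o) ->
  size (s 0) < H -> size (s 0) <= h ->
  exists2 t, t <= instr_cost h &
  areach tdelta (pc, 0, 0, 0) (tape H s) H
    ((istep P (pc, s)).1, 0, 0, 0) (tape H (istep P (pc, s)).2) H t.
Proof.
move=> Pi sH sh.
have tH (s' : stacks) : tape H s' H = None by rewrite /tape ltnn eqxx.
have tin (s' : stacks) x : x < size (s' 0) -> size (s' 0) < H ->
    tape H s' (H - x.+1) = Some (nth false (s' 0) (size (s' 0) - x.+1)).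
  move=> xs sH'; rewrite /tape !ifT; try lia.
  by rewrite (nth_map false); [congr (Some (nth _ _ _))|]; lia.
have H1 : forall k, k <= size (s 0) ->
    areach tdelta (pc, 4, 0, 0) (tape H s) (H - k.+1) (pc, 4, 0, 0) (tape H s)
      (H - (size (s 0)).+1) (size (s 0) - k).
  move=> k ks; move Ed: (size (s 0) - k) => d; elim: d k ks Ed => [|d IH] k ks Ed.
    by rewrite (_ : k = size (s 0)); [apply: AStop|lia].
  have c1 := tin s k ltac:(lia) sH.
  rewrite (_ : H - k.+1 = (H - k.+2).+1) in c1 *; last by lia.
  apply: (ARight (s := Some _)); first by rewrite /= Pi c1.
  by rewrite -c1 upd_same; apply: IH; lia.
have H0 : areach tdelta (pc, 0, 0, 0) (tape H s) H (pc, 4, 0, 0) (tape H s) (H - 1) 1.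
  have [H' ->] : exists H', H = H'.+1 by exists H.-1; lia.
  by rewrite subn1; apply: ARight; [by rewrite /= Pi|rewrite upd_same; apply: AStop].
have cE : tape H s (H - (size (s 0)).+1) = None.
  by rewrite /tape ifT; [rewrite ifF //; lia | lia].
have H2 : areach tdelta (pc, 4, 0, 0) (tape H s) (H - (size (s 0)).+1)
   (pc, 5, 0, 0) (tape H s) (H - size (s 0)) 1.
  rewrite (_ : H - size (s 0) = (H - (size (s 0)).+1).+1); last by lia.
  apply: ALeft; first by rewrite /= Pi cE.
  by rewrite -cE upd_same; apply: AStop.
have H01 := areach_trans H0 (areach_trans (H1 0 (leq0n _)) H2).
rewrite /= Pi; case E: (s 0) => [|b l].
  rewrite E /= !subn0 in H01; exists (1 + (0 + 1) + 1); first by rewrite /instr_cost; lia.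
  apply: areach_trans H01 _; apply: AStay; first by rewrite /= Pi tH.
  by rewrite -(tH s) upd_same; apply: AStop.
set f := if b then 2 else 1.
have H3 : areach tdelta (pc, 5, 0, 0) (tape H s) (H - size (s 0)) (pc, 6, 0, f)
    (tape H (upd s 0 l)) (H - size l) 1.
  rewrite (_ : H - size l = (H - size (s 0)).+1); last by rewrite E /= in sH *; lia.
  apply: (ALeft (s := None)).
    have := tin s (size l); rewrite E /= subnn in sH * => c1.
    by rewrite c1 // Pi /f; case: (b).
  by rewrite (tape_input E) //; apply: AStop.
have H4 : forall k, k <= size l -> areach tdelta (pc, 6, 0, f)
    (tape H (upd s 0 l)) (H - k) (pc, 6, 0, f) (tape H (upd s 0 l)) H k.
  have lH : size l < H by rewrite E /= in sH; lia.
  elim=> [|k IH] kl; first by rewrite subn0; apply: AStop.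
  have c1 := tin (upd s 0 l) k kl lH.
  apply: (ALeft (s := Some _)); first by rewrite /= Pi c1.
  by rewrite -c1 upd_same (_ : (H - k.+1).+1 = H - k); [apply: IH|]; lia.
exists (1 + (size (s 0) - 0 + 1) + (1 + (size l + 1))).
  have : 4 * (h + 2) <= instr_cost h by rewrite leq_mul2r leq_pmulr // orbT.
  by rewrite E /= in sh *; lia.
apply: areach_trans H01 _; apply: areach_trans H3 _; apply: areach_trans (H4 _ (leqnn _)) _.
apply: (AStay (s := None) (q' := (if b then o else z, 0, 0, 0))).
  by rewrite /= Pi tH /f; case: (b).
by rewrite -(tH (upd s 0 l)) upd_same; apply: AStop.
Qed.

(** A step adds at most one symbol to a stack, so height plus remaining steps never grows and one
    [h] serves for the whole run. Stack 0 never grows and stays to the right of the home cell. *)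
Lemma sim_steps k H pc s h : (forall r, size (s r) + k <= h) -> size (s 0) < H ->
  exists2 t, t <= k * instr_cost h &
  areach tdelta (pc, 0, 0, 0) (tape H s) H
    ((iter k (istep P) (pc, s)).1, 0, 0, 0) (tape H (iter k (istep P) (pc, s)).2) H t.
Proof.
elim: k pc s => [|k IH] pc s sh sH; first by exists 0 => //; apply: AStop.
have step1 : exists2 t, t <= instr_cost h & areach tdelta (pc, 0, 0, 0) (tape H s) H
    ((istep P (pc, s)).1, 0, 0, 0) (tape H (istep P (pc, s)).2) H t.
  have sr r : size (s r) <= h by have := sh r; lia.
  case Pi: (onth P pc) => [[r b nx|[|r] e z o|nx]|].
  - by rewrite /= Pi; apply: sim_push Pi _.
  - exact: sim_input Pi _ _.
  - exact: sim_pop Pi _ _.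
  - exists 1; first by rewrite /instr_cost !muln_gt0 addn_gt0 orbT.
    apply: AStay; first by rewrite /= Pi.
    by rewrite upd_same /= Pi; apply: AStop.
  - by exists 0 => //; rewrite /= Pi; apply: AStop.
case: step1 => t1 t1h R1; rewrite iterSr.
case E: (istep P (pc, s)) R1 => [pc' s'] R1.
have [r|//|t2 t2h R2] := IH pc' s'.
  have : size (s' r) <= (size (s r)).+1.
    move: E => /=; case: (onth P pc) => [[r' b nx|r' e z o|nx]|] /=.
    + by case=> _ <-; rewrite /upd; case: eqP => [->|].
    + case E: (s r') => [|b l] [_ <-] //; rewrite /upd; case: eqP => [->|] //.
      by rewrite E /=; lia.
    + by case=> _ <-.
    + by case=> _ <-.
  by have := sh r; lia.
- move: E => /=; case Pi: (onth P pc) => [[r' b nx|r' e z o|nx]|] /=.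
  + by have /and3P[_ + _] := onth_all wfP Pi; case: r' {Pi} => // r' _ [_ <-].
  + case E: (s r') => [|b l] [_ <-] //; rewrite /upd; case: eqP => // r0.
    by move: sH; rewrite r0 E /=; lia.
  + by case=> _ <-.
  + by case=> _ <-.
exists (t1 + t2); first by rewrite mulSn; lia.
exact: areach_trans R1 R2.
Qed.

Definition init_stacks (w : seq bool) : stacks := fun r => if r == 0 then rev w else [::].

Lemma tape_init w : tape (size w).+1 (init_stacks w) =
  upd (input_tape w) (size w).+2 (Some true).
Proof.
apply: functional_extensionality => x.
rewrite /tape /upd /input_tape /= size_rev.
case: (ltngtP x (size w).+1) => Hx.
- rewrite [RHS]ifF; last by lia.
  rewrite subSn // subnn; case: x Hx => [|x] Hx //=; rewrite subn1 /=.
  by rewrite (nth_map false) ?size_rev ?ifT //; lia.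
- case: (x =P (size w).+2) => [->|ne]; first by rewrite subnn mod0n div0n.
  rewrite [RHS]ifF; last by lia.
  case: ifP => [m0|mn0]; last by rewrite /init_stacks mn0 nth_nil.
  case: ifP => // d0; have := divn_eq (x - (size w).+2) W.
  by rewrite (eqP m0) (eqP d0); lia.
- by rewrite [RHS]ifF ?ifF //; lia.
Qed.

Theorem flowchart_runs w k pc s t :
  iter k (istep P) (0, init_stacks w) = (pc, s) -> onth P pc = None ->
  k * instr_cost (size w + k) + 3 <= t -> runs_within tm_of w t (acc pc).
Proof.
move=> E Pn ht.
have [r||t' th R] := @sim_steps k (size w).+1 0 (init_stacks w) (size w + k).
- by rewrite /init_stacks; case: ifP; rewrite ?size_rev //=; lia.
- by rewrite /= size_rev.
rewrite E /= tape_init in R.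
(* Phases 7, 8 and 9 cross the home cell, write the mark beyond it and return: this is the 3 in the
   time bound. *)
have Ri : areach tdelta tstart (input_tape w) (size w) (0, 0, 0, 0)
    (upd (input_tape w) (size w).+2 (Some true)) (size w).+1 3.
  apply: ALeft; first by []. rewrite upd_same.
  apply: ALeft; first by []. rewrite upd_same.
  by apply: ARight; [by []|apply: AStop].
have := @runs_within_machine _ tstart box tdelta (fun q => acc q.1.1.1) tdelta_closed
  w _ _ _ _ t (areach_trans Ri R).
by apply; [rewrite /= Pn|lia].
Qed.

End Simulation.

(** * Structured stack programs *)

Local Arguments onth : simpl never.

(* [Loop r p0 p1 once0] pops [r] until it is empty and runs [p0] or [p1]
   according to the popped bit; with [once0] it also stops after the first 0. *)
Inductive prog :=
| Skip
| Push of nat & bool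
| Seq of prog & prog
| If of nat & prog & prog & prog
| Loop of nat & prog & prog & bool.

(** The last index is an upper bound on the number of flowchart steps, not the exact number, so that
    costs can be rounded up freely. *)
Inductive exec : prog -> stacks -> stacks -> nat -> Prop :=
| XSkip s t : exec Skip s s t
| XPush r b s t : 0 < t -> exec (Push r b) s (upd s r (b :: s r)) t
| XSeq p q s s1 s2 t1 t2 t : exec p s s1 t1 -> exec q s1 s2 t2 -> t1 + t2 <= t ->
    exec (Seq p q) s s2 t
| XIfE r pe p0 p1 s s' t1 t : s r = [::] -> exec pe s s' t1 -> t1 + 2 <= t ->
    exec (If r pe p0 p1) s s' t
| XIf r pe p0 p1 s s' b l t1 t : s r = b :: l ->
    exec (if b then p1 else p0) (upd s r l) s' t1 -> t1 + 2 <= t ->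
    exec (If r pe p0 p1) s s' t
| XLoopE r p0 p1 o s t : s r = [::] -> 0 < t -> exec (Loop r p0 p1 o) s s t
| XLoopX r p0 p1 s l s' t1 t : s r = false :: l -> exec p0 (upd s r l) s' t1 ->
    t1 + 2 <= t -> exec (Loop r p0 p1 true) s s' t
| XLoop r p0 p1 o s b l s1 s' t1 t2 t : s r = b :: l -> b || ~~ o ->
    exec (if b then p1 else p0) (upd s r l) s1 t1 ->
    exec (Loop r p0 p1 o) s1 s' t2 -> t1 + t2 + 2 <= t ->
    exec (Loop r p0 p1 o) s s' t.

Fixpoint len (p : prog) : nat :=
  match p with
  | Skip => 0
  | Push _ _ => 1
  | Seq p q => len p + len q
  | If _ p q r => len p + len q + len r + 3
  | Loop _ p q _ => len p + len q + 3
  end.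

(* Control leaves the code at address [a + len p]. *)
Fixpoint code (p : prog) (a : nat) : seq instr :=
  match p with
  | Skip => [::]
  | Push r b => [:: IPush r b a.+1]
  | Seq p q => code p a ++ code q (a + len p)
  | If r pe p0 p1 =>
      let a0 := (a + len pe).+2 in let a1 := (a0 + len p0).+1 in
      IPop r a.+1 a0 a1 :: code pe a.+1 ++ IGo (a1 + len p1) ::
      code p0 a0 ++ IGo (a1 + len p1) :: code p1 a1
  | Loop r p0 p1 o =>
      let a1 := (a + len p0).+2 in let z := (a1 + len p1).+1 in
      IPop r z a.+1 a1 :: code p0 a.+1 ++ IGo (if o then z else a) ::
      code p1 a1 ++ [:: IGo a]
  end.

Lemma size_code p a : size (code p a) = len p.
Proof.
elim: p a => //= [p IHp q IHq|r pe IHe p0 IH0 p1 IH1|r p0 IH0 p1 IH1 o] a;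
rewrite ?size_cat /= ?size_cat /= ?size_cat /= ?IHp ?IHq ?IHe ?IH0 ?IH1; lia.
Qed.

Lemma onth_code (u v : seq instr) (x : instr) : onth (u ++ x :: v) (size u) = Some x.
Proof. by elim: u. Qed.

Definition placed (P : seq instr) (p : seq instr) (a : nat) : Prop :=
  exists u v, P = u ++ p ++ v /\ size u = a.

Lemma placed_cat P p q a : placed P (p ++ q) a -> placed P p a /\ placed P q (a + size p).
Proof.
move=> [u [v [-> <-]]]; split; first by exists u, (q ++ v); rewrite -catA.
by exists (u ++ p), v; rewrite !catA size_cat.
Qed.

Lemma placed_cons P i q a : placed P (i :: q) a -> onth P a = Some i /\ placed P q a.+1.
Proof.
rewrite -cat1s => /placed_cat[[u [v [-> <-]]]]; rewrite addn1; split=> //.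
exact: onth_code.
Qed.

Lemma exec_code p s s' t : exec p s s' t -> forall P a, placed P (code p a) a ->
  exists2 k, k <= t & iter k (istep P) (a, s) = (a + len p, s').
Proof.
have iter_add P k1 c c1 k2 c2 : iter k1 (istep P) c = c1 -> iter k2 (istep P) c1 = c2 ->
    iter (k1 + k2) (istep P) c = c2 by rewrite addnC iterD => -> ->.
elim=> {p s s' t}.
- by move=> s t P a _; exists 0; rewrite ?addn0.
- move=> r b s t t0 P a /placed_cons[Pa _]; exists 1 => //=.
  by rewrite Pa addn1.
- move=> p q s s1 s2 t1 t2 t _ IH1 _ IH2 tt P a /placed_cat[/IH1 [k1 k1t E1]].
  rewrite size_code => /IH2 [k2 k2t E2]; exists (k1 + k2); first by lia.
  by rewrite addnA; apply: iter_add E1 E2.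
- move=> r pe p0 p1 s s' t1 t sr _ IH tt P a /placed_cons[Pa] /placed_cat[/IH [k kt E]].
  rewrite size_code [a.+1 + _]addSn => /placed_cons[Pg _]; exists (1 + (k + 1)); first by lia.
  apply: (iter_add _ _ _ (a.+1, s)); first by rewrite /= Pa sr.
  by apply: iter_add E _; rewrite /= [a.+1 + _]addSn Pg; congr pair; rewrite /=; lia.
- move=> r pe p0 p1 s s' b l t1 t sr _ IH tt P a /placed_cons[Pa] /placed_cat[_].
  rewrite size_code [a.+1 + _]addSn => /placed_cons[_] /placed_cat[H0].
  rewrite size_code !addSn => /placed_cons[Pg H1].
  case: b sr IH => sr IH.
  + have [k kt E] := IH P _ H1; exists (1 + k); first by lia.
    apply: (iter_add _ _ _ (((a + len pe).+2 + len p0).+1, upd s r l)).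
      by rewrite /= Pa sr.
    by rewrite E; congr pair; rewrite /=; lia.
  + have [k kt E] := IH P _ H0; exists (1 + (k + 1)); first by lia.
    apply: (iter_add _ _ _ ((a + len pe).+2, upd s r l)); first by rewrite /= Pa sr.
    by apply: iter_add E _; rewrite /= ?addSn Pg; congr pair; rewrite /=; lia.
- move=> r p0 p1 o s t sr t0 P a /placed_cons[Pa _]; exists 1 => //.
  by rewrite /= Pa sr; congr pair; lia.
- move=> r p0 p1 s l s' t1 t sr _ IH tt P a /placed_cons[Pa] /placed_cat[/IH [k kt E]].
  rewrite size_code [a.+1 + _]addSn => /placed_cons[Pg _]; exists (1 + (k + 1)); first by lia.
  apply: (iter_add _ _ _ (a.+1, upd s r l)); first by rewrite /= Pa sr.
  by apply: iter_add E _; rewrite /= ?addSn Pg; congr pair; rewrite /=; lia.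
- move=> r p0 p1 o s b l s1 s' t1 t2 t sr bo _ IH _ IHL tt P a pl.
  have [k2 k2t E2] := IHL P a pl.
  move: pl => /placed_cons[Pa] /placed_cat[H0].
  rewrite size_code [a.+1 + _]addSn => /placed_cons[Pg0] /placed_cat[H1].
  rewrite size_code => /placed_cons[Pg1 _].
  case: b sr bo IH => sr bo IH.
  + have [k kt E] := IH P _ H1; exists (1 + (k + (1 + k2))); first by lia.
    apply: (iter_add _ _ _ ((a + len p0).+2, upd s r l)); first by rewrite /= Pa sr.
    apply: (iter_add _ _ _ _ _ _ E); apply: iter_add E2.
    by rewrite /= ?addSn Pg1.
  + have [k kt E] := IH P _ H0; exists (1 + (k + (1 + k2))); first by lia.
    apply: (iter_add _ _ _ (a.+1, upd s r l)); first by rewrite /= Pa sr.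
    apply: (iter_add _ _ _ _ _ _ E); apply: iter_add E2.
    by rewrite /= ?addSn Pg0; case: (o) bo.
Qed.

(** * A first-order language over binary trees *)

Inductive tree := N | C of tree & tree.

(** A prefix code: the end of a tree is found by counting, so a register needs no separators, and
    the first bit tells [N] from a pair. *)
Fixpoint ser (t : tree) : seq bool :=
  if t is C a b then true :: ser a ++ ser b else [:: false].

Lemma ser_inj_cat a b u v : ser a ++ u = ser b ++ v -> a = b /\ u = v.
Proof.
elim: a b u v => [|a IHa a' IHa'] [|b b'] u v //=; first by case.
by case; rewrite -!catA => /IHa [-> /IHa' [-> ->]].
Qed.

Lemma ser_inj : injective ser.
Proof. by move=> a b E; have [] := @ser_inj_cat a b [::] [::]; rewrite ?cats0. Qed.

HB.instance Definition _ := Equality.copy tree (inj_type ser_inj).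

Fixpoint elems (t : tree) : seq tree := if t is C a b then a :: elems b else [::].
Definition lst : seq tree -> tree := foldr C N.
Definition tsz (t : tree) : nat := size (ser t).

Lemma elemsK : cancel elems lst. Proof. by elim=> //= a _ b ->. Qed.
Lemma lstK : cancel lst elems. Proof. by elim=> //= a s ->. Qed.

(** The code of a list without its closing 0; on spines, concatenation of lists is concatenation of
    words. *)
Definition spine (s : seq tree) : seq bool := flatten [seq true :: ser x | x <- s].

Lemma ser_lst s : ser (lst s) = rcons (spine s) false.
Proof. by elim: s => //= a s ->; rewrite -rcons_cat. Qed.

(** Iteration runs only over the elements of an already computed list, so evaluation terminates and
    its time is polynomial in the size of the values that occur. [For] concatenates the lists
    produced by its body and so covers map, filter and concatenation. *)
Inductive expr :=
| Var of nat
| Nilx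
| Pair of expr & expr
| Eq of expr & expr
| Case of expr & expr & expr
| For of expr & expr
| Fold of expr & expr & expr.

(* Variables are de Bruijn levels: a binder appends to the environment. *)
Fixpoint ev (e : expr) (env : seq tree) : tree :=
  match e with
  | Var i => nth N env i
  | Nilx => N
  | Pair a b => C (ev a env) (ev b env)
  | Eq a b => if ev a env == ev b env then C N N else N
  | Case a b c => if ev a env is C x y then ev c (env ++ [:: x; y]) else ev b env
  | For a b => lst (flatten [seq elems (ev b (env ++ [:: x])) | x <- elems (ev a env)])
  | Fold a b c =>
      foldl (fun acc x => ev c (env ++ [:: acc; x])) (ev b env) (elems (ev a env))
  end.

Fixpoint maxfold (A : Type) (g : A -> tree -> nat) (h : A -> tree -> A) (acc : A)
    (s : seq tree) : nat :=
  if s is x :: s' then maxn (g acc x) (maxfold g h (h acc x) s') else 0.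

Fixpoint sz (e : expr) (env : seq tree) : nat :=
  maxn (tsz (ev e env))
  match e with
  | Var _ | Nilx => 0
  | Pair a b | Eq a b => maxn (sz a env) (sz b env)
  | Case a b c =>
      maxn (sz a env) (if ev a env is C x y then sz c (env ++ [:: x; y]) else sz b env)
  | For a b => maxn (sz a env) (\max_(x <- elems (ev a env)) sz b (env ++ [:: x]))
  | Fold a b c => maxn (sz a env) (maxn (sz b env)
      (maxfold (fun acc x => sz c (env ++ [:: acc; x]))
         (fun acc x => ev c (env ++ [:: acc; x])) (ev b env) (elems (ev a env))))
  end.

Definition mv (i j : nat) : prog := Loop i (Push j false) (Push j true) false.
Definition clear (i : nat) : prog := Loop i Skip Skip false.

Definition copy (i d : nat) : prog :=
  Seq (mv i (d + 1))
      (Loop (d + 1) (Seq (Push i false) (Push d false)) (Seq (Push i true) (Push d true)) false).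

(* Splits the first tree off register [d] and puts it into [d + 2]; the register
   [d + 4] counts the trees that remain to be read. *)
Definition split_body (d : nat) : prog :=
  If (d + 0) Skip (Push (d + 3) false)
    (Seq (Push (d + 3) true) (Seq (Push (d + 4) true) (Push (d + 4) true))).
Definition split (d : nat) : prog :=
  Seq (Push (d + 4) true)
    (Seq (Loop (d + 4) (split_body d) (split_body d) false) (mv (d + 3) (d + 2))).

(** [rho] lists the registers of the variables, all below [d]. The registers from [d] on are empty
    at the start, and at the end only [d] is filled, with the code of the value. *)
Fixpoint emit (e : expr) (rho : seq nat) (d : nat) : prog :=
  match e with
  | Var i => copy (nth 1 rho i) d
  | Nilx => Push (d + 0) false
  | Pair a b => Seq (emit a rho d) (Seq (emit b rho (d + 1))
      (Seq (mv (d + 0) (d + 2)) (Seq (mv (d + 1) (d + 3)) (Seq (mv (d + 3) (d + 0))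
      (Seq (mv (d + 2) (d + 0)) (Push (d + 0) true))))))
  | Eq a b => let f := Push (d + 2) true in
      Seq (emit a rho d) (Seq (emit b rho (d + 1))
      (Seq (Loop (d + 0) (If (d + 1) f Skip f) (If (d + 1) f f Skip) false)
      (Seq (Loop (d + 1) f f false)
      (If (d + 2) (Seq (Push (d + 0) false) (Seq (Push (d + 0) false) (Push (d + 0) true)))
         Skip (Seq (clear (d + 2)) (Push (d + 0) false))))))
  | Case a b c => Seq (emit a rho d) (If (d + 0) Skip (emit b rho d)
      (Seq (split d) (Seq (emit c (rho ++ [:: d + 2; d + 0]) (d + 3))
      (Seq (clear (d + 0)) (Seq (clear (d + 2))
      (Seq (mv (d + 3) (d + 1)) (mv (d + 1) (d + 0))))))))
  | For a b => Seq (emit a rho d)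
      (Seq (Loop (d + 0) Skip
         (Seq (split d) (Seq (emit b (rho ++ [:: d + 2]) (d + 3))
         (Seq (clear (d + 2)) (Seq (mv (d + 3) (d + 1)) (If (d + 1) Skip Skip Skip))))) true)
      (Seq (Push (d + 1) false) (mv (d + 1) (d + 0))))
  | Fold a b c => Seq (emit a rho d) (Seq (emit b rho (d + 1))
      (Seq (Loop (d + 0) Skip
         (Seq (split d) (Seq (emit c (rho ++ [:: d + 1; d + 2]) (d + 3))
         (Seq (clear (d + 1)) (Seq (clear (d + 2))
         (Seq (mv (d + 3) (d + 2)) (mv (d + 2) (d + 1))))))) true)
      (Seq (mv (d + 1) (d + 2)) (mv (d + 2) (d + 0)))))
  end.

Fixpoint cost (e : expr) (n : nat) : nat :=
  match e with
  | Var _ | Nilx => 50 * n.+1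
  | Pair a b | Eq a b => cost a n + cost b n + 50 * n.+1
  | Case a b c => cost a n + cost b n + cost c n + 50 * n.+1
  | For a b => cost a n + n * (cost b n + 50 * n.+1) + 50 * n.+1
  | Fold a b c => cost a n + cost b n + n * (cost c n + 50 * n.+1) + 50 * n.+1
  end.

Definition ext (s : stacks) (d : nat) (l : seq (seq bool)) : stacks :=
  fun z => if z < d then s z else nth [::] l (z - d).

Lemma ext_lt s d l z : z < d -> ext s d l z = s z.
Proof. by rewrite /ext => ->. Qed.

Lemma ext_nth s d l i : ext s d l (d + i) = nth [::] l i.
Proof. by rewrite /ext ltnNge leq_addr addKn. Qed.

Lemma upd_ext s d l i v : upd (ext s d l) (d + i) v = ext s d (set_nth [::] l i v).
Proof.
apply: functional_extensionality => z; rewrite /upd /ext nth_set_nth /=.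
case: ltnP => zd; first by rewrite ifF //; lia.
by rewrite (_ : (z == d + i) = (z - d == i)) //; lia.
Qed.

Lemma upd_ext_lt s d l i v : i < d -> upd (ext s d l) i v = ext (upd s i v) d l.
Proof.
move=> id; apply: functional_extensionality => z; rewrite /upd /ext.
by case: eqP => // ->; rewrite id.
Qed.

Lemma ext_ext s d l l' : ext (ext s d l) (d + size l) l' = ext s d (l ++ l').
Proof.
apply: functional_extensionality => z; rewrite /ext nth_cat.
case: (ltnP z d) => zd; first by rewrite ifT //; lia.
rewrite (_ : (z < d + size l) = (z - d < size l)); last by lia.
by case: ifP => //; rewrite subnDA.
Qed.

Lemma ext_eq s d l l' : (forall i, nth [::] l i = nth [::] l' i) -> ext s d l = ext s d l'.
Proof. by move=> E; apply: functional_extensionality => z; rewrite /ext E. Qed.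

(* States that differ by trailing empty registers. *)
Local Ltac nth_pad :=
  let z := fresh "z" in
  move=> [|[|[|[|[|[|z]]]]]]; rewrite /= ?nth_nil ?cats0 ?revK //.
Local Ltac ext_pad := apply: ext_eq; nth_pad.

Lemma exec_le p s s' t t' : exec p s s' t -> t <= t' -> exec p s s' t'.
Proof.
by case=> {p s s' t}; intros; econstructor; eauto; lia.
Qed.

Lemma exec_eq p s s' s'' t t' : exec p s s' t -> s' = s'' -> t <= t' -> exec p s s'' t'.
Proof. by move=> H <-; apply: exec_le. Qed.

Lemma exec_push s d l i b :
  exec (Push (d + i) b) (ext s d l) (ext s d (set_nth [::] l i (b :: nth [::] l i))) 1.
Proof. by rewrite -upd_ext -(ext_nth s d); apply: XPush. Qed.

Lemma exec_mv s d l i j : i != j ->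
  exec (mv (d + i) (d + j)) (ext s d l)
    (ext s d (set_nth [::] (set_nth [::] l i [::]) j (rev (nth [::] l i) ++ nth [::] l j)))
    (3 * size (nth [::] l i) + 1).
Proof.
move=> ij; move E: (nth [::] l i) => u; elim: u l E => [|b u IH] l E.
  apply: exec_eq (XLoopE _ _ _ (t := 1) _ _) _ _; rewrite ?ext_nth //.
  apply: ext_eq => z; rewrite !nth_set_nth /= /rev /=.
  by case: (z =P j) => [->|_] //; rewrite nth_set_nth /=; case: (z =P i) => [->|_].
pose l1 := set_nth [::] l i u; pose l' := set_nth [::] l1 j (b :: nth [::] l1 j).
have /IH H : nth [::] l' i = u by rewrite /l' nth_set_nth /= (negPf ij) nth_set_nth /= eqxx.
apply: (XLoop (l := u) (b := b) (t1 := 1)); rewrite ?ext_nth ?orbT //.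
- have -> : (if b then Push (d + j) true else Push (d + j) false) = Push (d + j) b.
    by case: (b).
  by rewrite upd_ext; apply: exec_push.
- apply: (exec_eq H _ (leqnn _)); apply: ext_eq => z.
  have ji : (j == i) = false by rewrite eq_sym (negPf ij).
  rewrite /l' /l1; do 3 rewrite ?nth_set_nth /= ?eqxx ?ji; rewrite rev_cons cat_rcons.
  by case: (z =P j) => // _; do 2 rewrite ?nth_set_nth /=; case: (z =P i).
- by rewrite /=; lia.
Qed.

Lemma exec_clear s d l i :
  exec (clear (d + i)) (ext s d l) (ext s d (set_nth [::] l i [::]))
    (2 * size (nth [::] l i) + 1).
Proof.
move E: (nth [::] l i) => u; elim: u l E => [|b u IH] l E.
  apply: exec_eq (XLoopE _ _ _ (t := 1) _ _) _ _; rewrite ?ext_nth //.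
  by apply: ext_eq => z; rewrite !nth_set_nth /=; case: eqP => // ->.
have /IH H : nth [::] (set_nth [::] l i u) i = u by rewrite nth_set_nth /= eqxx.
apply: (XLoop (l := u) (b := b) (t1 := 0)); rewrite ?ext_nth ?orbT //.
- by rewrite upd_ext; case: (b); apply: XSkip.
- apply: (exec_eq H _ (leqnn _)); apply: ext_eq => z.
  by rewrite !nth_set_nth /= ?nth_set_nth /=; case: eqP.
- by rewrite /=; lia.
Qed.

Lemma upd_upd (s : stacks) i u v : upd (upd s i u) i v = upd s i v.
Proof. by apply: functional_extensionality => z; rewrite /upd; case: eqP. Qed.

Lemma exec_seq p q s s1 s2 t1 t2 : exec p s s1 t1 -> exec q s1 s2 t2 ->
  exec (Seq p q) s s2 (t1 + t2).
Proof. by move=> H1 H2; apply: XSeq H1 H2 _. Qed.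

Lemma exec_ifE r pe p0 p1 s s' t : s r = [::] -> exec pe s s' t ->
  exec (If r pe p0 p1) s s' (t + 2).
Proof. by move=> E H; apply: XIfE E H _. Qed.

Lemma exec_if s d i pe p0 p1 l b u s' t : nth [::] l i = b :: u ->
  exec (if b then p1 else p0) (ext s d (set_nth [::] l i u)) s' t ->
  exec (If (d + i) pe p0 p1) (ext s d l) s' (t + 2).
Proof. by move=> E H; apply: XIf (leqnn _); [rewrite ext_nth E|rewrite upd_ext; apply: H]. Qed.

Lemma exec_loop s d i p0 p1 o l b u s1 s' t1 t2 : nth [::] l i = b :: u -> b || ~~ o ->
  exec (if b then p1 else p0) (ext s d (set_nth [::] l i u)) s1 t1 ->
  exec (Loop (d + i) p0 p1 o) s1 s' t2 ->
  exec (Loop (d + i) p0 p1 o) (ext s d l) s' (t1 + t2 + 2).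
Proof.
by move=> E bo H1 H2; apply: XLoop bo _ H2 (leqnn _); [rewrite ext_nth E|rewrite upd_ext; apply: H1].
Qed.

Lemma exec_loop0 s d i p0 p1 o l : nth [::] l i = [::] ->
  exec (Loop (d + i) p0 p1 o) (ext s d l) (ext s d l) 1.
Proof. by move=> E; apply: XLoopE; rewrite // ext_nth. Qed.

Lemma exec_copy s d i : i < d ->
  exec (copy i d) (ext s d [::]) (ext s d [:: s i]) (50 * (size (s i)).+1).
Proof.
move=> id; rewrite /copy.
have H1 u w : exec (mv i (d + 1)) (ext (upd s i u) d [:: [::]; w])
    (ext (upd s i [::]) d [:: [::]; rev u ++ w]) (3 * size u + 1).
  elim: u w => [|b u IH] w.
    by apply: XLoopE => //; rewrite ext_lt // /upd eqxx.
  apply: (XLoop (l := u) (b := b) (t1 := 1)); rewrite ?orbT //.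
  - by rewrite ext_lt // /upd eqxx.
  - have -> : (if b then Push (d + 1) true else Push (d + 1) false) = Push (d + 1) b.
      by case: (b).
    by rewrite upd_ext_lt // upd_upd; apply: exec_push.
  - by rewrite rev_cons cat_rcons; apply: IH.
  - by rewrite /=; lia.
have H2 u x : exec (Loop (d + 1) (Seq (Push i false) (Push d false))
      (Seq (Push i true) (Push d true)) false)
    (ext (upd s i x) d [:: x; u]) (ext (upd s i (rev u ++ x)) d [:: rev u ++ x])
    (4 * size u + 1).
  elim: u x => [|b u IH] x.
    by apply: exec_eq; [apply: exec_loop0|apply: ext_eq; do 2 case=> //; case|].
  have -> : 4 * size (b :: u) + 1 = 2 + (4 * size u + 1) + 2 by rewrite /=; lia.
  apply: (exec_loop (b := b) (u := u)); rewrite ?orbT //=; last first.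
    by rewrite rev_cons cat_rcons; apply: IH.
  have -> : (if b then Seq (Push i true) (Push d true) else Seq (Push i false) (Push d false))
      = Seq (Push i b) (Push d b) by case: (b).
  apply: (exec_seq (t1 := 1) (t2 := 1)); first by apply: XPush.
  rewrite ext_lt // upd_ext_lt // upd_upd /upd eqxx -[X in Push X]addn0.
  exact: exec_push.
have E l : ext s d l = ext (upd s i (s i)) d l by rewrite upd_same.
have -> : ext s d [::] = ext (upd s i (s i)) d [:: [::]; [::]].
  by rewrite -E; ext_pad.
apply: exec_eq; first by apply: exec_seq; [exact: H1|rewrite cats0; exact: H2].
- by rewrite revK cats0 -E.
- by rewrite size_rev; lia.
Qed.

Lemma exec_split s d a r y :
  exec (split d) (ext s d [:: ser a ++ r; y]) (ext s d [:: r; y; ser a]) (20 * tsz a).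
Proof.
(* Continuation form: [k] further trees are pending after [b], and a run of the loop on what follows
   [b] is extended to a run that starts before [b]. For a pair the two components are then treated
   in turn. *)
have H b T k r' s' t : exec (Loop (d + 4) (split_body d) (split_body d) false)
      (ext s d [:: r'; y; [::]; rev (ser b) ++ T; nseq k true]) s' t ->
    exec (Loop (d + 4) (split_body d) (split_body d) false)
      (ext s d [:: ser b ++ r'; y; [::]; T; nseq k.+1 true]) s' (t + 9 * tsz b).
  elim: b T k r' s' t => [|b IHb b' IHb'] T k r' s' t H.
    apply: exec_le; first apply: (exec_loop (b := true) (u := nseq k true)) => //.
    - apply: (exec_if _ (b := false) (u := r')) => //; exact: exec_push.
    - exact: H.
    - by rewrite /tsz /=; lia.
  apply: exec_le; first apply: (exec_loop (b := true) (u := nseq k true)) => //.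
  - apply: (exec_if _ (b := true) (u := ser b ++ ser b' ++ r')) => //.
      by rewrite /= catA.
    by apply: exec_seq; [exact: exec_push|apply: exec_seq; exact: exec_push].
  - apply: (IHb _ k.+1); apply: IHb'.
    by move: H; rewrite /= rev_cons rev_cat cat_rcons -catA; apply.
  - by rewrite /tsz /= size_cat; lia.
rewrite /split; apply: exec_eq.
- apply: exec_seq; first exact: exec_push.
  apply: exec_seq; first by apply: (H a [::] 0); apply: exec_loop0.
  exact: exec_mv.
- by rewrite /= !cats0 revK; ext_pad.
- rewrite /= !cats0 size_rev -/(tsz a); have : 0 < tsz a by case: (a).
  by lia.
Qed.

(** The unary counter in [d + 2] is raised at each mismatch and at each symbol of [u] without a
    partner, so it stays 0 exactly if [u] is a prefix of [v]. What is left of [v] is counted by the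
    next loop. *)
Lemma exec_eq_loop s d u v k : let f := Push (d + 2) true in
  exists2 k', k' = 0 <-> k = 0 /\ take (size u) v = u &
  k' <= k + size u /\
  exec (Loop (d + 0) (If (d + 1) f Skip f) (If (d + 1) f f Skip) false)
    (ext s d [:: u; v; nseq k true]) (ext s d [:: [::]; drop (size u) v; nseq k' true])
    (6 * size u + 1).
Proof.
move=> f; elim: u v k => [|b u IH] v k.
  exists k; first by rewrite take0; split=> [|[]].
  by rewrite drop0; split; [rewrite addn0|apply: exec_loop0].
pose j := if v is c :: _ then (b != c : nat) else 1.
have [k' k'0 [k'le H]] := IH (behead v) (j + k).
exists k'.
  rewrite k'0 /j; case: v {k'0 k'le H IH} @j => [|c v] /=.
    by split=> -[].
  case: eqP => [->|bc] /=; last by split=> [[]|[_ [] /esym]].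
  by rewrite add0n; split=> [[-> ->]|[-> [->]]].
split; first by move: k'le; rewrite /j; case: (v) => [|c v'] /=; try case: eqP; lia.
have -> : drop (size (b :: u)) v = drop (size u) (behead v) by case: (v) => //; rewrite drop_nil.
apply: (exec_le (t := 3 + (6 * size u + 1) + 2)); last by rewrite /=; lia.
apply: (exec_loop (b := b) (u := u)); rewrite ?orbT //; last exact: H.
rewrite /j; case: v {k'0 k'le H IH j} => [|c v] /=.
  have P : exec f (ext s d [:: u; [::]; nseq k true]) (ext s d [:: u; [::]; nseq k.+1 true]) 1.
    exact: exec_push.
  by case: b; apply: (exec_ifE _ _ (t := 1)); rewrite ?ext_nth.
have P : exec f (ext s d [:: u; v; nseq k true]) (ext s d [:: u; v; nseq k.+1 true]) 1.
  exact: exec_push.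
by case: b; apply: (exec_if _ (t := 1) (b := c) (u := v)) => //=; case: c => //=; exact: XSkip.
Qed.

Lemma exec_eq_rest s d v k : let f := Push (d + 2) true in
  exec (Loop (d + 1) f f false) (ext s d [:: [::]; v; nseq k true])
    (ext s d [:: [::]; [::]; nseq (size v + k) true]) (3 * size v + 1).
Proof.
move=> f; elim: v k => [|b v IH] k; first exact: exec_loop0.
apply: exec_le; first apply: (exec_loop (b := b) (u := v)); rewrite ?orbT //.
- by rewrite if_same; apply: exec_push.
- by have := IH k.+1; rewrite (addnS (size v)); apply.
- by rewrite /=; lia.
Qed.

(** As [i] is arbitrary, the default register 1 must hold the code of [N]; a variable out of scope
    then reads [N], as in [ev]. *)
Definition env_at (s : stacks) (rho : seq nat) (d : nat) (env : seq tree) : Prop :=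
  size rho = size env /\
  forall i, nth 1 rho i < d /\ s (nth 1 rho i) = ser (nth N env i).

Lemma env_at_ext s rho d env l js vs :
  env_at s rho d env -> all (fun j => j < size l) js ->
  map (nth [::] l) js = map ser vs ->
  env_at (ext s d l) (rho ++ map (addn d) js) (d + size l) (env ++ vs).
Proof.
move=> [Es H] jl E; have Ej : size js = size vs by rewrite -(size_map ser) -E size_map.
split; first by rewrite !size_cat size_map Es Ej.
move=> i; rewrite !nth_cat Es; case: (ltnP i (size env)) => iE.
  by have [ltd <-] := H i; split; [lia|rewrite ext_lt].
case: (ltnP (i - size env) (size js)) => ij.
  rewrite (nth_map 0) // ltn_add2l (all_nthP 0 jl) // ext_nth; split=> //.
  have := congr1 (fun x => nth [::] x (i - size env)) E.
  by rewrite !(nth_map 0) // (nth_map N) // -Ej.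
rewrite !nth_default ?size_map -?Ej //.
by have := H i; rewrite !nth_default ?Es // => -[d1 <-]; rewrite ext_lt //; split=> //; lia.
Qed.

Lemma tsz_sz e env : tsz (ev e env) <= sz e env.
Proof. by case: e => *; apply: leq_maxl. Qed.

Lemma tsz_C a b : tsz (C a b) = (tsz a + tsz b).+1.
Proof. by rewrite /tsz /= size_cat. Qed.

Lemma size_elems t : size (elems t) < tsz t.
Proof. by elim: t => //= a _ b IH; rewrite tsz_C; lia. Qed.

Lemma exec_loopX s d i p1 l u : nth [::] l i = false :: u ->
  exec (Loop (d + i) Skip p1 true) (ext s d l) (ext s d (set_nth [::] l i u)) 2.
Proof. by move=> E; apply: (XLoopX _ (l := u) (t1 := 0)); rewrite ?ext_nth // upd_ext; apply: XSkip. Qed.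

Lemma spine_cat u v : spine (u ++ v) = spine u ++ spine v.
Proof. by rewrite /spine map_cat flatten_cat. Qed.

Section CompFold.
Variables (s : stacks) (rho : seq nat) (d : nat) (env : seq tree) (n : nat).
Hypothesis Henv : env_at s rho d env.

Definition emit_ok (e : expr) : Prop := forall rho d env s n, env_at s rho d env ->
  sz e env <= n -> exec (emit e rho d) (ext s d [::]) (ext s d [:: ser (ev e env)]) (cost e n).

Lemma emit_at e l js vs : emit_ok e -> all (fun j => j < size l) js ->
  map (nth [::] l) js = map ser vs -> sz e (env ++ vs) <= n ->
  exec (emit e (rho ++ map (addn d) js) (d + size l)) (ext s d l)
    (ext s d (l ++ [:: ser (ev e (env ++ vs))])) (cost e n).
Proof.
move=> He jl E le; have := He _ _ _ _ _ (env_at_ext Henv jl E) le.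
by rewrite !ext_ext cats0.
Qed.

(** The output is kept as a reversed spine. Moving the code of a list onto it reverses that code, so
    the closing 0 ends on top, where the final [If] pops it; a single 0 is added after the loop. *)
Lemma exec_for b xs acc : emit_ok b -> all (fun x => tsz x <= n) xs ->
  all (fun x => sz b (env ++ [:: x]) <= n) xs ->
  exec (Loop (d + 0) Skip
         (Seq (split d) (Seq (emit b (rho ++ [:: d + 2]) (d + 3))
         (Seq (clear (d + 2)) (Seq (mv (d + 3) (d + 1)) (If (d + 1) Skip Skip Skip))))) true)
    (ext s d [:: ser (lst xs); rev (spine acc)])
    (ext s d [:: [::]; rev (spine (acc ++ flatten [seq elems (ev b (env ++ [:: x])) | x <- xs]))])
    (size xs * (cost b n + 50 * n.+1) + 2).
Proof.
move=> Hb; elim: xs acc => [|x xs IH] acc /=.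
  by move=> _ _; rewrite cats0; apply: exec_loopX.
move=> /andP[xn xsn] /andP[bn bsn].
set y := ev b _; have yn : tsz y <= n by apply: leq_trans bn; apply: tsz_sz.
apply: exec_le.
  apply: (exec_loop (b := true) (u := ser x ++ ser (lst xs))) => //.
  apply: exec_seq; first exact: exec_split.
  apply: exec_seq.
    by apply: (emit_at (l := [:: _; _; _]) (js := [:: 2]) (vs := [:: x])).
  apply: exec_seq; first exact: exec_clear.
  apply: exec_seq; first exact: exec_mv.
  apply: (exec_if _ (b := false) (t := 0) (u := rev (spine (acc ++ elems y)))); last exact: XSkip.
    by rewrite /= -/y -[y in ser y]elemsK ser_lst rev_rcons cat_cons spine_cat rev_cat.
  rewrite catA (@ext_eq _ _ _ [:: ser (lst xs); rev (spine (acc ++ elems y))]); last by nth_pad.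
  exact: IH.
rewrite -/y -/(tsz x) -/(tsz y) [(size xs).+1 * _]mulSn; move: (size xs * _) => u.
lia.
Qed.

Lemma emit_at0 e l : emit_ok e -> sz e env <= n ->
  exec (emit e rho (d + size l)) (ext s d l)
    (ext s d (l ++ [:: ser (ev e env)])) (cost e n).
Proof.
by move=> He; have := @emit_at e l [::] [::] He isT erefl; rewrite !cats0.
Qed.

Lemma exec_fold c xs acc : emit_ok c -> all (fun x => tsz x <= n) xs -> tsz acc <= n ->
  maxfold (fun acc x => sz c (env ++ [:: acc; x]))
         (fun acc x => ev c (env ++ [:: acc; x])) acc xs <= n ->
  exec (Loop (d + 0) Skip
         (Seq (split d) (Seq (emit c (rho ++ [:: d + 1; d + 2]) (d + 3))
         (Seq (clear (d + 1)) (Seq (clear (d + 2))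
         (Seq (mv (d + 3) (d + 2)) (mv (d + 2) (d + 1))))))) true)
    (ext s d [:: ser (lst xs); ser acc])
    (ext s d [:: [::]; ser (foldl (fun acc x => ev c (env ++ [:: acc; x])) acc xs)])
    (size xs * (cost c n + 50 * n.+1) + 2).
Proof.
move=> Hc; elim: xs acc => [|x xs IH] acc /=; first by move=> _ _ _; apply: exec_loopX.
move=> /andP[xn xsn] an; rewrite geq_max => /andP[cn xsc].
set y := ev c _; have yn : tsz y <= n by apply: leq_trans cn; apply: tsz_sz.
apply: exec_le.
  apply: (exec_loop (b := true) (u := ser x ++ ser (lst xs))) => //.
  apply: exec_seq; first exact: exec_split.
  apply: exec_seq.
    by apply: (emit_at (l := [:: _; _; _]) (js := [:: 1; 2]) (vs := [:: acc; x])).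
  apply: exec_seq; first exact: exec_clear.
  apply: exec_seq; first exact: exec_clear.
  apply: exec_seq; first exact: exec_mv.
  exact: exec_mv.
  rewrite (@ext_eq _ _ _ [:: ser (lst xs); ser y]); last by nth_pad.
  exact: IH.
rewrite /= -/y cats0 size_rev -/(tsz x) -/(tsz y) -/(tsz acc) [(size xs).+1 * _]mulSn.
by move: (size xs * _) => u; lia.
Qed.

End CompFold.

Lemma all_elems n t : tsz t <= n -> all (fun x => tsz x <= n) (elems t).
Proof. by elim: t => //= a _ b IH; rewrite tsz_C => H; rewrite IH ?andbT; lia. Qed.

Theorem exec_emit e : emit_ok e.
Proof.
elim: e => [i||a IHa b IHb|a IHa b IHb|a IHa b IHb c IHc|a IHa b IHb
  |a IHa b IHb c IHc] rho d env s n Henv; have := tsz_sz _ env;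
  rewrite [sz _ _]/= geq_max => _ /andP[vn].
- move=> _; have [lid E] := Henv.2 i.
  apply: exec_eq (exec_copy _ lid) _ _; first by rewrite E.
  by rewrite /= E -/(tsz _) leq_mul2l ltnS.
- move=> _; apply: exec_eq; first exact: exec_push.
    by ext_pad.
  by [].
- rewrite geq_max => /andP[an bn]; rewrite /= tsz_C in vn.
  apply: exec_eq.
  + apply: exec_seq; first exact: IHa Henv an.
    apply: exec_seq; first exact: (emit_at0 Henv [:: _] IHb bn).
    do 4 (apply: exec_seq; first exact: exec_mv).
    exact: exec_push.
  + by ext_pad.
  + by rewrite /= !cats0 !size_rev -!/(tsz _); lia.
- rewrite geq_max => /andP[an bn].
  set va := ev a env; set vb := ev b env.
  have va_n : tsz va <= n := leq_trans (tsz_sz _ _) an.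
  have vb_n : tsz vb <= n := leq_trans (tsz_sz _ _) bn.
  have [k k0 [kle Hk]] := exec_eq_loop s d (ser va) (ser vb) 0.
  have Hr := exec_eq_rest s d (drop (size (ser va)) (ser vb)) k.
  have zE : (size (drop (size (ser va)) (ser vb)) + k == 0) = (va == vb).
    rewrite addn_eq0; apply/andP/eqP => [[/eqP /size0nil d0 /eqP /k0 [_ t0]]|E].
      by apply: ser_inj; rewrite -t0 -[ser vb in RHS](cat_take_drop (size (ser va))) d0 cats0.
    by rewrite E drop_size; split=> //; apply/eqP/k0; rewrite E take_size.
  have rest_n : size (drop (size (ser va)) (ser vb)) <= n.
    by rewrite size_drop -/(tsz vb); lia.
  move: zE rest_n Hr; set z := size _ => zE rest_n Hr.
  apply: exec_eq.
  + apply: exec_seq; first exact: IHa Henv an.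
    apply: exec_seq; first exact: (emit_at0 Henv [:: _] IHb bn).
    rewrite (@ext_eq _ _ _ [:: ser va; ser vb; nseq 0 true]); last by nth_pad.
    apply: exec_seq; first exact: Hk.
    apply: exec_seq; first exact: Hr.
    instantiate (2 := ext s d [:: ser (if va == vb then C N N else N)]).
    instantiate (1 := 2 * n + 2 * n + 10).
    rewrite -zE; case Ez: (z + k) => [|zk].
      apply: exec_eq.
        apply: exec_ifE; first by rewrite ext_nth.
        by do 2 (apply: exec_seq; first exact: exec_push); exact: exec_push.
      by ext_pad.
      by lia.
    apply: exec_eq.
      apply: (exec_if _ (b := true) (u := nseq zk true)); first by [].
      by apply: exec_seq; [exact: exec_clear|exact: exec_push].
      by ext_pad.
    by rewrite /= size_nseq; move: kle; rewrite add0n -/(tsz va); lia.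
  + by [].
  + by rewrite /= -/(tsz va) -/z; lia.
- rewrite geq_max => /andP[an]; have := leq_trans (tsz_sz _ _) an.
  rewrite /=; case E: (ev a env) => [|x y] va_n bcn.
    apply: exec_eq.
    + apply: exec_seq; first exact: IHa Henv an.
      apply: (exec_if _ (b := false) (u := [::])); first by rewrite E.
      rewrite (@ext_eq _ _ _ [::]); last by nth_pad.
      exact: IHb Henv bcn.
    + by rewrite ?E.
    + by rewrite /=; lia.
  have vc_n : tsz (ev c (env ++ [:: x; y])) <= n := leq_trans (tsz_sz _ _) bcn.
  rewrite tsz_C in va_n.
  apply: exec_eq.
  + apply: exec_seq; first exact: IHa Henv an.
    apply: (exec_if _ (b := true) (u := ser x ++ ser y)); first by rewrite E.
    rewrite (@ext_eq _ _ _ [:: ser x ++ ser y; [::]]); last by nth_pad.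
    apply: exec_seq; first exact: exec_split.
    apply: exec_seq.
      by apply: (emit_at (n := n) Henv (l := [:: _; _; _]) (js := [:: 2; 0]) (vs := [:: x; y]) IHc).
    do 2 (apply: exec_seq; first exact: exec_clear).
    by apply: exec_seq; exact: exec_mv.
  + by rewrite /= ?E; ext_pad.
  + by rewrite /= !cats0 ?size_rev -!/(tsz _); lia.
- rewrite geq_max => /andP[an bn].
  have va_n := leq_trans (tsz_sz _ _) an.
  apply: exec_eq.
  + apply: exec_seq; first exact: IHa Henv an.
    apply: exec_seq.
      rewrite (@ext_eq _ _ _ [:: ser (lst (elems (ev a env))); rev (spine [::])]); last first.
        by rewrite elemsK; nth_pad.
      apply: (exec_for (n := n) Henv _ IHb); first exact: all_elems.
      apply/allP => x xa; apply: (leq_trans _ bn).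
      exact: (@leq_bigmax_seq _ _ xpredT (fun x => sz b (env ++ [:: x])) x xa isT).
    by apply: exec_seq; [exact: exec_push|exact: exec_mv].
  + by rewrite /= -rev_rcons -ser_lst; ext_pad.
  + rewrite /= in vn *; rewrite size_rev -/(tsz _).
    have := size_elems (ev a env) => la.
    have : size (elems (ev a env)) * (cost b n + 50 * n.+1) <= n * (cost b n + 50 * n.+1).
      by rewrite leq_mul2r; apply/orP; right; lia.
    move: vn; rewrite /tsz ser_lst size_rcons.
    by move: (n * _) (size _ * _) => u v; lia.
- rewrite !geq_max => /and3P[an bn cn].
  have va_n := leq_trans (tsz_sz _ _) an; have vb_n := leq_trans (tsz_sz _ _) bn.
  apply: exec_eq.
  + apply: exec_seq; first exact: IHa Henv an.
    apply: exec_seq; first exact: (emit_at0 Henv [:: _] IHb bn).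
    apply: exec_seq.
      rewrite -[ev a env]elemsK.
      by apply: (exec_fold (n := n) Henv IHc _ vb_n cn); first exact: all_elems.
    by apply: exec_seq; exact: exec_mv.
  + by ext_pad.
  + rewrite /= in vn *; rewrite !cats0 ?size_rev -!/(tsz _).
    have := size_elems (ev a env) => la.
    have : size (elems (ev a env)) * (cost c n + 50 * n.+1) <= n * (cost c n + 50 * n.+1).
      by rewrite leq_mul2r; apply/orP; right; lia.
    by move: (n * _) (size _ * _) => u v; lia.
Qed.

Fixpoint regs_ok (m : nat) (p : prog) : bool :=
  match p with
  | Skip => true
  | Push r _ => 0 < r <= m
  | Seq p q => regs_ok m p && regs_ok m q
  | If r p q p' => [&& r <= m, regs_ok m p, regs_ok m q & regs_ok m p']
  | Loop r p q _ => [&& r <= m, regs_ok m p & regs_ok m q]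
  end.

Lemma wf_code m B p a : regs_ok m p -> a + len p < B -> all (wf_instr m B) (code p a).
Proof.
elim: p a => [|r b|p IHp q IHq|r pe IHe p0 IH0 p1 IH1|r p0 IH0 p1 IH1 o] a //=.
- by case: r => // r /andP[_ rm] aB; rewrite /wf_instr /= rm; lia.
- by move=> /andP[rp rq] aB; rewrite all_cat IHp ?IHq //; lia.
- move=> /and4P[rm re r0 r1] aB; rewrite /= !all_cat /= !all_cat /= IHe ?IH0 ?IH1 /wf_instr //=; try lia.
- move=> /and3P[rm r0 r1] aB; rewrite /= !all_cat /= !all_cat /= IH0 ?IH1 /wf_instr //=; try lia.
  by rewrite rm; case: (o); lia.
Qed.

(** The bound is chosen before [rho]: it depends on the expression and [d] alone, as it must, since
    it fixes the number of tracks and hence the states of the machine. *)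
Lemma regs_emit e d : 0 < d -> exists m0, forall m rho, m0 <= m ->
  (forall i, 0 < nth 1 rho i < d) -> regs_ok m (emit e rho d).
Proof.
have cat_ok d' rho l : (forall i, 0 < nth 1 rho i < d') -> all (fun r => 0 < r < d' + 3) l ->
    forall i, 0 < nth 1 (rho ++ l) i < d' + 3.
  move=> H Hl i; rewrite nth_cat; case: (ltnP i (size rho)) => _; first by have := H i; lia.
  case: (ltnP (i - size rho) (size l)) => il; first exact: (all_nthP 1 Hl).
  by rewrite nth_default //; have := H 0; lia.
elim: e d => [i||a IHa b IHb|a IHa b IHb|a IHa b IHb c IHc|a IHa b IHb
  |a IHa b IHb c IHc] d d0.
- by exists (d + 5) => m rho md /(_ i) H /=; lia.
- by exists d => m rho md H /=; lia.
- have [ma Ha] := IHa d d0; have [|mb Hb] := IHb (d + 1); first by lia.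
  exists (ma + mb + d + 5) => m rho md H /=; rewrite Ha ?Hb //; try lia.
  by move=> i; have := H i; lia.
- have [ma Ha] := IHa d d0; have [|mb Hb] := IHb (d + 1); first by lia.
  exists (ma + mb + d + 5) => m rho md H /=; rewrite Ha ?Hb //; try lia.
  by move=> i; have := H i; lia.
- have [ma Ha] := IHa d d0; have [mb Hb] := IHb d d0; have [|mc Hc] := IHc (d + 3); first by lia.
  exists (ma + mb + mc + d + 5) => m rho md H /=; rewrite Ha ?Hb ?Hc //; try lia.
  by apply: cat_ok => //=; lia.
- have [ma Ha] := IHa d d0; have [|mb Hb] := IHb (d + 3); first by lia.
  exists (ma + mb + d + 5) => m rho md H /=; rewrite Ha ?Hb //; try lia.
  by apply: cat_ok => //=; lia.
- have [ma Ha] := IHa d d0; have [|mb Hb] := IHb (d + 1); first by lia.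
  have [|mc Hc] := IHc (d + 3); first by lia.
  exists (ma + mb + mc + d + 5) => m rho md H /=; rewrite Ha ?Hb ?Hc //; try lia.
    by apply: cat_ok => //=; lia.
  by move=> i; have := H i; lia.
Qed.

(** * Polynomial bounds and compilation to a machine *)

Definition polyb (f : nat -> nat) : Prop := exists c, forall n, f n <= (n + 2) ^ c.

Lemma polyb_le f g : (forall n, f n <= g n) -> polyb g -> polyb f.
Proof. by move=> fg [c gc]; exists c => n; apply: leq_trans (fg n) (gc n). Qed.

Lemma polyb_const k : polyb (fun=> k).
Proof.
exists k => n; apply: (@leq_trans (2 ^ k)); first exact: ltnW (ltn_expl _ _).
by case: k => // k; rewrite leq_exp2r //; lia.
Qed.

Lemma polyb_id : polyb id.
Proof. by exists 1 => n; rewrite expn1; lia. Qed.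

Lemma polyb_mul f g : polyb f -> polyb g -> polyb (fun n => f n * g n).
Proof. by move=> [c fc] [d gd]; exists (c + d) => n; rewrite expnD leq_mul. Qed.

(** The base [n + 2] is at least 2, so one more exponent absorbs the factor 2 of a sum. *)
Lemma polyb_add f g : polyb f -> polyb g -> polyb (fun n => f n + g n).
Proof.
move=> [c fc] [d gd]; exists (c + d).+1 => n.
have P k : 0 < (n + 2) ^ k by rewrite expn_gt0; lia.
have c1 : f n <= (n + 2) ^ (c + d).
  by apply: leq_trans (fc n) _; rewrite leq_exp2l; lia.
have d1 : g n <= (n + 2) ^ (c + d).
  by apply: leq_trans (gd n) _; rewrite leq_exp2l; lia.
rewrite expnS; apply: (@leq_trans (2 * (n + 2) ^ (c + d))); first by lia.
by rewrite leq_mul2r; lia.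
Qed.

Lemma polyb_exp f c : polyb f -> polyb (fun n => f n ^ c).
Proof.
move=> [d fd]; exists (d * c) => n; rewrite expnM.
by case: c => // c; rewrite leq_exp2r.
Qed.

Ltac polyb :=
  repeat first [exact: polyb_const | exact: polyb_id | assumption
               | apply: polyb_add | apply: polyb_mul].

Lemma polyb_cost e : polyb (cost e).
Proof.
have P50 : polyb (fun n => 50 * n.+1).
  by apply: (@polyb_le _ (fun n => 50 * (n + 1))) => [n|]; [lia|polyb].
by elim: e => /= *; polyb.
Qed.

Definition enc_bool (b : bool) : tree := if b then C N N else N.
Definition enc_bits (w : seq bool) : tree := lst (map enc_bool w).

(** Stack 0 yields the last symbol first, so consing each popped bit restores the order of the word.
    Codes are pushed back to front: 10 for the list cell of a 0 and 1100 for that of a 1. *)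
Definition load : prog :=
  Loop 0 (Seq (Push 2 false) (Push 2 true))
         (Seq (Push 2 false) (Seq (Push 2 false) (Seq (Push 2 true) (Push 2 true)))) false.

Lemma ser_bits b v :
  ser (enc_bits (b :: v)) = true :: ser (enc_bool b) ++ ser (enc_bits v).
Proof. by []. Qed.

Lemma exec_load (s : stacks) u v : s 0 = u -> s 2 = ser (enc_bits v) ->
  exec load s (upd (upd s 0 [::]) 2 (ser (enc_bits (rev u ++ v)))) (6 * size u + 1).
Proof.
elim: u v s => [|b u IH] v s s0 s2.
  rewrite -[upd _ _ _](_ : s = _); first by apply: XLoopE.
  by apply: functional_extensionality => z; rewrite /upd; case: eqP => [->//|_]; case: eqP => [->|].
pose s1 := upd (upd s 0 u) 2 (ser (enc_bits (b :: v))).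
have H1 : exec (if b then Seq (Push 2 false) (Seq (Push 2 false) (Seq (Push 2 true) (Push 2 true)))
    else Seq (Push 2 false) (Push 2 true)) (upd s 0 u) s1 4.
  rewrite /s1; case: (b).
    apply: exec_eq.
    - by do 3 (apply: exec_seq; first by apply: (XPush _ _ _ (t := 1))); apply: (XPush _ _ _ (t := 1)).
    - by rewrite !upd_upd ser_bits -s2.
    - by [].
  apply: exec_eq.
  - by apply: exec_seq; apply: (XPush _ _ _ (t := 1)).
  - by rewrite !upd_upd ser_bits -s2.
  - by [].
apply: (XLoop s0 _ H1 (t2 := 6 * size u + 1)); rewrite ?orbT //; last by rewrite /=; lia.
apply: exec_eq (IH (b :: v) s1 _ _) _ (leqnn _); rewrite /s1 //.
rewrite rev_cons cat_rcons; apply: functional_extensionality => z; rewrite /upd.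
by case: eqP => // _; case: eqP.
Qed.

(** One [n] bounds both the word and all intermediate values; the machine and the exponent depend on
    the expression alone. Any value other than [N] means acceptance. *)
Theorem compile e : exists M c, forall w n t, size w <= n -> sz e [:: enc_bits w] <= n ->
  (n + 2) ^ c <= t -> runs_within M w t (ev e [:: enc_bits w] != N).
Proof.
(* Register 1 gets the code of [N] for variables out of scope, register 2 the empty list on which
   [load] builds the input. *)
pose p := Seq (Push 1 false) (Seq (Push 2 false) (Seq load (emit e [:: 2] 3))).
have [m0 Hm0] := @regs_emit e 3 isT; pose m := m0 + 3.
have mp : regs_ok m p.
  by rewrite /= Hm0; rewrite /m; [lia|lia|case=> [|[|]]].
pose L := len p; pose B := L + 4.
(* The first bit of the result decides: a 0 leads to [L.+1], a 1 to [L.+2], both outside the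
   code. *)
pose P := code p 0 ++ [:: IPop 3 L.+1 L.+1 L.+2].
have wfP : all (wf_instr m B) P.
  have wl l : wf_instr m (l + 4) (IPop 3 l.+1 l.+1 l.+2) by rewrite /wf_instr /= /m; lia.
  rewrite all_cat wf_code // ?add0n; last by rewrite /B /L; lia.
  by rewrite all_seq1 wl.
pose M := tm_of P m B (fun pc => pc == L.+2).
pose T n := 6 * n + cost e n + 10.
pose TT n := T n * (4 * m.+1 * (n + T n + 2)) + 3.
have [c Hc] : polyb TT.
  by rewrite /TT /T; polyb; apply: polyb_cost.
exists M, c => w n t wn en tn.
pose s1 := upd (upd (init_stacks w) 1 [:: false]) 2 [:: false].
pose s2 := upd (upd s1 0 [::]) 2 (ser (enc_bits w)).
have E2 : ext s2 3 [::] = s2.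
  apply: functional_extensionality => z; rewrite /ext; case: ltnP => // z3.
  by rewrite nth_nil /s2 /s1 /upd /init_stacks !ifF //; lia.
have Hx : exec p (init_stacks w) (ext s2 3 [:: ser (ev e [:: enc_bits w])]) (T n - 1).
  apply: exec_eq.
  - apply: exec_seq; first by apply: (XPush _ _ _ (t := 1)).
    apply: exec_seq; first by apply: (XPush _ _ _ (t := 1)).
    apply: exec_seq; first by apply: (@exec_load _ (rev w) [::]).
    rewrite revK cats0 -/s2 -E2; apply: (exec_emit (n := n) _ en).
    by split=> // -[|[|i]] //; rewrite /= ?nth_nil.
  - by [].
  - by rewrite size_rev /T; lia.
have pl : placed P (code p 0) 0 by exists [::], [:: IPop 3 L.+1 L.+1 L.+2].
have [k kt] := exec_code Hx pl; rewrite add0n -/L => Ek.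
have PL : onth P L = Some (IPop 3 L.+1 L.+1 L.+2).
  by have := onth_code (code p 0) [::] (IPop 3 L.+1 L.+1 L.+2); rewrite size_code.
have sP : size P = L.+1 by rewrite /P size_cat size_code addn1.
have Pn i : L < i -> onth P i = None by move=> Li; apply/onth_default; rewrite sP.
pose v := ev e [:: enc_bits w].
have Ek1 : exists s', iter k.+1 (istep P) (0, init_stacks w) =
    (if v == N then L.+1 else L.+2, s').
  rewrite iterS Ek /istep PL -[3]addn0 ext_nth [nth _ _ _]/=.
  by rewrite -/v; case: (v) => [|x y] /=; eexists.
case: Ek1 => s' Ek1.
have := @flowchart_runs P m B (fun pc => pc == L.+2) _ wfP w k.+1 _ s' t Ek1.
have -> : (if v == N then L.+1 else L.+2) == L.+2 = (v != N).
  by case: (v == N) => /=; rewrite ?eqxx //; lia.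
apply; first by rewrite /B; lia.
  by apply: Pn; case: ifP; lia.
apply: leq_trans tn; apply: leq_trans (Hc n); rewrite /TT leq_add2r.
have kT : k.+1 <= T n by rewrite /T in kt *; lia.
by rewrite leq_mul // /instr_cost leq_mul2l leq_add2r leq_add // orbT.
Qed.

(** * Realizers *)

Class Enc (A : Type) := enc : A -> tree.
Class EncInj (A : Type) (e : Enc A) := enc_inj : injective (@enc A e).

#[export] Instance enc_tree : Enc tree := id.
#[export] Instance enc_b : Enc bool := enc_bool.
(** A number is the list of that many [N], so that lengths, products and counted loops are list
    operations. *)
#[export] Instance enc_nat : Enc nat := fun n => iter n (C N) N.
#[export] Instance enc_ord n : Enc 'I_n := fun i => enc (val i).
#[export] Instance enc_seq A (e : Enc A) : Enc (seq A) := fun s => lst (map enc s).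
#[export] Instance enc_pair A B (e : Enc A) (e' : Enc B) : Enc (A * B) :=
  fun p => C (enc p.1) (enc p.2).

#[export] Instance inj_bool : EncInj enc_b.
Proof. by case=> [] []. Qed.
#[export] Instance inj_nat : EncInj enc_nat.
Proof. by elim=> [|m IH] [|n] //= [/IH ->]. Qed.
#[export] Instance inj_ord n : EncInj (@enc_ord n).
Proof. by move=> i j /inj_nat /val_inj. Qed.
#[export] Instance inj_seq A (e : Enc A) (i : EncInj e) : EncInj (enc_seq e).
Proof. by move=> s t /(can_inj lstK) /inj_map; apply; apply: i. Qed.
#[export] Instance inj_pair A B (e : Enc A) (e' : Enc B) (i : EncInj e) (i' : EncInj e') :
  EncInj (enc_pair e e').
Proof. by move=> [a b] [a' b'] [/i /= -> /i' /= ->]. Qed.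

Lemma elems_enc A (e : Enc A) (s : seq A) : elems (enc s) = map enc s.
Proof. exact: lstK. Qed.

(* Higher-order syntax: a term is given the number of variables in scope. *)
Definition term := nat -> expr.

Definition tvar (i : nat) : term := fun _ => Var i.
Definition tnil : term := fun _ => Nilx.
Definition tcons (a b : term) : term := fun L => Pair (a L) (b L).
Definition teq (a b : term) : term := fun L => Eq (a L) (b L).
Definition tif (c a b : term) : term := fun L => Case (c L) (b L) (a L.+2).
Definition tcase (a b : term) (f : term -> term -> term) : term :=
  fun L => Case (a L) (b L) (f (tvar L) (tvar L.+1) L.+2).
Definition tfor (a : term) (f : term -> term) : term :=
  fun L => For (a L) (f (tvar L) L.+1).
Definition tfold (a b : term) (f : term -> term -> term) : term :=
  fun L => Fold (a L) (b L) (f (tvar L) (tvar L.+1) L.+2).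

(** [P] will be a size bound. It is demanded of fold accumulators only, and only along the branches
    that evaluation takes. *)
Fixpoint tame (P : tree -> Prop) (e : expr) (env : seq tree) : Prop :=
  match e with
  | Var _ | Nilx => True
  | Pair a b | Eq a b => tame P a env /\ tame P b env
  | Case a b c => tame P a env /\
      if ev a env is C x y then tame P c (env ++ [:: x; y]) else tame P b env
  | For a b => tame P a env /\ forall x, x \in elems (ev a env) -> tame P b (env ++ [:: x])
  | Fold a b c => [/\ tame P a env, tame P b env & forall i,
      let acc := foldl (fun acc x => ev c (env ++ [:: acc; x])) (ev b env)
                   (take i (elems (ev a env))) in
      P acc /\ (i < size (elems (ev a env)) ->
        tame P c (env ++ [:: acc; nth N (elems (ev a env)) i]))]
  end.

(* Quantifying over extensions of the environment lets a realizer be used under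
   further binders. *)
Definition realizes (P : tree -> Prop) (env : seq tree) (a : term) (t : tree) : Prop :=
  forall env', ev (a (size (env ++ env'))) (env ++ env') = t /\
    tame P (a (size (env ++ env'))) (env ++ env').

Section Rules.
Variable P : tree -> Prop.
Local Notation R := (realizes P).

Lemma R_mono env w a t : R env a t -> R (env ++ w) a t.
Proof. by move=> H env'; rewrite -catA. Qed.

Lemma R_var env i t : nth N env i = t -> i < size env -> R env (tvar i) t.
Proof. by move=> E Hi env'; rewrite /= nth_cat Hi. Qed.

Lemma R_tcons env a b t u : R env a t -> R env b u -> R env (tcons a b) (C t u).
Proof. by move=> Ha Hb env'; have [<- ?] := Ha env'; have [<- ?] := Hb env'. Qed.

Lemma R_last env w t : R (env ++ w ++ [:: t]) (tvar (size (env ++ w))) t.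
Proof.
by apply: R_var; rewrite catA; [rewrite nth_cat ltnn subnn|rewrite [X in _ < X]size_cat addn1].
Qed.

Lemma R_last2 env w t u : R (env ++ w ++ [:: t; u]) (tvar (size (env ++ w))) t /\
  R (env ++ w ++ [:: t; u]) (tvar (size (env ++ w)).+1) u.
Proof.
split; apply: R_var; rewrite catA.
- by rewrite nth_cat ltnn subnn.
- by rewrite [X in _ < X]size_cat addn2.
- by rewrite nth_cat ltnNge leqnSn subSnn.
- by rewrite [X in _ < X]size_cat addn2.
Qed.

(** A body is judged on an arbitrary realizer of the bound value in an arbitrary extension of the
    scope, so that levels of bound variables do not appear in the proofs about programs. *)
Definition bound1 env t (Q : seq tree -> term -> Prop) : Prop :=
  forall w a, R (env ++ w) a t -> Q (env ++ w) a.
Definition bound2 env t u (Q : seq tree -> term -> term -> Prop) : Prop :=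
  forall w a b, R (env ++ w) a t -> R (env ++ w) b u -> Q (env ++ w) a b.

Lemma bound1_elim env t f u env' : bound1 env t (fun w a => R w (f a) u) ->
  let L := size (env ++ env') in
  ev (f (tvar L) L.+1) ((env ++ env') ++ [:: t]) = u /\
  tame P (f (tvar L) L.+1) ((env ++ env') ++ [:: t]).
Proof.
move=> Hf; have := Hf _ _ (R_last env env' t) [::].
by rewrite cats0 catA [size (_ ++ [:: _])]size_cat addn1.
Qed.

Lemma bound2_elim env t t' f u env' : bound2 env t t' (fun w a b => R w (f a b) u) ->
  let L := size (env ++ env') in
  ev (f (tvar L) (tvar L.+1) L.+2) ((env ++ env') ++ [:: t; t']) = u /\
  tame P (f (tvar L) (tvar L.+1) L.+2) ((env ++ env') ++ [:: t; t']).
Proof.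
move=> Hf; have [H1 H2] := R_last2 env env' t t'; have := Hf _ _ _ H1 H2 [::].
by rewrite cats0 catA [size (_ ++ [:: _; _])]size_cat addn2.
Qed.

Lemma R_zero env : R env tnil (enc 0). Proof. by []. Qed.

Lemma R_false env : R env tnil (enc false). Proof. by []. Qed.

Lemma R_true env : R env (tcons tnil tnil) (enc true). Proof. by []. Qed.

Lemma R_succ env a n : R env a (enc n) -> R env (tcons tnil a) (enc n.+1).
Proof. exact: R_tcons. Qed.

Lemma R_nil {A : Type} {eA : Enc A} env : R env tnil (enc ([::] : seq A)).
Proof. by []. Qed.

Lemma R_cons {A : Type} {eA : Enc A} env a b (x : A) s :
  R env a (enc x) -> R env b (enc s) -> R env (tcons a b) (enc (x :: s)).
Proof. exact: R_tcons. Qed.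

Lemma R_pair {A B : Type} {eA : Enc A} {eB : Enc B} env a b (x : A) (y : B) :
  R env a (enc x) -> R env b (enc y) -> R env (tcons a b) (enc (x, y)).
Proof. exact: R_tcons. Qed.

(** Each branch may assume its condition, so a size bound that would fail on the branch not taken
    does no harm. *)
Lemma R_if {A : Type} {eA : Enc A} env c a b (p : bool) (x y : A) : R env c (enc p) ->
  (p -> R env a (enc x)) -> (~~ p -> R env b (enc y)) ->
  R env (tif c a b) (enc (if p then x else y)).
Proof.
move=> Hc Ha Hb env'; rewrite /=; have [-> ?] := Hc env'.
case: p {Hc} Ha Hb => /= Ha Hb; last by have [] := Hb isT env'.
have := Ha isT (env' ++ [:: N; N]).
by rewrite catA [size (_ ++ [:: _; _])]size_cat addn2 => -[].
Qed.

Lemma R_caseseq {A B : Type} {eA : Enc A} {eB : Enc B} env a b f (s : seq A) (x : B)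
    (g : A -> seq A -> B) :
  R env a (enc s) -> (s = [::] -> R env b (enc x)) ->
  (forall y s', s = y :: s' -> bound2 env (enc y) (enc s')
     (fun w h t => R w (f h t) (enc (g y s')))) ->
  R env (tcase a b f) (enc (if s is y :: s' then g y s' else x)).
Proof.
move=> Ha Hb Hf env'; rewrite /=; have [-> ?] := Ha env'.
case: s {Ha} Hb Hf => [|y s'] Hb Hf /=; first by have [] := Hb erefl env'.
by have [] := bound2_elim env' (Hf y s' erefl).
Qed.

Lemma R_casepair {A B : Type} {eA : Enc A} {eB : Enc B} env a b f (p : A * B) t :
  R env a (enc p) -> bound2 env (enc p.1) (enc p.2) (fun w x y => R w (f x y) t) ->
  R env (tcase a b f) t.
Proof.
move=> Ha Hf env'; rewrite /=; have [-> ?] := Ha env'.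
by have [] := bound2_elim env' Hf.
Qed.

Lemma R_fold {A B : Type} {eA : Enc A} {eB : Enc B} env a b f (s : seq A) (x : B)
    (g : B -> A -> B) :
  R env a (enc s) -> R env b (enc x) -> (forall i, P (enc (foldl g x (take i s)))) ->
  (forall i y, i < size s -> nth y s i = y ->
     bound2 env (enc (foldl g x (take i s))) (enc y)
       (fun w acc u => R w (f acc u) (enc (g (foldl g x (take i s)) y)))) ->
  R env (tfold a b f) (enc (foldl g x s)).
Proof.
move=> Ha Hb HP Hf env'; rewrite /=; have [-> ta] := Ha env'; have [-> tb] := Hb env'.
rewrite elems_enc size_map.
set h := fun _ _ => _.
have H i : i <= size s -> foldl h (enc x) (take i (map enc s)) = enc (foldl g x (take i s)).
  elim: i => [|i IH] Hi; first by rewrite !take0.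
  have [y0 _] : exists y0 : A, True by case: (s) Hi => // y0; exists y0.
  have := bound2_elim env' (Hf i (nth y0 s i) Hi (set_nth_default _ _ Hi)) => -[E _].
  rewrite (take_nth N) ?size_map // (nth_map y0) // (take_nth y0) //.
  by rewrite !foldl_rcons (IH (ltnW Hi)).
have H' i : foldl h (enc x) (take i (map enc s)) = enc (foldl g x (take i s)).
  case: (leqP i (size s)) => Hi; first exact: H.
  by rewrite !take_oversize ?size_map ?(ltnW Hi) // -[map _ _]take_size -[s in RHS]take_size size_map H.
split; first by rewrite -[map _ _]take_size -[s in RHS]take_size size_map H'.
split=> // i; rewrite H'; split=> // Hi.
have [y0 _] : exists y0 : A, True by case: (s) Hi => // y0; exists y0.
rewrite (nth_map y0) //.
by have [] := bound2_elim env' (Hf i (nth y0 s i) Hi (set_nth_default _ _ Hi)).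
Qed.

Lemma R_for {A B : Type} {eA : Enc A} {eB : Enc B} env a f (s : seq A) (g : A -> seq B) :
  R env a (enc s) ->
  (forall y, bound1 env (enc y) (fun w u => R w (f u) (enc (g y)))) ->
  R env (tfor a f) (enc (flatten (map g s))).
Proof.
move=> Ha Hf env'; rewrite /=; have [-> ?] := Ha env'; rewrite elems_enc.
split; last first.
  split=> //; elim: (s) => //= y s' IH x; rewrite inE => /orP[/eqP ->|/IH //].
  by have [] := bound1_elim env' (Hf y).
rewrite -map_comp [RHS]/enc /enc_seq map_flatten.
congr (lst (flatten _)); rewrite -map_comp; apply: eq_map => y /=.
by have [-> _] := bound1_elim env' (Hf y); rewrite elems_enc.
Qed.

Lemma R_eq env a b (A : eqType) (eA : Enc A) (iA : EncInj eA) (x y : A) :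
  R env a (enc x) -> R env b (enc y) -> R env (teq a b) (enc (x == y)).
Proof.
move=> Ha Hb env'; rewrite /=; have [-> ?] := Ha env'; have [-> ?] := Hb env'.
by rewrite (inj_eq iA).
Qed.

End Rules.

(** * Sizes of intermediate values *)

Definition tot (env : seq tree) : nat := (sumn (map tsz env)).+1.

Lemma tot_cat env w : tot (env ++ w) = tot env + sumn (map tsz w).
Proof. by rewrite /tot map_cat sumn_cat. Qed.

Lemma tsz_nth env i : tsz (nth N env i) <= tot env.
Proof.
case: (ltnP i (size env)) => Hi; last by rewrite nth_default.
elim: env i Hi => // t env IH [|i] Hi; rewrite /tot /=; first by lia.
by have := IH i Hi; rewrite /tot; lia.
Qed.

Lemma exp_mono c m n : m <= n -> m ^ c <= n ^ c.
Proof. by case: c => // c mn; rewrite leq_exp2r. Qed.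

Ltac polyb_exps := repeat first [apply: polyb_exp | progress polyb].

Lemma tsz_lst s : tsz (lst s) = (sumn (map (fun x => (tsz x).+1) s)).+1.
Proof. by elim: s => //= x s IH; rewrite tsz_C IH; lia. Qed.

Lemma sumn_le (T : eqType) (f : T -> nat) s M : (forall x, x \in s -> f x <= M) ->
  sumn (map f s) <= size s * M.
Proof.
elim: s => //= x s IH H; rewrite mulSn leq_add ?H ?mem_head ?IH // => y ys.
by apply: H; rewrite inE ys orbT.
Qed.

Lemma elems_le x t : x \in elems t -> tsz x < tsz t.
Proof.
elim: t => //= a _ b IH; rewrite inE tsz_C => /orP[/eqP ->|/IH]; lia.
Qed.

Lemma maxfold_le (A : Type) (g : A -> tree -> nat) h acc s M :
  (forall i, i < size s -> g (foldl h acc (take i s)) (nth N s i) <= M) ->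
  maxfold g h acc s <= M.
Proof.
elim: s acc => //= x s IH acc H; rewrite geq_max (H 0) //=; apply: IH => i Hi.
exact: H i.+1 Hi.
Qed.

(* Only the accumulators of folds can grow beyond a fixed polynomial. *)
Theorem tame_sz e : exists c, forall G env, tame (fun t => tsz t <= G) e env ->
  sz e env <= (tot env + G + 2) ^ c.
Proof.
have intro e' f : polyb f -> (forall G env, tame (fun t => tsz t <= G) e' env ->
    sz e' env <= f (tot env + G)) ->
    exists c, forall G env, tame (fun t => tsz t <= G) e' env ->
    sz e' env <= (tot env + G + 2) ^ c.
  by move=> [c fc] H; exists c => G env /H /leq_trans; apply; apply: fc.
elim: e => [i||a [ca Ha] b [cb Hb]|a [ca Ha] b [cb Hb]|a [ca Ha] b [cb Hb] c [cc Hc]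
  |a [ca Ha] b [cb Hb]|a [ca Ha] b [cb Hb] c [cc Hc]].
- apply: (intro _ id polyb_id) => G env _; rewrite /= maxn0.
  exact: leq_trans (tsz_nth env i) (leq_addr _ _).
- exact: (intro _ (fun=> 1) (polyb_const 1)).
- apply: (intro _ (fun n => (n + 2) ^ ca + (n + 2) ^ cb + 1)); first by polyb_exps.
  move=> G env [/Ha ha /Hb hb]; rewrite /= !geq_max tsz_C.
  by have := tsz_sz a env; have := tsz_sz b env; lia.
- apply: (intro _ (fun n => (n + 2) ^ ca + (n + 2) ^ cb + 3)); first by polyb_exps.
  move=> G env [/Ha ha /Hb hb]; rewrite /= !geq_max.
  by case: (_ == _); rewrite /tsz /=; lia.
- apply: (intro _ (fun n => (n + 2) ^ ca + (n + 2) ^ cb + (n + (n + 2) ^ ca + 2) ^ cc)).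
    by polyb_exps.
  move=> G env [/Ha ha]; have sa := tsz_sz a env; rewrite /= !geq_max.
  case E: (ev a env) sa => [|x y] sa.
    by move=> /Hb hb; have := tsz_sz b env; lia.
  move=> /Hc hc; rewrite tsz_C in sa.
  have : sz c (env ++ [:: x; y]) <= (tot env + G + (tot env + G + 2) ^ ca + 2) ^ cc.
    apply: leq_trans hc _; apply: exp_mono; rewrite tot_cat /=; lia.
  have := tsz_sz c (env ++ [:: x; y]).
  by move: (_ ^ cc) => u; lia.
- apply: (intro _ (fun n => (n + 2) ^ ca + (n + 2) ^ ca * (n + (n + 2) ^ ca + 2) ^ cb
    + (n + (n + 2) ^ ca + 2) ^ cb + 1)); first by polyb_exps.
  move=> G env [/Ha ha tb]; have sa := tsz_sz a env.
  set K := (_ + _ + 2) ^ cb.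
  have HK x : x \in elems (ev a env) -> sz b (env ++ [:: x]) <= K.
    move=> xa; apply: leq_trans (Hb _ _ (tb x xa)) _.
    by apply: exp_mono; rewrite tot_cat /=; have := elems_le xa; lia.
  have H1 : \max_(x <- elems (ev a env)) sz b (env ++ [:: x]) <= K.
    by rewrite big_seq; apply/bigmax_leqP_seq => x xa _; apply: HK.
  have H2 : tsz (lst (flatten [seq elems (ev b (env ++ [:: x])) | x <- elems (ev a env)]))
      <= (tot env + G + 2) ^ ca * K + 1.
    rewrite tsz_lst addn1 ltnS; apply: (@leq_trans (size (elems (ev a env)) * K)); last first.
      rewrite leq_mul2r; apply/orP; right.
      by have := size_elems (ev a env); lia.
    rewrite map_flatten sumn_flatten -!map_comp; apply: sumn_le => x xa /=.
    apply: leq_trans (HK x xa); apply: leq_trans (tsz_sz _ _).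
    by rewrite -[X in _ <= tsz X]elemsK tsz_lst.
  rewrite /= !geq_max; apply/and3P; split.
  + by apply: leq_trans H2 _; move: ha; move: (_ * K) => u; lia.
  + by apply: leq_trans ha _; rewrite -!addnA leq_addr.
  + by apply: leq_trans H1 _; rewrite addnAC; apply: leq_addl.
- apply: (intro _ (fun n => n + (n + 2) ^ ca + (n + 2) ^ cb + (n + n + (n + 2) ^ ca + 2) ^ cc)).
    by polyb_exps.
  move=> G env [/Ha ha /Hb hb tf]; have sa := tsz_sz a env; rewrite /= !geq_max.
  apply/and4P; split; [|lia|lia|].
    by have [] := tf (size (elems (ev a env))); rewrite take_size; lia.
  (* Every round starts from an accumulator of size at most [G], so the bounds of the rounds do not
     compound. *)
  apply: maxfold_le => i Hi; have [si /(_ Hi) /Hc /leq_trans] := tf i; apply.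
  apply: leq_trans (leq_addl _ _); apply: exp_mono; rewrite tot_cat /=.
  have xs : tsz (nth N (elems (ev a env)) i) <= _ :=
    leq_trans (leq_trans (ltnW (elems_le (mem_nth N Hi))) sa) ha.
  have arith m u v g k : u <= g -> v <= k -> m + (u + (v + 0)) + g + 2 <= m + g + (m + g) + k + 2 by lia.
  exact: arith si xs.
Qed.

(** * Dynamic programming along a layout tree *)

Section Adjacency.
Variables (T : eqType) (ed : seq (T * T)) (V : seq T).

Definition adj (x y : T) : bool := (x, y) \in ed.

(** Twins with respect to [B]: equal rows in the cut matrix between [B] and the rest of [V]. *)
Definition rowsame (B : seq T) (x y : T) : bool :=
  all (fun z => (z \in B) || (adj x z == adj y z)) V.

Definition rep (B : seq T) (x : T) : T := head x [seq y <- B | rowsame B x y].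

End Adjacency.

Section Tables.
Variables (T S : eqType) (ed : seq (T * T)) (V : seq T).
Variables (Lam : seq S) (forb : seq (bool * (S * S))) (marks : seq S) (und dom : S).
Variable init : seq (T * S).

Local Notation adj := (adj ed).
Local Notation rep := (rep ed V).
Local Notation sig_t := (seq (T * S)).
Local Notation entry := (sig_t * seq T)%type.

(** Signatures are sets of pairs of a twin class and a status. Filtering a fixed list of all pairs
    gives each set a unique list, so equality of lists is equality of sets. *)
Definition canon (B : seq T) (raw : sig_t) : sig_t :=
  [seq p <- [seq (x, s) | x <- B, s <- Lam] | p \in raw].

(** The only way a status changes: [und] becomes [dom] when a neighbour with a status in [marks]
    joins. With chosen vertices as marks this is domination. *)
Definition upd_status (sig : sig_t) (p : T * S) : S :=
  if (p.2 == und) && has (fun q => adj p.1 q.1 && (q.2 \in marks)) sig then dom else p.2.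

Definition lift_sig (B : seq T) (sig sig' : sig_t) : sig_t :=
  [seq (rep B p.1, upd_status sig' p) | p <- sig].

Definition compat (sig1 sig2 : sig_t) : bool :=
  all (fun p => all (fun q => (adj p.1 q.1, (p.2, q.2)) \notin forb) sig2) sig1.

Definition merge_entry (B : seq T) (e1 e2 : entry) : entry :=
  (canon B (lift_sig B e1.1 e2.1 ++ lift_sig B e2.1 e1.1), e1.2 ++ e2.2).

(** Extending an entry depends on its signature, and the test for well-coveredness also on the size
    of the witness. One witness per key is therefore kept, which bounds the table by the number of
    keys. *)
Definition same_key (e e' : entry) : bool := (e.1 == e'.1) && (size e.2 == size e'.2).

Definition dedup (t : seq entry) : seq entry :=
  foldl (fun acc e => if has (same_key e) acc then acc else e :: acc) [::] t.

Definition merge_table (B : seq T) (t1 t2 : seq entry) : seq entry :=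
  dedup (flatten [seq flatten [seq (if compat e1.1 e2.1 then [:: merge_entry B e1 e2] else [::])
    | e2 <- t2] | e1 <- t1]).

Definition leaf_table (v : T) : seq entry :=
  flatten [seq (if p.1 == v then [:: (canon [:: v] [:: (v, p.2)], if p.2 \in marks then [:: v] else [::])]
    else [::]) | p <- init].

(* A tree is given in postfix form: [[:: v]] is a leaf and [[::]] joins the two
   trees on top of the stack. *)
Definition dp_step (st : seq (seq T * seq entry)) (tok : seq T) :=
  if tok is v :: _ then ([:: v], leaf_table v) :: st
  else if st is x :: st1 then
    if st1 is y :: st2 then (y.1 ++ x.1, merge_table (y.1 ++ x.1) y.2 x.2) :: st2 else st
  else st.

Definition dp (toks : seq (seq T)) := foldl dp_step [::] toks.

End Tables.

Inductive layout (T : Type) := Leaf of T | Node of layout T & layout T.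

Section Correctness.
Variables (T S : eqType) (ed : seq (T * T)) (V : seq T).
Variables (Lam : seq S) (forb : seq (bool * (S * S))) (marks : seq S) (und dom : S).
Variable init : seq (T * S).

Fixpoint leaves (t : layout T) : seq T :=
  match t with Leaf v => [:: v] | Node l r => leaves l ++ leaves r end.

Fixpoint toks (t : layout T) : seq (seq T) :=
  match t with Leaf v => [:: [:: v]] | Node l r => toks l ++ toks r ++ [:: [::]] end.

Local Notation adj := (adj ed).
Local Notation rep := (rep ed V).
Local Notation rowsame := (rowsame ed V).
Local Notation canon := (canon Lam).
Local Notation upd_status := (upd_status ed marks und dom).
Local Notation lift_sig := (lift_sig ed V marks und dom).
Local Notation merge_entry := (merge_entry ed V Lam marks und dom).
Local Notation dp_step := (dp_step ed V Lam forb marks und dom init).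
Local Notation leaf_table := (leaf_table Lam marks init).
Local Notation merge_table := (merge_table ed V Lam forb marks und dom).

Fixpoint table (t : layout T) : seq (seq (T * S) * seq T) :=
  match t with
  | Leaf v => leaf_table v
  | Node l r => merge_table (leaves l ++ leaves r) (table l) (table r)
  end.

Lemma dp_toks t st : foldl dp_step st (toks t) = (leaves t, table t) :: st.
Proof.
elim: t st => [v|l IHl r IHr] st //=.
by rewrite foldl_cat IHl foldl_cat IHr.
Qed.

Hypothesis adj_sym : forall x y, adj x y = adj y x.
Hypothesis adj_irr : forall x, adj x x = false.
Hypothesis forb_sym : forall b s t, ((b, (s, t)) \in forb) = ((b, (t, s)) \in forb).
Hypothesis forb_dom : forall b s, ((b, (dom, s)) \in forb) = ((b, (und, s)) \in forb).
Hypothesis und_dom : dom != und.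
Hypothesis marks_und : und \notin marks.
Hypothesis marks_dom : dom \notin marks.
Hypothesis Lam_dom : und \in Lam -> dom \in Lam.
Hypothesis init_Lam : forall p, p \in init -> p.2 \in Lam.

Definition valid (B : seq T) (a : T -> S) : Prop :=
  (forall v, v \in B -> (v, a v) \in init) /\
  (forall u v, u \in B -> v \in B -> u != v -> (adj u v, (a u, a v)) \notin forb).

Definition status (B : seq T) (a : T -> S) (v : T) : S :=
  if (a v == und) && has (fun y => adj v y && (a y \in marks)) B then dom else a v.

Definition signature (B : seq T) (a : T -> S) : seq (T * S) :=
  canon B [seq (rep B v, status B a v) | v <- B].

Definition marked (B : seq T) (a : T -> S) : seq T := [seq v <- B | a v \in marks].

Lemma rowsame_refl B x : rowsame B x x.
Proof. by apply/allP => z _; rewrite eqxx orbT. Qed.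

Lemma rowsame_sym B x y : rowsame B x y = rowsame B y x.
Proof. by apply: eq_all => z; rewrite [adj x z == _]eq_sym. Qed.

Lemma rowsame_trans B x y z : rowsame B x y -> rowsame B y z -> rowsame B x z.
Proof.
move=> /allP xy /allP yz; apply/allP => w wV.
by have := xy w wV; have := yz w wV; case: (w \in B) => //= /eqP <- /eqP ->.
Qed.

Lemma rowsame_rep B x y : rowsame B x y -> x \in B -> rep B x = rep B y.
Proof.
move=> xy xB; rewrite /rep.
have <- : [seq z <- B | rowsame B x z] = [seq z <- B | rowsame B y z].
  apply: eq_filter => z; apply/idP/idP; last exact: rowsame_trans.
  by apply: rowsame_trans; rewrite rowsame_sym.
have : x \in [seq z <- B | rowsame B x z] by rewrite mem_filter rowsame_refl.
by case: [seq _ <- _ | _].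
Qed.

Lemma repP B x : x \in B -> rep B x \in B /\ rowsame B x (rep B x).
Proof.
move=> xB; rewrite /rep.
have : x \in [seq z <- B | rowsame B x z] by rewrite mem_filter rowsame_refl.
case E: [seq _ <- _ | _] => [|y s] //= _.
have : y \in [seq z <- B | rowsame B x z] by rewrite E mem_head.
by rewrite mem_filter => /andP[].
Qed.

Lemma status_in B a v : v \in B -> valid B a -> status B a v \in Lam.
Proof.
move=> vB [Hi _]; have := init_Lam (Hi v vB) => /= aL; rewrite /status.
by case: ifP => // /andP[/eqP E _]; apply: Lam_dom; rewrite -E.
Qed.

Lemma mem_pairs (A C : eqType) (s : seq A) (t : seq C) x y :
  ((x, y) \in [seq (a, b) | a <- s, b <- t]) = (x \in s) && (y \in t).
Proof.
apply/allpairsP/andP => [[[a b] [/= ? ? [-> ->]]]|[? ?]] //; by exists (x, y).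
Qed.

Lemma mem_signature B a x s : valid B a ->
  reflect (exists2 v, v \in B & x = rep B v /\ s = status B a v) ((x, s) \in signature B a).
Proof.
move=> va; rewrite mem_filter mem_pairs; apply: (iffP idP).
  by case/andP=> /mapP[v vB [-> ->]] _; exists v.
case=> v vB [-> ->]; rewrite status_in // (repP vB).1 !andbT.
by apply/mapP; exists v.
Qed.

Lemma eq_canon (B : seq T) (raw raw' : seq (T * S)) : raw =i raw' -> canon B raw = canon B raw'.
Proof. by move=> E; apply: eq_filter => p; rewrite E. Qed.

Lemma eq_status B a b v : {in B, a =1 b} -> v \in B -> status B a v = status B b v.
Proof.
move=> ab vB; rewrite /status ab //.
by rewrite (_ : has _ B = has (fun y => adj v y && (b y \in marks)) B) //;
  apply: eq_in_has => y yB; rewrite ab.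
Qed.

Lemma eq_signature B a b : {in B, a =1 b} -> signature B a = signature B b.
Proof.
move=> ab; rewrite /signature; congr canon; apply/eq_in_map => v vB.
by rewrite (eq_status ab).
Qed.

Lemma eq_marked B a b : {in B, a =1 b} -> marked B a = marked B b.
Proof. by move=> ab; apply: eq_in_filter => v vB; rewrite ab. Qed.

Lemma status_marks B a v : (status B a v \in marks) = (a v \in marks).
Proof.
rewrite /status; case: ifP => // /andP[/eqP -> _].
by rewrite (negPf marks_und) (negPf marks_dom).
Qed.

(** [und] and [dom] take part in the same forbidden pairs, so the constraints may be tested on
    updated statuses. *)
Lemma status_forb B B' a b e u v :
  ((e, (status B a u, status B' b v)) \in forb) = ((e, (a u, b v)) \in forb).
Proof.
have H s t (c c' : bool) : (c -> s = und) -> (c' -> t = und) ->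
    ((e, (if c then dom else s, if c' then dom else t)) \in forb) = ((e, (s, t)) \in forb).
  have D s' : ((e, (s', dom)) \in forb) = ((e, (s', und)) \in forb).
    by rewrite forb_sym forb_dom -forb_sym.
  by case: c; case: c' => Hc Hc'; rewrite ?(Hc isT) ?(Hc' isT) ?forb_dom ?D.
by apply: H => /andP[/eqP].
Qed.

Section Merge.
Variables (B1 B2 : seq T) (a : T -> S).
Hypothesis B12 : forall v, v \in B1 -> v \notin B2.
Hypothesis B1V : {subset B1 <= V}.
Hypothesis B2V : {subset B2 <= V}.
Hypothesis v1 : valid B1 a.
Hypothesis v2 : valid B2 a.

(** [u] lies outside [B2] and [rep B2 v] outside [B1], so the two vertices can be replaced by their
    twins one after the other. *)
Lemma adj_rep u v : u \in B1 -> v \in B2 -> adj (rep B1 u) (rep B2 v) = adj u v.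
Proof.
move=> u1 v2'; have [ru1 /allP ru] := repP u1; have [rv2 /allP rv] := repP v2'.
have := rv u (B1V u1); rewrite (negPf (B12 u1)) /= => /eqP Ev.
have := ru (rep B2 v) (B2V rv2); rewrite /= => /orP[H|/eqP Eu].
  by have := B12 H; rewrite rv2.
by rewrite -Eu adj_sym -Ev adj_sym.
Qed.
End Merge.

(** Twins with respect to [B1] stay twins with respect to the larger [B], so the new class can be
    computed from the old representative. Marked neighbours in [B1] are already accounted for in the
    status, and those in [B2] are seen by the representative through [adj_rep]. *)
Lemma lift_signature B1 B2 B a u :
  (forall v, v \in B1 -> v \notin B2) -> {subset B1 <= V} -> {subset B2 <= V} ->
  valid B1 a -> valid B2 a -> B =i B1 ++ B2 -> u \in B1 ->
  (rep B (rep B1 u), upd_status (signature B2 a) (rep B1 u, status B1 a u)) =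
  (rep B u, status B a u).
Proof.
move=> B12 B1V B2V v1 v2 EB u1; have [ru1 rsu] := repP u1.
have uB : u \in B by rewrite EB mem_cat u1.
congr pair.
  apply/esym/rowsame_rep => //; apply: sub_all rsu => z.
  by rewrite EB mem_cat => /orP[->|->]; rewrite ?orbT.
have hasE : has (fun q => adj (rep B1 u) q.1 && (q.2 \in marks)) (signature B2 a) =
    has (fun y => adj u y && (a y \in marks)) B2.
  apply/hasP/hasP => [[[x s] /(mem_signature _ _ v2) [v vB [-> ->]]]|[v vB /andP[uv av]]] /=.
    rewrite status_marks adj_rep // => H; by exists v.
  exists (rep B2 v, status B2 a v); first by apply/mem_signature => //; exists v.
  by rewrite /= status_marks adj_rep // uv.
rewrite /upd_status /= hasE {1}/status.
have hasB : has (fun y => adj u y && (a y \in marks)) B =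
    has (fun y => adj u y && (a y \in marks)) B1 || has (fun y => adj u y && (a y \in marks)) B2.
  by rewrite -has_cat; apply: eq_has_r.
rewrite [RHS]/status hasB /status.
case: (eqVneq (a u) und) => [->|ne] /=; last by rewrite (negPf ne).
by case: (has _ B1) => /=; rewrite ?eqxx ?(negPf und_dom).
Qed.

Lemma canon_merge B1 B2 a :
  (forall v, v \in B1 -> v \notin B2) -> {subset B1 <= V} -> {subset B2 <= V} ->
  valid B1 a -> valid B2 a ->
  canon (B1 ++ B2) (lift_sig (B1 ++ B2) (signature B1 a) (signature B2 a) ++
    lift_sig (B1 ++ B2) (signature B2 a) (signature B1 a)) = signature (B1 ++ B2) a.
Proof.
move=> B12 B1V B2V v1 v2.
have B21 v : v \in B2 -> v \notin B1 by move=> v2'; apply/negP => /B12; rewrite v2'.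
have H C C' w : w \in C -> (forall v, v \in C -> v \notin C') -> {subset C <= V} ->
   {subset C' <= V} -> valid C a -> valid C' a -> B1 ++ B2 =i C ++ C' ->
   forall p, p \in lift_sig (B1 ++ B2) (signature C a) (signature C' a) <->
    exists2 v, v \in C & p = (rep (B1 ++ B2) v, status (B1 ++ B2) a v).
  move=> _ CC' CV C'V vC vC' EB p; split.
    case/mapP => -[x s] /(mem_signature _ _ vC) [v vC1 [-> ->]] ->; exists v => //.
    by rewrite (lift_signature CC' CV C'V vC vC' EB).
  case=> v vC1 ->; rewrite -(lift_signature CC' CV C'V vC vC' EB) //.
  apply/mapP; exists (rep C v, status C a v) => //.
  by apply/mem_signature => //; exists v.
apply: eq_canon => p; rewrite mem_cat; apply/orP/mapP.
- case=> [pl|pl].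
    have [[x s] /(mem_signature _ _ v1) [v v1' _] _] := mapP pl.
    have /(H B1 B2 v v1') [] // := pl; move=> w w1 ->; exists w => //.
    by rewrite mem_cat w1.
  have [[x s] /(mem_signature _ _ v2) [v v2' _] _] := mapP pl.
  have EB : B1 ++ B2 =i B2 ++ B1 by move=> z; rewrite !mem_cat orbC.
  have /(H B2 B1 v v2') [] // := pl; move=> w w2 ->; exists w => //.
  by rewrite mem_cat w2 orbT.
- case=> v; rewrite mem_cat => /orP[vB|vB] ->; [left|right].
    by apply/(H B1 B2 v vB) => //; exists v.
  apply/(H B2 B1 v vB) => //; last by exists v.
  by move=> z; rewrite !mem_cat orbC.
Qed.

Lemma compat_signature B1 B2 a :
  (forall v, v \in B1 -> v \notin B2) -> {subset B1 <= V} -> {subset B2 <= V} ->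
  valid B1 a -> valid B2 a ->
  compat ed forb (signature B1 a) (signature B2 a) <-> valid (B1 ++ B2) a.
Proof.
move=> B12 B1V B2V v1 v2; split.
  move=> H.
  have cross u v : u \in B1 -> v \in B2 -> (adj u v, (a u, a v)) \notin forb.
    move=> u1 v2'; have /allP/(_ (rep B1 u, status B1 a u)) := H.
    have -> : (rep B1 u, status B1 a u) \in signature B1 a by apply/mem_signature => //; exists u.
    move=> /(_ isT)/allP/(_ (rep B2 v, status B2 a v)).
    have -> : (rep B2 v, status B2 a v) \in signature B2 a by apply/mem_signature => //; exists v.
    by move=> /(_ isT) /=; rewrite status_forb adj_rep.
  split=> [v|u v]; first by rewrite mem_cat => /orP[]; [apply: v1.1|apply: v2.1].
  rewrite !mem_cat => /orP[u1|u2] /orP[w1|w2] uv.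
  - exact: v1.2.
  - exact: cross.
  - by rewrite adj_sym forb_sym; apply: cross.
  - exact: v2.2.
move=> [_ H]; apply/allP => -[x s] /(mem_signature _ _ v1) [u u1 [-> ->]].
apply/allP => -[y t] /(mem_signature _ _ v2) [v v2' [-> ->]] /=.
rewrite status_forb adj_rep //; apply: H; rewrite ?mem_cat ?u1 ?v2' ?orbT //.
by apply: contraTneq u1 => ->; apply/negP => /B12; rewrite v2'.
Qed.

Lemma mem_dedup (t : seq (seq (T * S) * seq T)) e : e \in dedup t -> e \in t.
Proof.
rewrite /dedup.
suff H acc : e \in foldl (fun acc e => if has (same_key e) acc then acc else e :: acc) acc t ->
    (e \in acc) || (e \in t) by move/H.
elim: t acc => [|x t IH] acc /=; first by move->.
move/IH; rewrite inE; case: ifP => _; first by case/orP=> ->; rewrite ?orbT.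
by rewrite inE; case/orP => [/orP[]|] ->; rewrite ?orbT.
Qed.

Lemma dedup_key (t : seq (seq (T * S) * seq T)) e : e \in t -> has (same_key e) (dedup t).
Proof.
rewrite /dedup.
suff H acc : has (same_key e) acc || (e \in t) -> has (same_key e)
    (foldl (fun acc e => if has (same_key e) acc then acc else e :: acc) acc t).
  by move=> et; apply: H; rewrite et orbT.
elim: t acc => [|x t IH] acc /=; first by rewrite orbF.
rewrite inE => H; apply: IH.
case/orP: H => [H|/orP[/eqP <-|->]]; last by rewrite orbT.
  by case: ifP => _ /=; rewrite H ?orbT.
by case: ifP => [->//|_] /=; rewrite /same_key !eqxx.
Qed.

Lemma signature1 v a : signature [:: v] a = canon [:: v] [:: (v, a v)].
Proof.
have rv : rep [:: v] v = v.
  by have [] := @repP [:: v] v (mem_head _ _); rewrite inE => /eqP.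
by rewrite /signature /= rv /status /= adj_irr /= andbF.
Qed.

Lemma valid_sub B B' a : {subset B' <= B} -> valid B a -> valid B' a.
Proof. by move=> s [H1 H2]; split=> [v /s|u v /s uB /s]; [apply: H1|apply: H2]. Qed.

Lemma eq_valid B a b : {in B, a =1 b} -> valid B a -> valid B b.
Proof. by move=> ab [H1 H2]; split=> [v vB|u v uB vB]; rewrite -!ab //; auto. Qed.

Lemma table_sound t e : uniq (leaves t) -> {subset leaves t <= V} -> e \in table t ->
  exists2 a, valid (leaves t) a & e = (signature (leaves t) a, marked (leaves t) a).
Proof.
elim: t e => [v|l IHl r IHr] e.
  move=> _ vV /flattenP[s /mapP[[w s0] wi ->]] /=.
  case: eqP => // Ewv; rewrite inE => /eqP ->; rewrite {w}Ewv in wi *.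
  exists (fun=> s0); last by rewrite signature1.
  split=> [u|u w]; rewrite !inE => /eqP -> //.
  by move=> /eqP ->; rewrite eqxx.
rewrite /= cat_uniq => /and3P[ul /hasPn dis ur] sub /mem_dedup.
have subl : {subset leaves l <= V} by move=> v vl; apply: sub; rewrite mem_cat vl.
have subr : {subset leaves r <= V} by move=> v vr; apply: sub; rewrite mem_cat vr orbT.
case/flattenP => s1 /mapP[e1 /IHl [] // a1 va1 ->] -> /flattenP[s2 /mapP[e2 /IHr [] // a2 va2 ->] ->].
case: ifP => //= Hc; rewrite inE => /eqP ->.
(* The assignments of the two children live on disjoint sets of leaves and are glued. *)
pose a v := if v \in leaves l then a1 v else a2 v.
have dis1 v : v \in leaves l -> v \notin leaves r by move=> vl; apply/negP => /dis; rewrite vl.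
have al : {in leaves l, a1 =1 a} by move=> v vl; rewrite /a vl.
have ar : {in leaves r, a2 =1 a}.
  by move=> v vr; rewrite /a ifN //; apply: dis.
move: Hc; rewrite (eq_signature al) (eq_signature ar).
move: va1 va2 => /(eq_valid al) va1 /(eq_valid ar) va2 /compat_signature va.
exists a; first exact: va.
rewrite /merge_entry /= canon_merge // (eq_marked al) (eq_marked ar).
by rewrite /marked filter_cat.
Qed.

(** Only the key of [a] is found: [dedup] may have kept the witness of another assignment with the
    same key. *)
Lemma table_complete t a : uniq (leaves t) -> {subset leaves t <= V} -> valid (leaves t) a ->
  has (same_key (signature (leaves t) a, marked (leaves t) a)) (table t).
Proof.
elim: t => [v|l IHl r IHr].
  move=> _ _ [/(_ v (mem_head _ _)) vi _]; apply/hasP.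
  set e := (canon [:: v] [:: (v, a v)], if a v \in marks then [:: v] else [::]).
  exists e; last by rewrite /same_key /= signature1 !eqxx.
  apply/flattenP; exists [:: e]; last exact: mem_head.
  by apply/mapP; exists (v, a v) => //=; rewrite eqxx.
rewrite /= cat_uniq => /and3P[ul /hasPn dis ur] sub va.
have subl : {subset leaves l <= V} by move=> v vl; apply: sub; rewrite mem_cat vl.
have subr : {subset leaves r <= V} by move=> v vr; apply: sub; rewrite mem_cat vr orbT.
have dis1 v : v \in leaves l -> v \notin leaves r by move=> vl; apply/negP => /dis; rewrite vl.
have val : valid (leaves l) a by apply: valid_sub va => v vl; rewrite mem_cat vl.
have var : valid (leaves r) a by apply: valid_sub va => v vr; rewrite mem_cat vr orbT.
have /hasP[[g1 w1] e1 /andP[/= /eqP Eg1 /eqP Ew1]] := IHl ul subl val.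
have /hasP[[g2 w2] e2 /andP[/= /eqP Eg2 /eqP Ew2]] := IHr ur subr var.
have /hasP[e' e't /andP[/eqP k1 /eqP k2]] :
  has (same_key (merge_entry (leaves l ++ leaves r) (g1, w1) (g2, w2)))
   (merge_table (leaves l ++ leaves r) (table l) (table r)).
  apply: dedup_key; apply/flattenP; eexists; first by apply/mapP; exists (g1, w1).
  apply/flattenP; eexists; first by apply/mapP; exists (g2, w2).
  by rewrite /= -Eg1 -Eg2 (compat_signature dis1 subl subr val var).2 ?mem_head.
apply/hasP; exists e' => //; rewrite /same_key -k1 -k2 /= -Eg1 -Eg2 canon_merge // eqxx /=.
by rewrite /marked filter_cat !size_cat Ew1 Ew2.
Qed.

Lemma uniq_keys_dedup (t : seq (seq (T * S) * seq T)) :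
  uniq [seq (e.1, size e.2) | e <- dedup t].
Proof.
rewrite /dedup; have : uniq [seq (e.1, size e.2) | e <- [::] : seq (seq (T * S) * seq T)] by [].
elim: t [::] => //= e t IH acc ua; apply: IH; case: ifP => // H.
rewrite /= ua andbT; apply/negP => /mapP[e' e'a [E1 E2]].
by move/hasP: H; apply; exists e' => //; rewrite /same_key E1 E2 !eqxx.
Qed.

End Correctness.

(** * Cut-rank *)

Import GRing.Theory.

Section CutRank.
Variables (n : nat) (E : rel 'I_n).
Hypothesis Esym : forall x y, E x y = E y x.

Local Open Scope ring_scope.

(** Entries outside [X] and [Y] are set to 0 instead of taking a submatrix: all cuts then have the
    same format and are compared by multiplication with diagonal projections. *)
Definition cutmx (X Y : {set 'I_n}) : 'M['F_2]_n :=
  \matrix_(i, j) (if (i \in X) && (j \in Y) then (E i j)%:R else 0).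

Definition cutrk (X Y : {set 'I_n}) : nat := \rank (cutmx X Y).

Definition proj (X : {set 'I_n}) : 'M['F_2]_n := diag_mx (\row_i (i \in X)%:R).

Lemma cutmxE (X Y X' Y' : {set 'I_n}) : X' \subset X -> Y' \subset Y ->
  cutmx X' Y' = proj X' *m cutmx X Y *m proj Y'.
Proof.
move=> /subsetP sX /subsetP sY; apply/matrixP => i j.
rewrite mul_mx_diag mul_diag_mx !mxE.
have := sX i; have := sY j; case: (i \in X'); case: (j \in Y') => /=;
  rewrite ?mulr0 ?mul0r ?mulr1 ?mul1r //.
by move=> -> // ->.
Qed.

Lemma cutrkS (X Y X' Y' : {set 'I_n}) :
  X' \subset X -> Y' \subset Y -> (cutrk X' Y' <= cutrk X Y)%N.
Proof.
move=> sX sY; rewrite /cutrk (cutmxE sX sY).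
by apply: leq_trans (mxrankM_maxl _ _) _; apply: mxrankM_maxr.
Qed.

Lemma cutrkC X Y : cutrk X Y = cutrk Y X.
Proof.
rewrite /cutrk -mxrank_tr; congr mxrank; apply/matrixP => i j; rewrite !mxE andbC.
by rewrite Esym.
Qed.

Definition dotF (r : nat) (a b : 'rV['F_2]_r) : 'F_2 := \sum_l a 0 l * b 0 l.

(** A rank factorization, with one vector for each row and each column. In this form low cut-rank
    can be guessed vertex by vertex. *)
Lemma cutrkP X Y r : (cutrk X Y <= r)%N <-> exists a b : 'I_n -> 'rV['F_2]_r,
   forall i j, i \in X -> j \in Y -> (E i j)%:R = dotF (a i) (b j).
Proof.
split=> [rr|[a [b H]]].
  pose A := cutmx X Y.
  pose P := col_ebase A *m (pid_mx (\rank A) : 'M_(n, r)).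
  pose Q := (pid_mx (\rank A) : 'M_(r, n)) *m row_ebase A.
  have PQ : P *m Q = A.
    by rewrite mulmxA -[P *m _]mulmxA pid_mx_id // mulmx_ebase.
  exists (fun i => row i P), (fun j => (col j Q)^T) => i j iX jY.
  have := congr1 (fun B : 'M_n => B i j) PQ.
  rewrite [RHS]mxE iX jY /= => <-; rewrite mxE.
  by apply: eq_bigr => l _; rewrite !mxE.
pose P := \matrix_(i, l) (if i \in X then a i 0 l else 0).
pose Q := \matrix_(l, j) (if j \in Y then b j 0 l else 0).
have -> : cutrk X Y = \rank (P *m Q).
  congr mxrank; apply/matrixP => i j; rewrite !mxE.
  case: ifP => [/andP[iX jY]|nXY].
    by rewrite H //; apply: eq_bigr => l _; rewrite !mxE iX jY.
  rewrite big1 // => l _; rewrite !mxE; move: nXY.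
  by case: (i \in X) => /=; [move=> ->; rewrite mulr0|rewrite mul0r].
exact: leq_trans (mxrankM_maxr _ _) (rank_leq_row _).
Qed.

Lemma projM (X Y : {set 'I_n}) : proj X *m proj Y = proj (X :&: Y).
Proof.
apply/matrixP => i j; rewrite mul_diag_mx !mxE inE.
by case: (i \in X); rewrite ?mul1r ?mul0r ?mul0rn.
Qed.

Lemma projD (X Y : {set 'I_n}) : proj (X :|: Y) = proj X + proj (Y :\: X).
Proof.
apply/matrixP => i j; rewrite !mxE !inE -mulrnDl.
by case: (i \in X); case: (i \in Y); rewrite /= ?addr0 ?add0r.
Qed.

Lemma proj_sub (X Y : {set 'I_n}) : X \subset Y -> (proj X <= proj Y)%MS.
Proof. by move=> /setIidPl <-; rewrite -projM submxMl. Qed.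

Lemma sub_projP m (A : 'M_(m, n)) (X : {set 'I_n}) : (A <= proj X)%MS -> A *m proj X = A.
Proof. by case/submxP => B ->; rewrite -mulmxA projM setIid. Qed.

Lemma proj_cap (X Y : {set 'I_n}) : (proj X :&: proj Y <= proj (X :&: Y))%MS.
Proof.
set A := (_ :&: _)%MS; have AX : A *m proj X = A by apply/sub_projP/capmxSl.
have AY : A *m proj Y = A by apply/sub_projP/capmxSr.
by rewrite -AY -AX -mulmxA projM submxMl.
Qed.

Definition rows (X : {set 'I_n}) : 'M['F_2]_n := proj X *m cutmx setT setT.

(** Cut-rank is the dimension of the row space of [X] modulo the coordinates outside [Y]. Expressed
    by the dimension of a sum of subspaces, it is open to the modular law for dimensions. *)
Lemma cutrk_dim (X Y : {set 'I_n}) :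
  \rank (rows X + proj (~: Y))%MS = (cutrk X Y + \rank (proj (~: Y)))%N.
Proof.
have U : cutmx X Y = rows X *m proj Y by rewrite (cutmxE (subsetT X) (subsetT Y)).
have p1 : 1%:M = proj Y + proj (~: Y).
  rewrite -[~: Y]setTD -projD setUT.
  by apply/matrixP => i j; rewrite !mxE inE.
have E1 : (rows X + proj (~: Y) :=: cutmx X Y + proj (~: Y))%MS.
  apply/eqmxP/andP; split; rewrite addsmx_sub addsmxSr andbT U.
    by rewrite -{1}[rows X]mulmx1 p1 mulmxDr addmx_sub_adds // submxMl.
  have -> : rows X *m proj Y = rows X - rows X *m proj (~: Y).
    by rewrite -[X in X - _]mulmx1 p1 mulmxDr addrK.
  by rewrite addmx_sub_adds // eqmx_opp submxMl.
rewrite E1 mxrank_disjoint_sum //; apply/eqP; rewrite -submx0.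
set A := (_ :&: _)%MS.
have A1 : A *m proj (~: Y) = A by apply/sub_projP/capmxSr.
have /submxP[B EB] : (A <= cutmx X Y)%MS by apply: capmxSl.
have A2 : A *m proj Y = A by rewrite EB U -!mulmxA projM setIid.
have p0 : proj set0 = 0 by apply/matrixP => i j; rewrite !mxE inE mul0rn.
have : A *m proj (~: Y) *m proj Y = A by rewrite A1 A2.
by rewrite -mulmxA projM setIC setICr p0 mulmx0 => <-; apply: submx_refl.
Qed.

(** The subspace for [X :&: X'] lies in the intersection of the two given ones, and that for
    [X :|: X'] in their sum. The modular law gives the inequality, and the coordinate subspaces
    cancel because their dimensions are modular. *)
Lemma cutrk_submod (X Y X' Y' : {set 'I_n}) :
  (cutrk (X :&: X') (Y :|: Y') + cutrk (X :|: X') (Y :&: Y') <= cutrk X Y + cutrk X' Y')%N.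
Proof.
have rows_sub (Z Z' : {set 'I_n}) : Z \subset Z' -> (rows Z <= rows Z')%MS.
  by move=> /setIidPl <-; rewrite /rows -projM -mulmxA submxMl.
have h1 : (rows (X :&: X') + proj (~: (Y :|: Y')) <=
    (rows X + proj (~: Y)) :&: (rows X' + proj (~: Y')))%MS.
  by rewrite sub_capmx !addsmxS ?rows_sub ?proj_sub ?subsetIl ?subsetIr //
    setCU ?subsetIl ?subsetIr.
have h2 : (rows (X :|: X') + proj (~: (Y :&: Y')) <=
    (rows X + proj (~: Y)) + (rows X' + proj (~: Y')))%MS.
  have sl := addsmxSl (rows X + proj (~: Y))%MS (rows X' + proj (~: Y'))%MS.
  have sr := addsmxSr (rows X + proj (~: Y))%MS (rows X' + proj (~: Y'))%MS.
  rewrite addsmx_sub setCI; apply/andP; split.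
    rewrite {1}/rows projD mulmxDl addmx_sub //.
      by rewrite -/(rows X); apply: (submx_trans _ sl); apply: addsmxSl.
    rewrite -/(rows _); apply: (submx_trans _ sr); apply: (submx_trans _ (addsmxSl _ _)).
    by apply: rows_sub; apply: subsetDl.
  rewrite projD addmx_sub //; first exact: (submx_trans (addsmxSr _ _) sl).
  apply: (submx_trans _ sr); apply: (submx_trans _ (addsmxSr _ _)).
  by apply: proj_sub; apply: subsetDl.
have k1 : (proj (~: Y) + proj (~: Y') <= proj (~: (Y :&: Y')))%MS.
  by rewrite addsmx_sub setCI !proj_sub ?subsetUl ?subsetUr.
have k2 := proj_cap (~: Y) (~: Y'); rewrite -setCU in k2.
have := (mxrankS h1, mxrankS h2, mxrankS k1, mxrankS k2).
have := mxrank_sum_cap (proj (~: Y)) (proj (~: Y')).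
have := mxrank_sum_cap (rows X + proj (~: Y))%MS (rows X' + proj (~: Y'))%MS.
by rewrite !cutrk_dim => e1 e2 [[[]]]; lia.
Qed.

Lemma cutrkU (X Y Y' : {set 'I_n}) : (cutrk X (Y :|: Y') <= cutrk X Y + cutrk X Y')%N.
Proof.
have := cutrk_submod X Y X Y'; rewrite setIid setUid; exact: leq_trans (leq_addr _ _).
Qed.

Lemma cutrk1 v Y : (cutrk [set v] Y <= 1)%N.
Proof.
apply/cutrkP; exists (fun=> const_mx 1), (fun j => const_mx (E v j)%:R) => i j.
by rewrite inE => /eqP -> _; rewrite /dotF big_ord1 !mxE mul1r.
Qed.

Lemma cutrk_set0 X : cutrk X set0 = 0%N.
Proof.
apply/eqP; rewrite -leqn0; apply/cutrkP.
by exists (fun=> 0), (fun=> 0) => i j _; rewrite inE.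
Qed.

Definition good_cut (R : nat) (V B : {set 'I_n}) : bool := (cutrk B (V :\: B) <= R)%N.

(** Below rank [R] any single vertex can be split off, as moving it raises the rank by at most one.
    Otherwise the two halves are the parts of [B] inside and outside [Z]. *)
Lemma split_exists (V B : {set 'I_n}) (R : nat) : B \subset V -> (1 < #|B|)%N ->
  good_cut R V B ->
  (cutrk B (V :\: B) < R)%N \/
    (exists k (Z : {set 'I_n}), [/\ (cutrk (Z :&: V) (V :\: Z) <= k)%N,
       (k < cutrk ((V :\: B) :&: Z) B)%N & (k < cutrk ((V :\: B) :\: Z) B)%N]) ->
  exists B1 : {set 'I_n}, [/\ B1 \subset B, B1 != set0, B :\: B1 != set0,
    good_cut R V B1 & good_cut R V (B :\: B1)].
Proof.
move=> BV B2 gB [rR|[k [Z [Zk kZ kZ']]]].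
  have /card_gt0P[v vB] : (0 < #|B|)%N by apply: leq_trans B2.
  have vV : v \in V by apply: (subsetP BV).
  exists [set v]; split; rewrite ?sub1set //.
  - by apply/set0Pn; exists v; rewrite inE.
  - by rewrite -card_gt0; move: B2; rewrite (cardsD1 v) vB.
  - by apply: leq_trans (cutrk1 _ _) _; apply: leq_trans rR.
  - rewrite /good_cut; have -> : V :\: (B :\ v) = (V :\: B) :|: [set v].
      apply/setP => x; rewrite !inE; case: (eqVneq x v) => [->|]; first by rewrite vV orbT.
      by rewrite /= orbF.
    apply: leq_trans (cutrkU _ _ _) _.
    apply: leq_trans rR; rewrite -addn1; apply: leq_add.
      by apply: cutrkS => //; apply: subsetDl.
    by rewrite cutrkC; apply: cutrk1.
set A := V :\: B in kZ kZ'.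
(* The union of [B] with one side of the cut still has rank above [k] towards
   the other side, so submodularity makes the intersection cheaper than [B]. *)
have side (Y : {set 'I_n}) : (cutrk (Y :&: V) (V :\: Y) <= k)%N -> (k < cutrk (A :\: Y) B)%N ->
    good_cut R V (B :&: Y).
  move=> Yk kY; have := cutrk_submod B A (Y :&: V) (V :\: Y).
  have -> : B :&: (Y :&: V) = B :&: Y.
    by apply/setP => x; rewrite !inE; have := subsetP BV x; case: (x \in B) => //= ->; rewrite ?andbT.
  have -> : A :|: V :\: Y = V :\: (B :&: Y).
    by apply/setP => x; rewrite !inE; case: (x \in B); case: (x \in Y); case: (x \in V).
  have -> : A :&: (V :\: Y) = A :\: Y.
    by apply/setP => x; rewrite !inE; case: (x \in B); case: (x \in Y); case: (x \in V).
  have : (cutrk (A :\: Y) B <= cutrk (B :|: Y :&: V) (A :\: Y))%N.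
    by rewrite cutrkC; apply: cutrkS => //; apply: subsetUl.
  by move: gB; rewrite /good_cut -/A; lia.
have BDZ : B :\: (B :&: Z) = B :&: ~: Z 
  by apply/setP => x; rewrite !inE; case: (x \in B); rewrite /= ?andbT ?andbF.
have Zk' : (cutrk (~: Z :&: V) (V :\: ~: Z) <= k)%N.
  by rewrite setDE setCK [V :&: Z]setIC [~: Z :&: V]setIC -setDE cutrkC.
have kA : (k < cutrk (A :\: ~: Z) B)%N by rewrite setDE setCK.
exists (B :&: Z); split; rewrite ?BDZ ?subsetIl ?side //.
(* If [B] missed [Z], the cut of [Z] would contain the cut between [A :&: Z] and [B], whose rank is
   above [k]. *)
- apply: contraTneq kZ => BZ; rewrite -leqNgt; apply: leq_trans Zk.
  apply: cutrkS; first by rewrite setIC setIS // subsetDl.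
  rewrite subsetD BV /=; apply/pred0P => x /=; apply/negP => /andP[xB xZ].
  by have := in_set0 x; rewrite -BZ inE xB xZ.
- apply: contraTneq kZ' => BZ; rewrite -leqNgt; apply: leq_trans Zk; rewrite cutrkC.
  apply: cutrkS; last by rewrite setSD // subsetDl.
  apply/subsetP => x xB; rewrite inE (subsetP BV) // andbT.
  by apply/negPn/negP => xZ; have := in_set0 x; rewrite -BZ !inE xB xZ.
Qed.

End CutRank.

(** * Cuts of subterms of a clique-width expression *)

Lemma klab_lt k e u : valid_kexp k e -> u < kv e -> klab e u < k.
Proof.
elim: e u => [l|a IHa b IHb|i j a IHa|i j a IHa] u //=.
- move=> /andP[va vb] Hu; case: (ltnP u (kv a)) => Hua; first exact: IHa.
  by apply: IHb => //; lia.
- by move=> /and4P[_ _ _ va]; apply: IHa.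
- by move=> /and3P[ik jk va] Hu; case: ifP => // _; apply: IHa.
Qed.

Section Walk.
Variables (n : nat) (E : rel 'I_n) (s : {perm 'I_n}) (k : nat) (w : {set 'I_n} -> nat).
Hypothesis Esym : forall x y, E x y = E y x.
Hypothesis w0 : w set0 <= 1.
Hypothesis w1 : forall v, w [set v] <= 1.
Hypothesis w_mono : forall X Y : {set 'I_n}, X \subset Y -> w X <= w Y.
Hypothesis wU : forall X Y : {set 'I_n}, w (X :|: Y) <= w X + w Y.

Definition block (e : kexp) (o : nat) : {set 'I_n} := [set x | o <= s x < o + kv e].

(* The edges of the final graph inside and around a subterm are determined by
   its own edges and the labels at that stage. *)
Definition context (e : kexp) (o : nat) : Prop :=
  exists (J : nat -> nat -> bool) (h : nat -> 'I_n -> bool),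
   (forall x y, x \in block e o -> y \in block e o ->
     E x y = kedge e (s x - o) (s y - o) || J (klab e (s x - o)) (klab e (s y - o))) /\
   (forall x y, x \in block e o -> y \notin block e o -> E x y = h (klab e (s x - o)) y).

(** Adjacency to the outside depends only on the label, so indicator vectors of the [k] labels
    factorize the cut. *)
Lemma context_cut e o : valid_kexp k e -> context e o ->
  cutrk E (block e o) (~: block e o) <= k.
Proof.
move=> ve [J [h [_ H]]]; apply/cutrkP.
exists (fun x => \row_l (val l == klab e (s x - o))%:R)%R, (fun y => \row_l (h (val l) y)%:R)%R.
move=> x y xB; rewrite inE => yB; rewrite H // /dotF.
have lk : klab e (s x - o) < k.
  by apply: klab_lt => //; move: xB; rewrite inE; lia.
rewrite (bigD1 (Ordinal lk)) //= !mxE eqxx mul1r big1 ?addr0 // => l ne.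
rewrite !mxE [_ == _](_ : _ = false) ?mul0r //.
by apply: contraNF ne => /eqP El; apply/eqP/val_inj.
Qed.

Lemma balanced e o : valid_kexp k e -> context e o -> k < w (block e o) ->
  (2 * k < w (block e o) ->
    exists Z : {set 'I_n}, [/\ cutrk E Z (~: Z) <= k, k < w Z & w Z <= 2 * k]) ->
  exists Z : {set 'I_n}, [/\ cutrk E Z (~: Z) <= k, k < w Z & w Z <= 2 * k].
Proof.
move=> ve ce kw H; case: (leqP (w (block e o)) (2 * k)) => [w2|/H //].
by exists (block e o); split=> //; apply: context_cut.
Qed.

(** While the weight exceeds [2 * k], one child of a union weighs more than [k] by subadditivity;
    joins and relabellings keep the vertex set. The descent ends at the first subterm of weight at
    most [2 * k]; a leaf, of weight at most 1, is too light to be reached. *)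
Lemma walk e o : valid_kexp k e -> context e o -> k < w (block e o) ->
  exists Z : {set 'I_n}, [/\ cutrk E Z (~: Z) <= k, k < w Z & w Z <= 2 * k].
Proof.
elim: e o => [l|a IHa b IHb|i j a IHa|i j a IHa] o ve ce kw;
  apply: (balanced ve ce kw) => w2.
- have k0 : 0 < k by move: ve => /=; lia.
  have [x xB] : exists x, x \in block (KVtx l) o.
    by apply/set0Pn; apply: contraTneq kw => ->; rewrite -leqNgt (leq_trans w0).
  have : w (block (KVtx l) o) <= 1.
    apply: leq_trans (w1 x); apply: w_mono; apply/subsetP => y yB.
    rewrite inE; apply/eqP; apply: (@perm_inj _ s); apply: val_inj => /=.
    by move: xB yB; rewrite !inE /=; lia.
  by lia.
- move: ve ce => /= /andP[va vb] [J [h [H1 H2]]].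
  have EB x : (x \in block (KUnion a b) o) = (x \in block a o) || (x \in block b (o + kv a)).
    by rewrite !inE /=; lia.
  have dis x : x \in block a o -> x \notin block b (o + kv a) by rewrite !inE; lia.
  have : w (block (KUnion a b) o) <= w (block a o) + w (block b (o + kv a)).
    by apply: leq_trans (wU _ _); apply: w_mono; apply/subsetP => x; rewrite EB in_setU.
  case: (ltnP k (w (block a o))) => [ka _|ka wab].
    apply: IHa va _ ka.
    (* A union adds no edge between its children, so an edge from [a] to a vertex of the sibling is
       created later and depends on the two labels through [J]. *)
    exists J, (fun l y => if y \in block b (o + kv a) then J l (klab b (s y - (o + kv a))) else h l y).
    split=> x y xa ya.
      rewrite H1 ?EB ?xa ?ya //=; move: xa ya; rewrite !inE => xa ya.
      by rewrite !ifT //; lia.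
    case: ifP => yb.
      rewrite H1 ?EB ?xa ?yb ?orbT //=; move: xa ya yb; rewrite !inE => xa ya yb.
      rewrite ifF; last by lia. rewrite ifF; last by lia.
      rewrite ifT; last by lia. rewrite ifF; last by lia.
      by rewrite subnDA.
    rewrite H2 ?EB ?xa ?(negPf ya) ?yb //=; move: xa; rewrite inE => xa.
    by rewrite ifT //; lia.
  apply: (IHb (o + kv a) vb) => [|]; last by lia.
  exists J, (fun l y => if y \in block a o then J l (klab a (s y - o)) else h l y).
  split=> x y xb yb.
    rewrite H1 ?EB ?xb ?yb ?orbT //=; move: xb yb; rewrite !inE => xb yb.
    rewrite ifF; last by lia. rewrite ifT; last by lia.
    by rewrite !ifF; [rewrite !subnDA|lia|lia].
  case: ifP => ya.
    rewrite H1 ?EB ?xb ?ya ?orbT //=; move: xb ya yb; rewrite !inE => xb ya yb.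
    rewrite ifF; last by lia. rewrite ifF; last by lia.
    rewrite ifF; last by lia. rewrite ifT; last by lia.
    by rewrite subnDA.
  rewrite H2 ?EB ?xb ?(negPf yb) ?ya ?orbT //=; move: xb; rewrite inE => xb.
  by rewrite ifF ?subnDA //; lia.
- move: ve ce => /= /and4P[ik jk _ va] [J [h [H1 H2]]]; apply: (IHa o va _ kw).
  exists (fun l l' => ((l == i) && (l' == j)) || ((l == j) && (l' == i)) || J l l'), h.
  split=> // x y xB yB; rewrite H1 //=.
  have xa : s x - o < kv a by move: xB; rewrite inE; lia.
  have ya : s y - o < kv a by move: yB; rewrite inE; lia.
  by rewrite xa ya /= -!orbA.
- move: ve ce => /= /and3P[ik jk va] [J [h [H1 H2]]]; apply: (IHa o va _ kw).
  pose f l := if l == i then j else l.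
  exists (fun l l' => J (f l) (f l')), (fun l y => h (f l) y).
  by split=> x y xB yB; [apply: H1|apply: H2].
Qed.

End Walk.

(** The last hypothesis has two cases because the width used below is the minimum of [3 * k + 1] and
    [n - 1]. When [n - 1] is the smaller one, the rank of [B] is below it merely because few
    vertices lie outside [B]. *)
Theorem split_cw n (E : rel 'I_n) (k R : nat) (V B : {set 'I_n}) :
  (forall x y, E x y = E y x) -> cw_le E k -> B \subset V -> 1 < #|B| -> good_cut E R V B ->
  3 * k < R \/ cutrk E B (V :\: B) < R ->
  exists B1 : {set 'I_n}, [/\ B1 \subset B, B1 != set0, B :\: B1 != set0,
    good_cut E R V B1 & good_cut E R V (B :\: B1)].
Proof.
move=> Esym [e [ve [en [s Es]]]] BV B2 gB kR; apply: split_exists => //.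
case: (ltnP (cutrk E B (V :\: B)) R) => rR; [by left|right].
have {rR} rR : cutrk E B (V :\: B) = R by apply/eqP; rewrite eqn_leq rR andbT.
have {}kR : 3 * k < R by case: kR => //; rewrite rR ltnn.
set A := V :\: B in rR *; pose w (Z : {set 'I_n}) := cutrk E (A :&: Z) B.
have wU (X Y : {set 'I_n}) : w (X :|: Y) <= w X + w Y.
  by rewrite /w setIUr !(cutrkC Esym _ B); apply: cutrkU.
have bT : block s e 0 = setT by apply/setP => x; rewrite !inE leq0n add0n en ltn_ord.
have [Z [Zk kZ Zk2]] : exists Z : {set 'I_n},
    [/\ cutrk E Z (~: Z) <= k, k < w Z & w Z <= 2 * k].
  apply: (@walk _ E s k w _ _ _ _ e 0) => //.
  - by rewrite /w setI0 (cutrkC Esym) cutrk_set0.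
  - by move=> v; apply: leq_trans (cutrk1 E v B); apply: cutrkS => //; apply: subsetIr.
  - by move=> X Y XY; apply: cutrkS => //; apply: setIS.
  - exists (fun _ _ => false), (fun _ _ => false); split=> x y.
      by rewrite orbF !subn0 Es.
    by rewrite bT inE => _; rewrite inE.
  - by rewrite /w bT setIT (cutrkC Esym) rR; lia.
exists k, Z; split=> //.
  by apply: leq_trans Zk; apply: cutrkS; [apply: subsetIl|rewrite setDE subsetIr].
(* [A :&: Z] carries rank at most [2 * k] out of more than [3 * k], so more than [k] is left for
   [A :\: Z]. *)
have := cutrkU E B (A :&: Z) (A :\: Z).
by rewrite setID rR (cutrkC Esym _ (A :&: Z)) (cutrkC Esym _ (A :\: Z)) -/(w Z); lia.
Qed.

(** * Splitting sets of low cut-rank *)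

Definition pset (s : seq nat) : seq (seq nat) :=
  foldl (fun acc x => acc ++ [seq x :: u | u <- acc]) [:: [::]] s.

Lemma pset_rcons s x : pset (rcons s x) = pset s ++ [seq x :: u | u <- pset s].
Proof. by rewrite /pset foldl_rcons. Qed.

Lemma size_pset s : size (pset s) = 2 ^ size s.
Proof.
elim/last_ind: s => // s x IH.
by rewrite pset_rcons size_cat size_map IH size_rcons expnS mul2n addnn.
Qed.

Lemma mem_pset_filter s (P : pred nat) : rev (filter P s) \in pset s.
Proof.
elim/last_ind: s => // s x IH.
rewrite pset_rcons filter_rcons mem_cat; case: (P x); last by rewrite IH.
by rewrite rev_rcons map_f ?orbT.
Qed.

Lemma pset_subseq s a : a \in pset s -> subseq (rev a) s.
Proof.
elim/last_ind: s a => [|s x IH] a; first by rewrite inE => /eqP ->.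
rewrite pset_rcons mem_cat => /orP[/IH H|/mapP[u /IH H ->]].
  by apply: subseq_trans H (subseq_rcons _ _).
by rewrite rev_cons -!cats1 cat_subseq.
Qed.

(** Vectors over the two-element field are lists of the coordinates equal to 1, in decreasing order
    when taken from [pset (iota 0 r)]. This is their inner product, the parity of the common
    support. *)
Definition dot (a b : seq nat) : bool := foldl (fun p _ => ~~ p) false [seq x <- a | x \in b].

Lemma dotE a b : dot a b = odd (size [seq x <- a | x \in b]).
Proof.
suff H c s : foldl (fun p (_ : nat) => ~~ p) c s = c (+) odd (size s) by rewrite /dot H.
elim: s c => [|x s IH] c /=; first by rewrite addbF.
by rewrite IH addNb addbN.
Qed.

Section Vectors.
Variable r : nat.
Local Open Scope ring_scope.

Definition to_vec (a : seq nat) : 'rV['F_2]_r := \row_l (val l \in a)%:R.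
Definition of_vec (v : 'rV['F_2]_r) : seq nat :=
  rev [seq i <- iota 0 r | if insub i is Some l then v 0 l != 0 else false].

Lemma F2_bool (x : 'F_2) : (x != 0)%:R = x.
Proof. by case: x => [] [|[|]] // i; apply: val_inj. Qed.

Lemma of_vecK v : to_vec (of_vec v) = v.
Proof.
apply/rowP => l; rewrite mxE mem_rev mem_filter mem_iota /= add0n ltn_ord andbT.
by rewrite valK F2_bool.
Qed.

Lemma of_vec_pset v : of_vec v \in pset (iota 0 r).
Proof. exact: mem_pset_filter. Qed.

Lemma bool_F2_inj (b c : bool) : (b%:R : 'F_2) = c%:R -> b = c.
Proof. by case: b; case: c. Qed.

Lemma natr_odd m : (m%:R : 'F_2) = (odd m)%:R.
Proof.
rewrite -[in LHS](odd_double_half m) natrD -muln2 natrM.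
by rewrite (_ : 2%:R = 0 :> 'F_2) ?mulr0 ?addr0 //; apply: val_inj.
Qed.

Lemma dot_to_vec a b : a \in pset (iota 0 r) -> (dot a b)%:R = dotF (to_vec a) (to_vec b).
Proof.
move=> /pset_subseq sa; have ua : uniq a by rewrite -rev_uniq (subseq_uniq sa) ?iota_uniq.
have ra x : x \in a -> (x < r)%N.
  by rewrite -mem_rev => /(mem_subseq sa); rewrite mem_iota.
rewrite dotE -natr_odd size_filter /dotF.
have -> : count (mem b) a = (\sum_(l < r) (val l \in a) * (val l \in b))%N.
  rewrite -(big_mkord xpredT (fun l => (l \in a) * (l \in b)))%N /index_iota subn0.
  have /seq.permP -> : perm_eq a [seq x <- iota 0 r | x \in a].
    apply: uniq_perm => //; first by rewrite filter_uniq ?iota_uniq.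
    by move=> x; rewrite mem_filter mem_iota add0n; case: (boolP (x \in a)) => // /ra ->.
  rewrite count_filter -sum1_count big_mkcond; apply: eq_bigr => x _ /=.
  by case: (x \in a); case: (x \in b).
by rewrite natr_sum; apply: eq_bigr => l _; rewrite !mxE natrM.
Qed.

End Vectors.

Definition vecs (r : nat) : seq (seq nat) := pset (iota 0 r).

Notation status_t := (nat * (seq nat * seq nat))%type.

Definition all_status (r : nat) : seq status_t :=
  flatten [seq flatten [seq [seq (p, (a, b)) | b <- vecs r] | a <- vecs r] | p <- [:: 0; 1; 2]].

(* Part 0 is the outside of the set that is split, parts 1 and 2 are its two
   halves; the two vectors factorize the cut of part 1 and the cut of part 2. *)
Definition fits (e : bool) (s t : status_t) : bool :=
  (((s.1 == 1) == (t.1 == 1)) || (e == dot s.2.1 t.2.1)) &&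
  (((s.1 == 2) == (t.1 == 2)) || (e == dot s.2.2 t.2.2)).

Definition forbidden (r : nat) : seq (bool * (status_t * status_t)) :=
  flatten [seq flatten [seq flatten [seq (if fits e s t then [::] else [:: (e, (s, t))])
    | t <- all_status r] | s <- all_status r] | e <- [:: true; false]].

Definition part1 (r : nat) : seq status_t := [seq s <- all_status r | s.1 == 1].

(** For [p > 2] these are statuses outside [all_status]. Splitting involves no domination, so it
    takes [dead 3] and [dead 4], which no vertex receives, for [und] and [dom]. The test for
    well-coveredness has [dead 0], [dead 1] and [dead 2] as its statuses. *)
Definition dead (p : nat) : status_t := (p, ([::], [::])).

Definition insert_layout (T : Type) (v : T) (ts : seq (seq T)) : seq (seq T) :=
  if ts is _ :: _ then ts ++ [:: [:: v]; [::]] else [:: [:: v]].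

Section Split.
Variable (T : eqType) (ed : seq (T * T)).

Definition split_init (r : nat) (V B : seq T) : seq (T * status_t) :=
  flatten [seq [seq (v, s) | s <- all_status r & (v \in B) == (s.1 != 0)] | v <- V].

Definition split_dp (r : nat) (V B : seq T) (ts : seq (seq T)) :=
  dp ed V (all_status r) (forbidden r) (part1 r) (dead 3) (dead 4) (split_init r V B) ts.

Definition halves (B w : seq T) : seq (seq T * seq T) :=
  if [seq x <- B | x \in w] is _ :: _ then
    if [seq x <- B | x \notin w] is _ :: _ then
      [:: ([seq x <- B | x \in w], [seq x <- B | x \notin w])]
    else [::]
  else [::].

Definition split_set (r : nat) (V : seq T) (ts : seq (seq T)) (B : seq T) : seq (seq T * seq T) :=
  if split_dp r V B ts is x :: _ then flatten [seq halves B e.2 | e <- x.2] else [::].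

(** [st.1] lists the sets still to be split, [st.2] the tokens so far. Tokens are put in front, so a
    join emitted before its subtrees follows them in the result, as postfix form requires. A failure
    empties both lists. *)
Definition build_step (r : nat) (V : seq T) (ts : seq (seq T))
    (st : seq (seq T) * seq (seq T)) : seq (seq T) * seq (seq T) :=
  if st.1 is B :: wl then
    if B is _ :: B' then
      if B' is _ :: _ then
        if split_set r V ts B is p :: _ then (p.1 :: p.2 :: wl, [::] :: st.2) else ([::], [::])
      else (wl, B :: st.2)
    else (wl, B :: st.2)
  else st.

(** [V ++ V] only counts steps: each successful step emits one token, and a layout with [size V]
    leaves has [2 * size V - 1] tokens. *)
Definition build (r : nat) (V : seq T) (ts : seq (seq T)) : seq (seq T) :=
  (foldl (fun st (_ : T) => build_step r V ts st) ([:: V], [::]) (V ++ V)).2.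

Definition insert (rs : seq nat) (st : seq T * seq (seq T)) (v : T) : seq T * seq (seq T) :=
  (v :: st.1,
   foldl (fun acc r => if acc is _ :: _ then acc else
     build r (v :: st.1) (insert_layout v st.2))
   [::] rs).

Definition decompose (V : seq T) (rs : seq nat) : seq T * seq (seq T) :=
  foldl (insert rs) ([::], [::]) V.

(** [dead 0] is a chosen vertex, [dead 2] an unchosen one without a chosen neighbour so far,
    [dead 1] an unchosen dominated one. A leaf starts with 0 or 2, and two adjacent chosen vertices
    are forbidden. *)
Definition wc_dp (V : seq T) (ts : seq (seq T)) :=
  dp ed V [:: dead 0; dead 1; dead 2] [:: (true, (dead 0, dead 0))] [:: dead 0]
    (dead 2) (dead 1) (flatten [seq [seq (v, s) | s <- [:: dead 0; dead 2]] | v <- V]) ts.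

Definition closed_entry (e : seq (T * status_t) * seq T) : bool :=
  all (fun p => p.2 != dead 2) e.1.

Definition wc_test (V : seq T) (ts : seq (seq T)) : bool :=
  if wc_dp V ts is x :: _ then
    all (fun e => all (fun e' => closed_entry e ==> (closed_entry e' ==> (size e.2 == size e'.2)))
      x.2) x.2
  else true.

Definition well_covered_alg (V : seq T) (rs : seq nat) : bool :=
  wc_test V (decompose V rs).2.

End Split.

(** * Correctness of the splitting step *)

Lemma mem_all_status r (s : status_t) :
  (s \in all_status r) = [&& s.1 < 3, s.2.1 \in vecs r & s.2.2 \in vecs r].
Proof.
apply/flatten_mapP/and3P => [[p p3 /flatten_mapP[a ar /mapP[b br ->]]]|[s3 ar br]].
  by split=> //; move: p3; rewrite !inE => /or3P[] /eqP ->.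
exists s.1; first by case: s.1 s3 => [|[|[|]]].
apply/flatten_mapP; exists s.2.1 => //; apply/mapP; exists s.2.2 => //.
by case: s {s3 ar br} => [? []].
Qed.

Lemma size_all_status r : size (all_status r) = 3 * (2 ^ r * 2 ^ r).
Proof.
have H (A B : Type) (f : A -> seq B) s c : (forall x, size (f x) = c) ->
    size (flatten (map f s)) = size s * c.
  by move=> fc; elim: s => //= x s IH; rewrite size_cat IH fc mulSn.
rewrite (H _ _ _ _ (2 ^ r * 2 ^ r)) // => p.
by rewrite (H _ _ _ _ (2 ^ r)) => [|a]; rewrite ?size_map size_pset size_iota.
Qed.

Lemma mem_forbidden r e s t : ((e, (s, t)) \in forbidden r) =
  [&& s \in all_status r, t \in all_status r & ~~ fits e s t].
Proof.
apply/flatten_mapP/and3P => [[e' _ /flatten_mapP[s' sr /flatten_mapP[t' tr]]]|[sr tr st]].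
  by case: ifP => // st; rewrite inE => /eqP[-> -> ->]; rewrite st.
exists e; first by case: (e).
by apply/flatten_mapP; exists s => //; apply/flatten_mapP; exists t; rewrite // (negPf st) mem_head.
Qed.

Lemma dotC r a b : a \in vecs r -> b \in vecs r -> dot a b = dot b a.
Proof.
move=> ar br; apply: bool_F2_inj; rewrite (dot_to_vec _ ar) (dot_to_vec _ br).
by apply: eq_bigr => l _; rewrite mulrC.
Qed.

Lemma dot_of_vec r (u v : 'rV['F_2]_r) : ((dot (of_vec u) (of_vec v))%:R = dotF u v)%R.
Proof. by rewrite (dot_to_vec _ (of_vec_pset u)) !of_vecK. Qed.

Lemma fits_sym r e s t : s \in all_status r -> t \in all_status r -> fits e s t = fits e t s.
Proof.
rewrite !mem_all_status => /and3P[_ s1 s2] /and3P[_ t1 t2].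
by rewrite /fits (dotC s1 t1) (dotC s2 t2) (eq_sym (s.1 == 1)) (eq_sym (s.1 == 2)).
Qed.

Lemma forbidden_sym r e s t :
  ((e, (s, t)) \in forbidden r) = ((e, (t, s)) \in forbidden r).
Proof.
rewrite !mem_forbidden; case sr: (s \in _); case tr: (t \in _) => //=.
by rewrite (fits_sym _ sr tr).
Qed.

Lemma dead_all_status r p : 2 < p -> dead p \notin all_status r.
Proof. by move=> p3; rewrite mem_all_status /= ltnNge p3. Qed.

Lemma forbidden_dead r e s : ((e, (dead 4, s)) \in forbidden r) = ((e, (dead 3, s)) \in forbidden r).
Proof. by rewrite !mem_forbidden !(negPf (dead_all_status _ _)). Qed.

Lemma mem_part1 r s : (s \in part1 r) = (s.1 == 1) && (s \in all_status r).
Proof. by rewrite mem_filter. Qed.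

Section SplitCorrect.
Variables (n : nat) (E : rel 'I_n) (ed : seq ('I_n * 'I_n)).
Hypothesis Esym : forall x y, E x y = E y x.
Hypothesis Eirr : forall x, E x x = false.
Hypothesis edE : forall x y, adj ed x y = E x y.

Definition good (r : nat) (V B : seq 'I_n) : bool :=
  good_cut E r [set x in V] [set x in B].

Section Fixed.
Variables (r : nat) (V B : seq 'I_n) (t0 : layout 'I_n).
Hypothesis t0V : leaves t0 =i V.
Hypothesis t0u : uniq (leaves t0).
Hypothesis BV : {subset B <= V}.

Let adj_sym x y : adj ed x y = adj ed y x.
Proof. by rewrite !edE Esym. Qed.
Let adj_irr x : adj ed x x = false.
Proof. by rewrite edE Eirr. Qed.
Let init_ok p : p \in split_init r V B -> p.2 \in all_status r.
Proof. by case/flatten_mapP => v _ /mapP[s]; rewrite mem_filter => /andP[_ sr] ->. Qed.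
Let und_dom : dead 4 != dead 3 :> status_t. Proof. by []. Qed.
Let marks_und : dead 3 \notin part1 r. Proof. by rewrite mem_part1. Qed.
Let marks_dom : dead 4 \notin part1 r. Proof. by rewrite mem_part1. Qed.
Let Lam_dom : dead 3 \in all_status r -> dead 4 \in all_status r.
Proof. by rewrite (negPf (dead_all_status _ _)). Qed.

Local Notation valid := (valid ed (forbidden r) (split_init r V B)).

Lemma split_dpE : split_dp ed r V B (toks t0) =
  [:: (leaves t0, table ed V (all_status r) (forbidden r) (part1 r) (dead 3) (dead 4)
     (split_init r V B) t0)].
Proof. exact: dp_toks. Qed.

Lemma mem_split_init v s : ((v, s) \in split_init r V B) =
  [&& v \in V, s \in all_status r & (v \in B) == (s.1 != 0)].
Proof.
apply/flatten_mapP/and3P => [[u uV /mapP[s']]|[vV sr vB]].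
  by rewrite mem_filter => /andP[H sr] [-> ->].
by exists v => //; apply/mapP; exists s => //; rewrite mem_filter vB.
Qed.

Lemma valid_good a (B1 B2 : {set 'I_n}) : valid V a ->
  (forall x, (x \in B1) = (x \in B) && ((a x).1 == 1)) ->
  (forall x, (x \in B2) = (x \in B) && ((a x).1 == 2)) ->
  good_cut E r [set x in V] B1 && good_cut E r [set x in V] B2.
Proof.
move=> [Hi Hf] HB1 HB2.
have ar x : x \in V -> a x \in all_status r.
  by move=> /Hi; rewrite mem_split_init => /and3P[].
have ok x y : x \in V -> y \in V -> x != y -> fits (E x y) (a x) (a y).
  by move=> xV yV xy; have := Hf x y xV yV xy; rewrite mem_forbidden !ar //= negbK edE.
have inV x : x \in V -> (x \in B) = ((a x).1 != 0).
  by move=> /Hi; rewrite mem_split_init => /and3P[_ _ /eqP].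
have part x p : 0 < p -> x \in V -> ((x \in B) && ((a x).1 == p)) = ((a x).1 == p).
  by move=> p0 xV; rewrite inV //; case: (eqVneq (a x).1 p) => [->|_]; rewrite ?andbF // -lt0n p0.
apply/andP; split; apply/cutrkP.
- exists (fun x => to_vec r (a x).2.1), (fun x => to_vec r (a x).2.1) => x y.
  rewrite HB1 inE HB1 inE => /andP[xB a1] /andP[ny yV].
  have xV := BV xB; rewrite part // in ny.
  have := ok x y xV yV; rewrite /fits a1 (negPf ny) /=.
  have -> : x != y by apply: contraTneq a1 => ->.
  move=> /(_ isT) /andP[/eqP -> _]; apply: dot_to_vec.
  by have := ar x xV; rewrite mem_all_status => /and3P[].
- exists (fun x => to_vec r (a x).2.2), (fun x => to_vec r (a x).2.2) => x y.
  rewrite HB2 inE HB2 inE => /andP[xB a1] /andP[ny yV].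
  have xV := BV xB; rewrite part // in ny.
  have := ok x y xV yV; rewrite /fits a1 (negPf ny) /=.
  have -> : x != y by apply: contraTneq a1 => ->.
  move=> /(_ isT) /andP[_ /eqP ->]; apply: dot_to_vec.
  by have := ar x xV; rewrite mem_all_status => /and3P[].
Qed.

(** For each of the two cuts a vertex carries the row vector of the factorization if it belongs to
    the part, and the column vector otherwise. Since [dot] is symmetric, the order of two vertices
    across the cut does not matter. *)
Lemma good_valid (B1 B2 : {set 'I_n}) : B1 :|: B2 = [set x in B] -> [disjoint B1 & B2] ->
  good_cut E r [set x in V] B1 -> good_cut E r [set x in V] B2 ->
  exists2 a, valid V a & forall x, x \in V ->
    ((a x).1 == 1) = (x \in B1) /\ ((a x).1 == 2) = (x \in B2).
Proof.
move=> B12 dis /cutrkP[a1 [b1 H1]] /cutrkP[a2 [b2 H2]].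
pose a x : status_t := (if x \in B1 then 1 else if x \in B2 then 2 else 0,
  (of_vec (if x \in B1 then a1 x else b1 x), of_vec (if x \in B2 then a2 x else b2 x))).
have dis2 x : x \in B2 -> x \notin B1 by move=> x2; apply: contraL x2 => /(disjointFr dis) ->.
have E1 x : ((a x).1 == 1) = (x \in B1).
  by rewrite /a /=; case: (x \in B1) => //; case: (x \in B2).
have E2 x : ((a x).1 == 2) = (x \in B2).
  by rewrite /a /=; case: (boolP (x \in B2)) => [/dis2/negPf ->|] //; case: (x \in B1).
have ar x : a x \in all_status r.
  by rewrite mem_all_status /= !of_vec_pset !andbT; case: ifP => // _; case: ifP.
exists a => // ; split=> [x xV|x y xV yV xy].
  rewrite mem_split_init xV ar /=.
  have -> : (x \in B) = (x \in B1) || (x \in B2) by rewrite -in_setU B12 inE.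
  by case: (x \in B1) => //; case: (x \in B2).
have key (C : {set 'I_n}) (f g : 'I_n -> 'rV['F_2]_r) :
   (forall i j, i \in C -> j \in [set x in V] :\: C -> ((E i j)%:R = dotF (f i) (g j))%R) ->
   (x \in C) != (y \in C) ->
   E x y = dot (of_vec (if x \in C then f x else g x)) (of_vec (if y \in C then f y else g y)).
  move=> H; case xC: (x \in C); case yC: (y \in C) => // _.
    by apply: bool_F2_inj; rewrite dot_of_vec -H // !inE yC yV.
  rewrite (dotC (r := r)) ?of_vec_pset // Esym.
  by apply: bool_F2_inj; rewrite dot_of_vec -H // !inE xC xV.
rewrite mem_forbidden !ar /= negbK edE /fits !E1 !E2.
by apply/andP; split; case: (eqVneq (_ \in _) (_ \in _)) => //= ne; apply/eqP; exact: key.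
Qed.

Lemma leaves_valid a : valid (leaves t0) a <-> valid V a.
Proof. by split; apply: valid_sub => x; rewrite t0V. Qed.

Lemma status_valid W a v : valid V a -> v \in V -> status ed (part1 r) (dead 3) (dead 4) W a v = a v.
Proof.
move=> [Hi _] /Hi; rewrite mem_split_init => /and3P[_ ar _].
rewrite /status ifF //; apply/negP => /andP[/eqP av _].
by have := dead_all_status r (p := 3) isT; rewrite -av ar.
Qed.

Lemma mem_marked a x : valid V a -> x \in V ->
  (x \in marked (part1 r) (leaves t0) a) = ((a x).1 == 1).
Proof.
move=> [Hi _] xV; rewrite mem_filter t0V xV andbT mem_part1.
by have := Hi x xV; rewrite mem_split_init => /and3P[_ -> _]; rewrite andbT.
Qed.

Lemma mem_halves (w : seq 'I_n) p : p \in halves B w ->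
  [/\ p = ([seq x <- B | x \in w], [seq x <- B | x \notin w]),
   has (mem w) B & has (predC (mem w)) B].
Proof.
rewrite /halves; case E1: [seq x <- B | x \in w] => [|x1 s1] //.
case E2: [seq x <- B | x \notin w] => [|x2 s2] //; rewrite inE => /eqP ->.
by split=> //; rewrite has_filter ?E1 //=; rewrite (_ : [seq _ <- _ | _] = [seq x <- B | x \notin w]) ?E2.
Qed.

Lemma halves_nil (w : seq 'I_n) : has (mem w) B -> has (predC (mem w)) B -> halves B w != [::].
Proof.
rewrite !has_filter /halves; case: [seq x <- B | x \in w] => // x1 s1 _.
by rewrite (_ : [seq _ <- _ | predC _ _] = [seq x <- B | x \notin w]) //; case: [seq _ <- _ | _].
Qed.

Lemma split_sound p : p \in split_set ed r V (toks t0) B ->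
  [/\ perm_eq (p.1 ++ p.2) B, p.1 != [::], p.2 != [::], good r V p.1 & good r V p.2].
Proof.
have tV : {subset leaves t0 <= V} by move=> x; rewrite t0V.
rewrite /split_set split_dpE => /flatten_mapP[e et].
have [a /leaves_valid va ->] := table_sound adj_sym adj_irr (@forbidden_sym r)
  (@forbidden_dead r) und_dom marks_und marks_dom Lam_dom init_ok t0u tV et.
move=> /= /mem_halves[-> h1 h2] /=.
rewrite perm_filterC; have mE := mem_marked va.
have /andP[g1 g2] := @valid_good a [set x in B | (a x).1 == 1] [set x in B | (a x).1 == 2]
  va (fun x => in_set _ _) (fun x => in_set _ _).
split=> //; try by rewrite -has_filter.
- rewrite /good; suff <- : [set x in B | (a x).1 == 1] =
    [set x in [seq x <- B | x \in marked (part1 r) (leaves t0) a]] by [].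
  by apply/setP => x; rewrite !in_set mem_filter; case xB: (x \in B); rewrite ?andbF // mE ?BV ?andbT.
- rewrite /good; suff <- : [set x in B | (a x).1 == 2] =
    [set x in [seq x <- B | x \notin marked (part1 r) (leaves t0) a]] by [].
  apply/setP => x; rewrite !in_set mem_filter; case xB: (x \in B); rewrite ?andbF //= mE ?BV // andbT.
  have := va.1 x (BV xB); rewrite mem_split_init xB mem_all_status => /and3P[_ /and3P[+ _ _]].
  by case: (a x).1 => [|[|[|]]].
Qed.

(** Instead of the intended split the table may hold another assignment [a'] with the same
    signature. Equal signatures contain the same statuses, so [a'] also has vertices in parts 1 and
    2. This is enough, since by soundness every split read off the table is good. *)
Lemma split_complete (B1 : {set 'I_n}) : B1 \subset [set x in B] -> B1 != set0 ->
  [set x in B] :\: B1 != set0 -> good_cut E r [set x in V] B1 ->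
  good_cut E r [set x in V] ([set x in B] :\: B1) -> split_set ed r V (toks t0) B != [::].
Proof.
move=> B1B n1 n2 g1 g2.
have [||a va aE] := good_valid _ _ g1 g2.
- apply/setP => x; rewrite in_setU in_setD; have := subsetP B1B x.
  by case: (x \in B1) => [->|_].

- by rewrite -setI_eq0; apply/eqP/setP => x; rewrite !inE; case: (x \in B1).
have tV : {subset leaves t0 <= V} by move=> x; rewrite t0V.
have /hasP[e et /andP[/eqP /= sE _]] := @table_complete _ _ ed V (all_status r) (forbidden r)
  (part1 r) (dead 3) (dead 4) _ adj_sym adj_irr (@forbidden_sym r) (@forbidden_dead r) und_dom
  marks_und marks_dom Lam_dom init_ok t0 a t0u tV (proj2 (leaves_valid a) va).
rewrite /split_set split_dpE.
suff : halves B e.2 != [::].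
  apply: contra_neq => H; case Eh: (halves B e.2) => [|p s] //.
  have : p \in flatten [seq halves B e.2 | e <- table ed V (all_status r) (forbidden r)
     (part1 r) (dead 3) (dead 4) (split_init r V B) t0].
    by apply/flatten_mapP; exists e; rewrite // Eh mem_head.
  by rewrite H.
have [a' va' eE] := table_sound adj_sym adj_irr (@forbidden_sym r) (@forbidden_dead r)
  und_dom marks_und marks_dom Lam_dom init_ok t0u tV et.
have va'V := proj1 (leaves_valid a') va'.
have transfer v : v \in V -> exists2 v', v' \in V & a' v' = a v.
  move=> vV; have : (rep ed V (leaves t0) v, a v) \in
      signature ed V (all_status r) (part1 r) (dead 3) (dead 4) (leaves t0) a.
    apply/(mem_signature _ _ Lam_dom init_ok); first exact/leaves_valid.
    by exists v; rewrite ?t0V // status_valid.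
  rewrite sE eE /= => /(mem_signature _ _ Lam_dom init_ok _ _ va') [v' v't [_]].
  by rewrite t0V in v't; rewrite status_valid // => ->; exists v'.
have inB b v : valid V b -> v \in V -> (b v).1 != 0 -> v \in B.
  by move=> vb vV; have := vb.1 v vV; rewrite mem_split_init => /and3P[_ _ /eqP ->].
rewrite eE /=; apply: halves_nil; apply/hasP.
- have [x xB1] := set0Pn _ n1; have xB : x \in B by have := subsetP B1B x xB1; rewrite inE.
  have [x' x'V ax] := transfer x (BV xB).
  have a1 : (a' x').1 == 1 by rewrite ax (aE x (BV xB)).1.
  exists x'; last by rewrite /= mem_marked.
  by apply: (inB a') => //; rewrite (eqP a1).
- have [x xB2] := set0Pn _ n2; have xB : x \in B by move: xB2; rewrite !inE => /andP[].
  have [x' x'V ax] := transfer x (BV xB).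
  have a2 : (a' x').1 == 2 by rewrite ax (aE x (BV xB)).2.
  exists x'; last by rewrite /= mem_marked // (eqP a2).
  by apply: (inB a') => //; rewrite (eqP a2).
Qed.

End Fixed.
End SplitCorrect.

(** * Iterative compression *)

Lemma size_toks (T : eqType) (t : layout T) : (size (toks t)).+1 = 2 * size (leaves t).
Proof. by elim: t => //= l IHl r IHr; rewrite !size_cat /=; lia. Qed.

Lemma toks_nil (T : eqType) (t : layout T) : toks t <> [::].
Proof. by move/(congr1 size) => H; have := size_toks t; rewrite H /=; lia. Qed.

Lemma foldl_const (A B : Type) (f : A -> A) (s : seq B) x :
  foldl (fun st _ => f st) x s = iter (size s) f x.
Proof. by elim: s x => //= y s IH x; rewrite IH -iterSr. Qed.

Section BuildCorrect.
Variables (n : nat) (E : rel 'I_n) (ed : seq ('I_n * 'I_n)).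
Hypothesis Esym : forall x y, E x y = E y x.
Hypothesis Eirr : forall x, E x x = false.
Hypothesis edE : forall x y, adj ed x y = E x y.

Local Notation good := (good E).

Lemma eq_good r V V' B B' : V =i V' -> B =i B' -> good r V B = good r V' B'.
Proof.
move=> EV EB; rewrite /good; congr good_cut; apply/setP => x; rewrite !inE; [exact: EV|exact: EB].
Qed.

Fixpoint wide (r : nat) (V : seq 'I_n) (t : layout 'I_n) : bool :=
  good r V (leaves t) && (if t is Node a b then wide r V a && wide r V b else true).

Lemma wide_good r V t : wide r V t -> good r V (leaves t).
Proof. by case: t => [x|a b] /andP[]. Qed.

Section Fixed.
Variables (r : nat) (V : seq 'I_n) (t0 : layout 'I_n).
Hypothesis t0V : leaves t0 =i V.
Hypothesis t0u : uniq (leaves t0).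
Hypothesis Vu : uniq V.

Local Notation step := (build_step ed r V (toks t0)).
Local Notation split := (split_set ed r V (toks t0)).

(** Induction on the size of [B], with arbitrary work list and output so that the halves can be
    processed one after the other. Success takes [2 * size B - 1] steps and failure fewer than
    [2 * size B], so the step count of [build] suffices. *)
Lemma build_or_fail m B : size B <= m -> B != [::] -> uniq B -> {subset B <= V} -> good r V B ->
  (exists t, [/\ perm_eq (leaves t) B, wide r V t &
     forall wl out, iter (size (toks t)) step (B :: wl, out) = (wl, toks t ++ out)]) \/
  ((exists B' : seq 'I_n, [/\ 1 < size B', uniq B', {subset B' <= V}, good r V B' & split B' = [::]]) /\
   exists2 i, i < 2 * size B & forall wl out, iter i step (B :: wl, out) = ([::], [::])).
Proof.
elim: m B => [|m IH] [|x [|y B]] //= sB _ uB BV gB.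
  by left; exists (Leaf x); rewrite /= gB; split.
set B0 := [:: x, y & B] in uB BV gB *.
case Es: (split B0) => [|p rest].
  right; split; first by exists B0.
  by exists 1 => // wl out; rewrite /= /build_step /= -/B0 Es.
have pB : p \in split B0 by rewrite Es mem_head.
have [pp p1 p2 g1 g2] := split_sound Esym Eirr edE t0V t0u BV pB.
have step1 wl out : step (B0 :: wl, out) = (p.1 :: p.2 :: wl, [::] :: out).
  by rewrite /build_step /= -/B0 Es.
have sp : size p.1 + size p.2 = size B0 by rewrite -size_cat; apply: perm_size.
have up : uniq (p.1 ++ p.2) by rewrite (perm_uniq pp).
have {}p1 : p.1 != [::] := p1; have {}p2 : p.2 != [::] := p2.
have s1 : 0 < size p.1 by rewrite lt0n size_eq0.
have s2 : 0 < size p.2 by rewrite lt0n size_eq0.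
have sB0 : size B0 <= m.+1 by [].
have u1 : uniq p.1 by move: up; rewrite cat_uniq => /andP[].
have u2 : uniq p.2 by move: up; rewrite cat_uniq => /and3P[].
have V1 : {subset p.1 <= V} by move=> z zp; apply: BV; rewrite -(perm_mem pp) mem_cat zp.
have V2 : {subset p.2 <= V} by move=> z zp; apply: BV; rewrite -(perm_mem pp) mem_cat zp orbT.
have arith a b c : a + b = c -> 0 < a -> 0 < b -> c <= m.+1 ->
  [/\ a <= m, b <= m, (forall i, i < 2 * a -> i.+1 < 2 * c) &
    forall i k, i < 2 * b -> k.+1 = 2 * a -> i + (k + 1) < 2 * c].
  by clear => *; split=> *; lia.
have [m1 m2 a1 a2] := arith _ _ _ sp s1 s2 sB0.
case: (IH p.1 m1 p1 u1 V1 g1) => [[t1 [P1 W1 R1]]|[F [i1 i1s R1]]]; last first.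
  right; split; first exact: F.
  exists i1.+1; first exact: a1.
  by move=> wl out; rewrite iterSr step1.
have st1 : (size (toks t1)).+1 = 2 * size p.1 by rewrite size_toks (perm_size P1).
case: (IH p.2 m2 p2 u2 V2 g2) => [[t2 [P2 W2 R2]]|[F [i2 i2s R2]]]; last first.
  right; split; first exact: F.
  exists (i2 + (size (toks t1) + 1)); first exact: a2.
  by move=> wl out; rewrite iterD iterD /= step1 R1.
(* The first half is processed first, so its tokens end up behind those of the second half: it
   becomes the right subtree. *)
left; exists (Node t2 t1).
have PB : perm_eq (leaves (Node t2 t1)) B0.
  by rewrite /= perm_catC -(permPr pp); apply: perm_cat.
split=> //.
  by rewrite /= W1 W2 (eq_good _ (fun _ => erefl _) (perm_mem PB)) gB.
move=> wl out; rewrite [toks _]/= !size_cat addnA addn1 iterSr step1 iterD R1 R2.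
by rewrite /= -!catA.
Qed.

Lemma iter_stop i out : iter i step ([::], out) = ([::], out).
Proof. by elim: i => //= i ->. Qed.

Hypothesis V0 : V != [::].

Lemma good_all : good r V V.
Proof. by rewrite /good /good_cut setDv cutrk_set0. Qed.

Lemma build_sound : build ed r V (toks t0) <> [::] ->
  exists t, [/\ build ed r V (toks t0) = toks t, perm_eq (leaves t) V & wide r V t].
Proof.
rewrite /build foldl_const => nz.
have [[t [P W H]]|[_ [i il H]]] := build_or_fail (leqnn (size V)) V0 Vu (fun _ => id) good_all.
- exists t; split=> //.
  have Vs : size (toks t) <= size (V ++ V).
    by rewrite size_cat addnn -mul2n -(perm_size P) -size_toks.
  by rewrite -(subnK Vs) iterD H iter_stop cats0.
- have Vs : i <= size (V ++ V) by rewrite size_cat addnn -mul2n ltnW.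
  by case: nz; rewrite -(subnK Vs) iterD H iter_stop.
Qed.

Lemma build_complete :
  (forall B, 1 < size B -> uniq B -> {subset B <= V} -> good r V B -> split B <> [::]) ->
  build ed r V (toks t0) <> [::].
Proof.
move=> Hs; rewrite /build foldl_const.
have [[t [P W H]]|[[B [B1 uB BV gB sB]] _]] := build_or_fail (leqnn (size V)) V0 Vu (fun _ => id) good_all.
- have Vs : size (toks t) <= size (V ++ V).
    by rewrite size_cat addnn -mul2n -(perm_size P) -size_toks.
  by rewrite -(subnK Vs) iterD H iter_stop cats0; apply: toks_nil.
- by case: (Hs B B1 uB BV gB).
Qed.

End Fixed.
End BuildCorrect.

Lemma cutrk_card n (E : rel 'I_n) (X Y : {set 'I_n}) : cutrk E X Y <= #|Y|.
Proof.
apply/cutrkP; exists (fun x => \row_l (E x (enum_val l))%:R)%R,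
  (fun y => \row_(l < #|Y|) (y == enum_val l)%:R)%R.
move=> x y _ yY; rewrite /dotF (bigD1 (enum_rank_in yY y)) //= !mxE enum_rankK_in // eqxx GRing.mulr1.
rewrite big1 ?GRing.addr0 // => l ne; rewrite !mxE [_ == _](_ : _ = false) ?GRing.mulr0 //.
by apply: contraNF ne => /eqP Ey; apply/eqP; rewrite [X in enum_rank_in _ X]Ey enum_valK_in.
Qed.

Lemma first_success (X : Type) (f : nat -> seq X) r0 m j : m <= r0 < m + j -> f r0 <> [::] ->
  exists r, [/\ r <= r0, f r <> [::] &
    foldl (fun acc r => if acc is _ :: _ then acc else f r) [::] (iota m j) = f r].
Proof.
have stop s x l : foldl (fun acc r => if acc is _ :: _ then acc else f r) (x :: l) s = x :: l.
  by elim: s.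
elim: j m => [|j IH] m Hm fr0 /=; first by lia.
case E: (f m) => [|x l].
  apply: IH => //; have : m <> r0 by move=> Em; apply: fr0; rewrite -Em.
  by lia.
by exists m; rewrite E stop; split=> //; lia.
Qed.

Section Decompose.
Variables (n : nat) (E : rel 'I_n) (ed : seq ('I_n * 'I_n)) (k : nat).
Hypothesis Esym : forall x y, E x y = E y x.
Hypothesis Eirr : forall x, E x x = false.
Hypothesis edE : forall x y, adj ed x y = E x y.
Hypothesis cwk : cw_le E k.

Lemma goodS r r' V B : r <= r' -> good E r V B -> good E r' V B.
Proof. by move=> rr; rewrite /good /good_cut => /leq_trans; apply. Qed.

Lemma wideS r r' V t : r <= r' -> wide E r V t -> wide E r' V t.
Proof.
move=> rr; elim: t => [x|a IHa b IHb] /= /andP[g w]; rewrite (goodS rr g) //=.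
by move: w => /andP[wa wb]; rewrite IHa ?IHb.
Qed.

(** The new vertex contributes one column to the cut, of rank at most 1. *)
Lemma good_grow r V v B : good E r V B -> good E r.+1 (v :: V) B.
Proof.
rewrite /good /good_cut => g; apply: leq_trans (_ : cutrk E [set x in B]
  (([set x in V] :\: [set x in B]) :|: [set v]) <= _).
  by apply: cutrkS => //; apply/subsetP => x; rewrite !inE; case: (x == v); rewrite ?orbT ?orbF.
apply: leq_trans (cutrkU _ _ _ _) _; rewrite -addn1; apply: leq_add => //.
by rewrite cutrkC //; apply: cutrk1.
Qed.

Lemma wide_grow r V v t : wide E r V t -> wide E r.+1 (v :: V) t.
Proof.
elim: t => [x|a IHa b IHb] /= /andP[g w]; rewrite good_grow //=.
by move: w => /andP[wa wb]; rewrite IHa ?IHb.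
Qed.

Lemma wide_insert r V v t : perm_eq (leaves t) V -> wide E r V t ->
  wide E r.+1 (v :: V) (Node t (Leaf v)).
Proof.
move=> P w; rewrite /= wide_grow //= andbT; apply/andP; split.
  rewrite (eq_good _ _ (fun _ => erefl _) (B' := v :: V)); first exact: good_all.
  by move=> x; rewrite mem_cat (perm_mem P) !inE orbC.
rewrite /good /good_cut; have -> : [set x in [:: v]] = [set v] by apply/setP => x; rewrite !inE.
exact: leq_trans (cutrk1 _ _ _) _.
Qed.

(** Ranks are tried up to [n - 1] only. If [3 * k + 1] is larger, [n - 1] is wide enough by itself:
    a set of at least two vertices leaves at most [n - 2] outside, hence has smaller cut-rank. *)
Definition rmax : nat := minn (3 * k).+1 n.-1.

Lemma build_rmax V t0 : leaves t0 =i V -> uniq (leaves t0) -> uniq V -> V != [::] ->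
  build ed rmax V (toks t0) <> [::].
Proof.
move=> t0V t0u Vu V0; apply: (build_complete Esym Eirr edE) => // B B2 uB BV gB.
have BV' : [set x in B] \subset [set x in V] by apply/subsetP => x; rewrite !inE; apply: BV.
have cB : #|[set x in B]| = size B by rewrite cardsE; apply/card_uniqP.
have B2' : 1 < #|[set x in B]| by rewrite cB.
have VB : #|[set x in V] :\: [set x in B]| + size B <= n.
  have c1 := cardsC [set x in B]; rewrite card_ord cB in c1.
  rewrite addnC -[X in _ <= X]c1 leq_add2l.
  by apply: subset_leq_card; rewrite setDE subsetIr.
have kR : 3 * k < rmax \/ cutrk E [set x in B] ([set x in V] :\: [set x in B]) < rmax.
  rewrite /rmax; case: (leqP (3 * k).+1 n.-1) => H; [by left|right].
  apply: leq_ltn_trans (cutrk_card _ _ _) _.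
  by move: VB B2'; rewrite -cB; move: #|_| #|_| => u v; clear; lia.
have [B1 [s1 n1 n2 g1 g2]] := split_cw Esym cwk BV' B2' gB kR.
by apply/eqP; apply: (split_complete Esym Eirr edE t0V t0u BV s1 n1 n2 g1 g2).
Qed.

Definition decomposition (V : seq 'I_n) (ts : seq (seq 'I_n)) : Prop :=
  if V is [::] then ts = [::]
  else exists t, [/\ ts = toks t, perm_eq (leaves t) V & wide E rmax V t].

Lemma insert_layoutP V v ts : uniq (v :: V) -> decomposition V ts ->
  exists t, [/\ insert_layout v ts = toks t, uniq (leaves t), leaves t =i v :: V &
    wide E rmax.+1 (v :: V) t].
Proof.
case: V => [_ ->|u V uV [t [-> P W]]].
  exists (Leaf v); split=> //=; rewrite andbT; apply: good_all.
exists (Node t (Leaf v)); split.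
- by rewrite /insert_layout /=; case Et: (toks t) => //; case: (toks_nil Et).
- by rewrite /= cats1 rcons_uniq (perm_uniq P) (perm_mem P).
- by move=> x; rewrite /= mem_cat (perm_mem P) !inE orbC.
- exact: wide_insert.
Qed.

(** Since [rmax] succeeds, the first success has [r <= rmax], and a layout of width [r] also has
    width [rmax]. So [k] occurs in the invariant without being known to the algorithm. *)
Lemma insert_ok V ts v : uniq (v :: V) -> decomposition V ts ->
  exists r t, [/\ r <= rmax, insert ed (iota 0 n) (V, ts) v = (v :: V, toks t),
    perm_eq (leaves t) (v :: V) & wide E rmax (v :: V) t].
Proof.
move=> uV D; have [t0 [Et0 u0 m0 w0]] := insert_layoutP uV D.
have n0 : 0 < n by case: (n) v {uV D Et0 m0 w0} => // -[].
have b0 := build_rmax m0 u0 uV isT.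
have [|r [rr fr E1]] := @first_success _ (fun r => build ed r (v :: V) (toks t0)) rmax 0 n _ b0.
  by rewrite /rmax; lia.
have [t [Et P W]] := build_sound Esym Eirr edE m0 u0 uV isT fr.
exists r, t; split=> //; last exact: wideS W.
by rewrite /insert /= Et0 -Et -E1.
Qed.

Lemma decompose_prefix V ts s : uniq (rev s ++ V) -> decomposition V ts ->
  (foldl (insert ed (iota 0 n)) (V, ts) s).1 = rev s ++ V /\
  decomposition (rev s ++ V) (foldl (insert ed (iota 0 n)) (V, ts) s).2.
Proof.
elim: s V ts => [|v s IH] V ts //= u D.
rewrite rev_cons cat_rcons in u *.
have uV : uniq (v :: V) by move: u; rewrite cat_uniq => /and3P[].
have [r [t [_ -> P W]]] := insert_ok uV D.
by apply: IH => //; exists t.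
Qed.

End Decompose.

(** * The test for well-coveredness *)

Lemma maximal_independentP n (E : rel 'I_n) (S : {set 'I_n}) : (forall x, E x x = false) ->
  (forall x y, E x y = E y x) ->
  maximal_independent E S <->
  (forall x y, x \in S -> y \in S -> ~~ E x y) /\
  (forall x, x \notin S -> exists2 y, y \in S & E x y).
Proof.
move=> Eirr Esym.
have indP (U : {set 'I_n}) : reflect (forall x y, x \in U -> y \in U -> ~~ E x y) (independent E U).
  apply: (iffP forall_inP) => [H x y xU yU|H x xU]; first exact: (forall_inP (H x xU)).
  by apply/forall_inP => y yU; apply: H.
split.
  move/maxsetP => [/indP iS mS]; split=> // x xS.
  case: (boolP [exists y in S, E x y]) => [/exists_inP[y yS xy]|]; first by exists y.
  rewrite negb_exists_in => /forall_inP nx.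
  have : x |: S = S.
    apply: mS; last exact: subsetUr.
    apply/indP => y z; rewrite !inE => /orP[/eqP ->|yS] /orP[/eqP ->|zS].
    - by rewrite Eirr.
    - exact: nx.
    - by rewrite Esym; apply: nx.
    - exact: iS.
  by move/setP/(_ x); rewrite !inE eqxx (negPf xS).
move=> [/indP iS dS]; apply/maxsetP; split=> // U /indP iU SU.
apply/eqP; rewrite eqEsubset SU andbT; apply/subsetP => x xU.
apply: contraT => /dS[y yS xy].
by have := iU x y xU (subsetP SU y yS); rewrite xy.
Qed.

Section WellCovered.
Variables (n : nat) (E : rel 'I_n) (ed : seq ('I_n * 'I_n)).
Hypothesis Esym : forall x y, E x y = E y x.
Hypothesis Eirr : forall x, E x x = false.
Hypothesis edE : forall x y, adj ed x y = E x y.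
Variables (V : seq 'I_n) (t : layout 'I_n).
Hypothesis tV : leaves t =i V.
Hypothesis tu : uniq (leaves t).
Hypothesis Vall : forall x, x \in V.

Let Lam := [:: dead 0; dead 1; dead 2].
Let forb := [:: (true, (dead 0, dead 0))].
Let marks := [:: dead 0].
Let init := flatten [seq [seq (v, s) | s <- [:: dead 0; dead 2]] | v <- V].

Let adj_sym x y : adj ed x y = adj ed y x.
Proof. by rewrite !edE Esym. Qed.
Let adj_irr x : adj ed x x = false.
Proof. by rewrite edE Eirr. Qed.
Let forb_sym b s u : ((b, (s, u)) \in forb) = ((b, (u, s)) \in forb).
Proof. by rewrite !inE !xpair_eqE; case: b; case: (s == _); case: (u == _). Qed.
Let forb_dom b s : ((b, (dead 1, s)) \in forb) = ((b, (dead 2, s)) \in forb).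
Proof. by rewrite !inE !xpair_eqE /= !andbF. Qed.
Let init_ok p : p \in init -> p.2 \in Lam.
Proof.
case/flatten_mapP => v _ /mapP[s]; rewrite !inE => /orP[]/eqP -> -> //=.
Qed.
Let und_dom : dead 1 != dead 2 :> status_t. Proof. by []. Qed.
Let marks_und : dead 2 \notin marks. Proof. by []. Qed.
Let marks_dom : dead 1 \notin marks. Proof. by []. Qed.
Let Lam_dom : dead 2 \in Lam -> dead 1 \in Lam. Proof. by []. Qed.

Let B := leaves t.
Let Ball x : x \in B. Proof. by rewrite /B tV. Qed.

Lemma mem_init v s : ((v, s) \in init) = (s == dead 0) || (s == dead 2).
Proof.
apply/flatten_mapP/idP => [[u _ /mapP[s' + [_ ->]]]|H]; first by rewrite !inE.
by exists v => //; apply/mapP; exists s; rewrite ?inE.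
Qed.

Definition chosen (a : 'I_n -> status_t) : {set 'I_n} := [set x | a x == dead 0].

Lemma size_marked a : size (marked marks B a) = #|chosen a|.
Proof.
have /card_uniqP <- : uniq (marked marks B a) by rewrite filter_uniq.
by apply: eq_card => x; rewrite mem_filter Ball andbT !inE.
Qed.

(** At the root all vertices are in [B], so a status [dead 2] there means an unchosen vertex without
    any chosen neighbour. Independence comes from validity, and maximality is domination. *)
Lemma closedP a w : valid ed forb init B a ->
  closed_entry (signature ed V Lam marks (dead 2) (dead 1) B a, w) <->
  maximal_independent E (chosen a).
Proof.
move=> va; rewrite maximal_independentP //.
have a02 x : (a x == dead 0) || (a x == dead 2) by have := va.1 x (Ball x); rewrite mem_init.
have ind x y : x \in chosen a -> y \in chosen a -> ~~ E x y.
  rewrite !inE => /eqP ax /eqP ay; apply/negP => xy.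
  have xy' : x != y by apply: contraTneq xy => ->; rewrite Eirr.
  by have := va.2 x y (Ball x) (Ball y) xy'; rewrite edE xy ax ay inE eqxx.
have st x : (status ed marks (dead 2) (dead 1) B a x == dead 2) =
    (x \notin chosen a) && ~~ has (fun y => E x y && (y \in chosen a)) B.
  rewrite /status inE; have -> : has (fun y => adj ed x y && (a y \in marks)) B =
      has (fun y => E x y && (y \in chosen a)) B.
    by apply: eq_has => y; rewrite edE !inE.
  case: (has _ B); rewrite ?andbT ?andbF /=.
    by case: ifP => // ->.
  by have := a02 x; case: (eqVneq (a x) (dead 0)) => [->|_] //= /eqP ->.
split=> [/allP H|[_ H]].
  split=> // x xS.
  have : (rep ed V B x, status ed marks (dead 2) (dead 1) B a x) \in
     signature ed V Lam marks (dead 2) (dead 1) B a.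
    by apply/(mem_signature _ _ Lam_dom init_ok _ _ va); exists x.
  by move/H; rewrite /= st xS /= negbK => /hasP[y _ /andP[xy yS]]; exists y.
apply/allP => -[x s] /(mem_signature _ _ Lam_dom init_ok _ _ va)[v _ [_ ->]] /=.
rewrite st negb_and !negbK; case: (boolP (v \in chosen a)) => //= /H[y yS vy].
by apply/hasP; exists y; rewrite ?Ball // vy.
Qed.

(** Every maximal independent set gives a valid assignment, whose signature and size survive in the
    table; conversely a closed entry comes from a maximal independent set of the size of its
    witness. *)
Lemma wc_correct : wc_test ed V (toks t) <-> well_covered E.
Proof.
have tsub : {subset leaves t <= V} by move=> x _; apply: Vall.
have sound e := @table_sound _ _ ed V Lam forb marks (dead 2) (dead 1) init adj_sym adj_irr
  forb_sym forb_dom und_dom marks_und marks_dom Lam_dom init_ok t e tu tsub.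
have complete a := @table_complete _ _ ed V Lam forb marks (dead 2) (dead 1) init adj_sym adj_irr
  forb_sym forb_dom und_dom marks_und marks_dom Lam_dom init_ok t a tu tsub.
rewrite /wc_test /wc_dp /dp dp_toks -/Lam -/forb -/marks -/init /=.
split=> [/allP H S S'|WC].
  have entry_of (U : {set 'I_n}) : maximal_independent E U ->
      exists2 e, e \in table ed V Lam forb marks (dead 2) (dead 1) init t &
        closed_entry e /\ size e.2 = #|U|.
    move=> mU; pose a v : status_t := if v \in U then dead 0 else dead 2.
    have cU : chosen a = U by apply/setP => x; rewrite inE /a; case: (x \in U).
    have [iU _] := proj1 (maximal_independentP U Eirr Esym) mU.
    have va : valid ed forb init B a.
      split=> [v _|u v _ _ _]; first by rewrite mem_init /a; case: ifP.
      rewrite inE edE !xpair_eqE eqb_id /a.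
      case: (boolP (u \in U)) => uU; case: (boolP (v \in U)) => vU; rewrite ?andbF //= andbT.
      exact: iU.
    have /hasP[[sg w] et /andP[/eqP /= Es /eqP Ew]] := complete a va.
    exists (sg, w) => //; split; last by rewrite /= -Ew size_marked cU.
    by rewrite -Es; apply/closedP; rewrite ?cU.
  move=> /entry_of[e et [ce <-]] /entry_of[e' et' [ce' <-]].
  by have := allP (H e et) e' et'; rewrite ce ce' => /eqP.
apply/allP => e /sound[a va ->]; apply/allP => e' /sound[a' va' ->].
apply/implyP => /(closedP _ va) ma; apply/implyP => /(closedP _ va') ma'.
by rewrite /= !size_marked; apply/eqP; apply: WC.
Qed.

End WellCovered.

(** * Number of twin classes and of table entries *)

Section TableSize.
Variables (n : nat) (E : rel 'I_n) (ed : seq ('I_n * 'I_n)).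
Hypothesis Esym : forall x y, E x y = E y x.
Hypothesis Eirr : forall x, E x x = false.
Hypothesis edE : forall x y, adj ed x y = E x y.
Variables (S : eqType) (V : seq 'I_n) (Lam : seq S) (forb : seq (bool * (S * S))).
Variables (marks : seq S) (und dom : S) (init : seq ('I_n * S)).

(** Vertices with the same row vector in a factorization of the cut are twins, so distinct
    representatives have distinct vectors among the [2 ^ r] possible ones. *)
Lemma size_reps r (B : seq 'I_n) : uniq B -> good E r V B ->
  size [seq x <- B | rep ed V B x == x] <= 2 ^ r.
Proof.
move=> uB /cutrkP[a [b H]].
rewrite -(size_map a); have ua : uniq (map a [seq x <- B | rep ed V B x == x]).
  rewrite map_inj_in_uniq ?filter_uniq // => x y.
  rewrite !mem_filter => /andP[/eqP rx xB] /andP[/eqP ry yB] axy.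
  rewrite -rx -ry; apply: rowsame_rep => //; apply/allP => z zV.
  case: (boolP (z \in B)) => //= zB; rewrite !edE; apply/eqP/bool_F2_inj.
  by rewrite !H ?inE ?zB ?zV // axy.
apply: leq_trans (uniq_leq_size ua (fun v _ => mem_enum 'rV['F_2]_r v)) _.
by rewrite -cardE card_mx mul1n card_Fp.
Qed.

Lemma filter_pairs (A : eqType) (C : eqType) (P : pred (A * C)) (q : pred A) (s : seq A) (u : seq C) :
  (forall p, P p -> q p.1) ->
  [seq p <- [seq (x, y) | x <- s, y <- u] | P p] =
  [seq p <- [seq (x, y) | x <- [seq x <- s | q x], y <- u] | P p].
Proof.
move=> Pq; elim: s => //= x s IH; rewrite filter_cat IH; case: ifP => [_|qx] /=.
  by rewrite filter_cat.
suff -> : [seq p <- [seq (x, y) | y <- u] | P p] = [::] by [].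
by elim: {IH}u => //= y u ->; case: ifP => // /Pq /=; rewrite qx.
Qed.

Local Notation table := (table ed V Lam forb marks und dom init).

Lemma size_leaf_table v : size (leaf_table Lam marks init v) <= size init.
Proof.
rewrite /leaf_table; elim: init => //= p s IH; rewrite size_cat.
by case: ifP => _ /=; [rewrite add1n ltnS|apply: leq_trans IH _].
Qed.

Lemma table_entry t e : e \in table t ->
  (forall p, p \in e.1 -> p.1 \in leaves t /\ p.2 \in Lam) /\ size e.2 <= size (leaves t).
Proof.
have canonP (B : seq 'I_n) raw (p : 'I_n * S) : p \in canon Lam B raw -> p.1 \in B /\ p.2 \in Lam.
  by case: p => x s; rewrite mem_filter mem_pairs => /and3P[].
elim: t e => [v|l IHl r IHr] e /=.
  case/flatten_mapP => p _; case: ifP => // _; rewrite inE => /eqP -> /=.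
  by split; [exact: canonP|case: ifP].
move/mem_dedup => /flatten_mapP[e1 /IHl[_ s1] /flatten_mapP[e2 /IHr[_ s2]]].
case: ifP => // _; rewrite inE => /eqP ->; split; first exact: canonP.
by rewrite /= !size_cat leq_add.
Qed.

(** A key is a set of pairs of a representative and a status, together with a witness size of at
    most [size V]. The table of a leaf is not deduplicated and is bounded by [init] instead. *)
Lemma size_table r t : uniq (leaves t) -> wide E r V t -> {subset leaves t <= V} ->
  size (table t) <= maxn (size init) (2 ^ (2 ^ r * size Lam) * (size V).+1).
Proof.
case: t => [v|a b] u w sub; rewrite leq_max; first by rewrite size_leaf_table.
set B := leaves (Node a b) in u sub *.
have gB : good E r V B by apply: wide_good w.
pose U := [seq (x, s) | x <- [seq x <- B | rep ed V B x == x], s <- Lam].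
have sU : size U <= 2 ^ r * size Lam by rewrite size_allpairs leq_mul2r (size_reps u gB) orbT.
have repK x : x \in B -> rep ed V B (rep ed V B x) == rep ed V B x.
  move=> xB; have [rB rs] := repP ed V xB.
  by apply/eqP/rowsame_rep => //; rewrite rowsame_sym.
apply/orP; right.
pose K := [seq (mask (val m) U, j) | m <- enum {: (size U).-tuple bool}, j <- iota 0 (size V).+1].
have -> : size (table (Node a b)) = size [seq (e.1, size e.2) | e <- table (Node a b)].
  by rewrite size_map.
apply: (@leq_trans (size K)); last first.
  rewrite size_allpairs size_iota -cardE card_tuple card_bool leq_mul2r.
  by rewrite leq_exp2l // sU orbT.
apply: uniq_leq_size; first exact: uniq_keys_dedup.
move=> [sg j] /mapP[e et [-> ->]].
have [_ se] := table_entry et.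
have [P eP] : exists P : pred ('I_n * S), e.1 = [seq p <- U | P p].
  move: et => /= /mem_dedup /flatten_mapP[e1 /table_entry[m1 _] /flatten_mapP[e2 /table_entry[m2 _]]].
  case: ifP => // _; rewrite inE => /eqP -> /=; rewrite /canon -/B.
  set raw := _ ++ _; exists (mem raw); rewrite /U -filter_pairs // => p.
  rewrite inE mem_cat => /orP[] /mapP[q qm ->] /=; apply: repK; rewrite mem_cat.
    by have [-> _] := m1 q qm.
  by have [-> _] := m2 q qm; rewrite orbT.
apply/allpairsP; exists (Tuple (introT eqP (size_map P U)), size e.2); split.
- by rewrite mem_enum.
- rewrite mem_iota add0n ltnS; apply: leq_trans se _; exact: uniq_leq_size.
- by rewrite /= eP filter_mask.
Qed.
End TableSize.

(** * Realizers of the algorithm *)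

Definition ttrue : term := tcons tnil tnil.
Definition tnot (a : term) : term := tif a tnil ttrue.
Definition tand (a b : term) : term := tif a b tnil.
Definition tor (a b : term) : term := tif a ttrue b.
Definition tsing (a : term) : term := tcons a tnil.
Definition tmap (a : term) (f : term -> term) : term := tfor a (fun u => tsing (f u)).
Definition tfilter (a : term) (f : term -> term) : term :=
  tfor a (fun u => tif (f u) (tsing u) tnil).
(** [For] with the identity as body flattens the list of the two lists. *)
Definition tcat (a b : term) : term := tfor (tcons a (tsing b)) (fun u => u).
Definition tnonempty (a : term) : term := tcase a tnil (fun _ _ => ttrue).
Definition thas (a : term) (f : term -> term) : term :=
  tnonempty (tfor a (fun u => tif (f u) ttrue tnil)).
Definition tall (a : term) (f : term -> term) : term := tnot (thas a (fun u => tnot (f u))).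
Definition tmem (x a : term) : term := thas a (fun u => teq u x).
(** [ttrue] is also the list with the single element [N], and numbers are lists of [N]. *)
Definition tlength (a : term) : term := tfor a (fun _ => ttrue).
Definition tfst (a : term) : term := tcase a tnil (fun u _ => u).
Definition tsnd (a : term) : term := tcase a tnil (fun _ u => u).
Definition thead_or (d a : term) : term := tcase a d (fun u _ => u).

Section Macros.
Variable P : tree -> Prop.
Local Notation R := (realizes P).

Lemma R_sing {A : Type} {eA : Enc A} env a (x : A) : R env a (enc x) -> R env (tsing a) (enc [:: x]).
Proof. by move=> Ha; apply: R_cons => //; apply: R_nil. Qed.

Lemma R_not env a (p : bool) : R env a (enc p) -> R env (tnot a) (enc (~~ p)).
Proof.
move=> Ha; have -> : ~~ p = if p then false else true by case: p {Ha}.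
by apply: (R_if (eA := enc_b)).
Qed.

Lemma R_and env a b (p q : bool) : R env a (enc p) -> R env b (enc q) -> R env (tand a b) (enc (p && q)).
Proof. by move=> Ha Hb; apply: (R_if (eA := enc_b) (x := q) (y := false)). Qed.

Lemma R_or env a b (p q : bool) : R env a (enc p) -> R env b (enc q) -> R env (tor a b) (enc (p || q)).
Proof. by move=> Ha Hb; apply: (R_if (eA := enc_b) (x := true) (y := q)). Qed.

Lemma R_map {A B : Type} {eA : Enc A} {eB : Enc B} env a f (s : seq A) (g : A -> B) : R env a (enc s) ->
  (forall y, bound1 P env (enc y) (fun w u => R w (f u) (enc (g y)))) ->
  R env (tmap a f) (enc (map g s)).
Proof.
move=> Ha Hf; rewrite -[map g s]flatten_seq1 -map_comp.
by apply: (R_for (g := fun y => [:: g y])) => // y w u Hu; apply: R_sing; apply: Hf.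
Qed.

Lemma R_filter {A : Type} {eA : Enc A} env a f (s : seq A) (g : pred A) : R env a (enc s) ->
  (forall y, bound1 P env (enc y) (fun w u => R w (f u) (enc (g y)))) ->
  R env (tfilter a f) (enc (filter g s)).
Proof.
move=> Ha Hf.
have -> : filter g s = flatten [seq (if g y then [:: y] else [::]) | y <- s].
  by elim: s {Ha} => //= y s ->; case: ifP.
apply: R_for => // y w u Hu; apply: (R_if (eA := enc_seq _)); first exact: Hf.
  by move=> _; apply: R_sing.
by move=> _; apply: R_nil.
Qed.

Lemma R_cat {A : Type} {eA : Enc A} env a b (s t : seq A) : R env a (enc s) -> R env b (enc t) ->
  R env (tcat a b) (enc (s ++ t)).
Proof.
move=> Ha Hb; have -> : s ++ t = flatten (map id [:: s; t]) by rewrite /= cats0.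
apply: (R_for (eA := enc_seq eA)) => [|y w u Hu]; last exact: Hu.
by apply: (R_cons (eA := enc_seq eA)) => //; apply: R_sing.
Qed.

Lemma R_nonempty {A : Type} {eA : Enc A} env a (s : seq A) : R env a (enc s) ->
  R env (tnonempty a) (enc (if s is _ :: _ then true else false)).
Proof. by move=> Ha; apply: (R_caseseq (g := fun _ _ => true)). Qed.

Lemma R_has {A : Type} {eA : Enc A} env a f (s : seq A) (g : pred A) : R env a (enc s) ->
  (forall y, bound1 P env (enc y) (fun w u => R w (f u) (enc (g y)))) ->
  R env (thas a f) (enc (has g s)).
Proof.
move=> Ha Hf.
have -> : has g s =
    (if flatten [seq (if g y then [:: N] else [::]) | y <- s] is _ :: _ then true else false).
  by elim: s {Ha} => //= y s ->; case: (g y).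
apply: R_nonempty; apply: R_for => // y w u Hu; apply: (R_if (eA := enc_seq _)); first exact: Hf.
  by move=> _; apply: R_sing.
by move=> _; apply: R_nil.
Qed.

Lemma R_all {A : Type} {eA : Enc A} env a f (s : seq A) (g : pred A) : R env a (enc s) ->
  (forall y, bound1 P env (enc y) (fun w u => R w (f u) (enc (g y)))) ->
  R env (tall a f) (enc (all g s)).
Proof.
move=> Ha Hf; rewrite -[all g s]negbK -has_predC.
by apply: R_not; apply: R_has => // y w u Hu; apply: R_not; apply: Hf.
Qed.

Lemma R_length {A : Type} {eA : Enc A} env a (s : seq A) :
  R env a (enc s) -> R env (tlength a) (enc (size s)).
Proof.
move=> Ha; have -> : enc (size s) = enc (flatten [seq [:: N] | _ <- s]) :> tree.
  by elim: s {Ha} => //= y s IH; rewrite /enc /= -[X in C _ X]/(enc _) IH.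
by apply: (R_for (eB := enc_tree)) => // y w u _; apply: R_sing.
Qed.

Lemma R_fst {A B : Type} {eA : Enc A} {eB : Enc B} env a (x : A * B) :
  R env a (enc x) -> R env (tfst a) (enc x.1).
Proof. by move=> Ha; apply: R_casepair Ha _ => w u v. Qed.

Lemma R_snd {A B : Type} {eA : Enc A} {eB : Enc B} env a (x : A * B) :
  R env a (enc x) -> R env (tsnd a) (enc x.2).
Proof. by move=> Ha; apply: R_casepair Ha _ => w u v. Qed.

Lemma R_head {A : Type} {eA : Enc A} env a d (x : A) (s : seq A) : R env a (enc s) -> R env d (enc x) ->
  R env (thead_or d a) (enc (head x s)).
Proof.
move=> Ha Hd; have -> : head x s = if s is y :: s' then y else x by case: s {Ha}.
by apply: (R_caseseq (g := fun y _ => y)) => // y s' _ w u v Hu _; exact: Hu.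
Qed.

Lemma R_mem env x a (A : eqType) (eA : Enc A) (iA : EncInj eA) (y : A) (s : seq A) :
  R env x (enc y) -> R env a (enc s) -> R env (tmem x a) (enc (y \in s)).
Proof.
move=> Hx Ha; rewrite -has_pred1; apply: R_has => // z w u Hu /=.
by apply: (R_eq iA); [exact: Hu|exact: R_mono].
Qed.

End Macros.

(** [dedup] only adds in front, so its accumulators are suffixes of the final table and are covered
    by a bound for that table. *)
Lemma suffix_dedup (T S : eqType) (t : seq (seq (T * S) * seq T)) i :
  suffix (dedup (take i t)) (dedup t).
Proof.
rewrite -[t in X in suffix _ X](cat_take_drop i) /dedup foldl_cat.
elim: (drop i t) (foldl _ _ _) => [|e s IH] acc /=; first exact: suffix_refl.
case: ifP => _; first exact: IH.
by have /suffixP[u ->] := IH (e :: acc); apply/suffixP; exists (rcons u e); rewrite cat_rcons.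
Qed.

Section DP.
Variable P : tree -> Prop.
Local Notation R := (realizes P).
Context {T S : eqType} {eT : Enc T} {eS : Enc S} {iT : EncInj eT} {iS : EncInj eS}.
Variables (ed : seq (T * T)) (V : seq T) (Lam : seq S) (forb : seq (bool * (S * S))).
Variables (marks : seq S) (und dom : S) (init : seq (T * S)).
Variables ted tV tLam tforb tmarks tund tdom tinit : term.

Record graph_ctx env : Prop := GraphCtx {
  c_ed : R env ted (enc ed);
  c_V : R env tV (enc V) }.

Record dp_ctx env : Prop := DpCtx {
  c_graph : graph_ctx env;
  c_Lam : R env tLam (enc Lam);
  c_forb : R env tforb (enc forb);
  c_marks : R env tmarks (enc marks);
  c_und : R env tund (enc und);
  c_dom : R env tdom (enc dom);
  c_init : R env tinit (enc init) }.

Lemma graph_mono env w : graph_ctx env -> graph_ctx (env ++ w).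
Proof. by case=> *; split; apply: R_mono. Qed.

Lemma dp_mono env w : dp_ctx env -> dp_ctx (env ++ w).
Proof. by case=> /graph_mono H *; split; [exact: H|..]; apply: R_mono. Qed.

Ltac enter := rewrite /bound1 /bound2; intros; cbv beta;
  match goal with |- realizes _ (?env ++ ?w) _ _ =>
    repeat match goal with
    | H : realizes _ env _ _ |- _ => apply (R_mono w) in H
    | H : graph_ctx env |- _ => apply (graph_mono w) in H
    | H : dp_ctx env |- _ => apply (dp_mono w) in H
    end end.

Definition tadj (x y : term) : term := tmem (tcons x y) ted.
Definition trowsame (B x y : term) : term :=
  tall tV (fun z => tor (tmem z B) (teq (tadj x z) (tadj y z))).
Definition trep (B x : term) : term := thead_or x (tfilter B (fun y => trowsame B x y)).
Definition tpairs (a b : term) : term := tfor a (fun x => tmap b (fun y => tcons x y)).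
Definition tcanon (B raw : term) : term := tfilter (tpairs B tLam) (fun p => tmem p raw).
Definition tupd (sig p : term) : term :=
  tif (tand (teq (tsnd p) tund)
        (thas sig (fun q => tand (tadj (tfst p) (tfst q)) (tmem (tsnd q) tmarks))))
    tdom (tsnd p).
Definition tlift (B sig sig' : term) : term :=
  tmap sig (fun p => tcons (trep B (tfst p)) (tupd sig' p)).
Definition tcompat (sig sig' : term) : term :=
  tall sig (fun p => tall sig' (fun q =>
    tnot (tmem (tcons (tadj (tfst p) (tfst q)) (tcons (tsnd p) (tsnd q))) tforb))).
Definition tmerge_entry (B e e' : term) : term :=
  tcons (tcanon B (tcat (tlift B (tfst e) (tfst e')) (tlift B (tfst e') (tfst e))))
        (tcat (tsnd e) (tsnd e')).
Definition tsame (e e' : term) : term :=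
  tand (teq (tfst e) (tfst e')) (teq (tlength (tsnd e)) (tlength (tsnd e'))).
Definition tdedup (a : term) : term :=
  tfold a tnil (fun acc e => tif (thas acc (fun e' => tsame e e')) acc (tcons e acc)).
Definition tmerge_table (B a b : term) : term :=
  tdedup (tfor a (fun e => tfor b (fun e' =>
    tif (tcompat (tfst e) (tfst e')) (tsing (tmerge_entry B e e')) tnil))).
Definition tleaf_table (v : term) : term :=
  tfor tinit (fun p => tif (teq (tfst p) v)
    (tsing (tcons (tcanon (tsing v) (tsing (tcons v (tsnd p))))
                  (tif (tmem (tsnd p) tmarks) (tsing v) tnil))) tnil).
Definition tdp_step (st tok : term) : term :=
  tcase tok
    (tcase st st (fun x st1 => tcase st1 st (fun y st2 =>
       tcons (tcons (tcat (tfst y) (tfst x))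
         (tmerge_table (tcat (tfst y) (tfst x)) (tsnd y) (tsnd x))) st2)))
    (fun v _ => tcons (tcons (tsing v) (tleaf_table v)) st).
Definition tdp (ts : term) : term := tfold ts tnil tdp_step.

Lemma R_adj env x y (u v : T) : graph_ctx env -> R env x (enc u) -> R env y (enc v) ->
  R env (tadj x y) (enc (adj ed u v)).
Proof. by move=> [He _] Hx Hy; apply: R_mem => //; apply: R_pair. Qed.

Lemma R_rowsame env b x y (B : seq T) (u v : T) : graph_ctx env -> R env b (enc B) -> R env x (enc u) ->
  R env y (enc v) -> R env (trowsame b x y) (enc (rowsame ed V B u v)).
Proof.
move=> H Hb Hx Hy; apply: R_all; first by case: H.
enter; apply: R_or; first exact: R_mem.
by apply: R_eq; apply: R_adj.
Qed.

Lemma R_rep env b x (B : seq T) (u : T) : graph_ctx env -> R env b (enc B) -> R env x (enc u) ->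
  R env (trep b x) (enc (rep ed V B u)).
Proof.
move=> H Hb Hx; apply: R_head => //; apply: R_filter => //.
by enter; apply: R_rowsame.
Qed.

Lemma R_pairs {A A' : Type} {eA : Enc A} {eA' : Enc A'} env a b (s : seq A) (t : seq A') :
  R env a (enc s) -> R env b (enc t) ->
  R env (tpairs a b) (enc [seq (x, y) | x <- s, y <- t]).
Proof.
move=> Ha Hb; apply: R_for => //; enter.
by apply: R_map => //; enter; apply: R_pair.
Qed.

Lemma R_canon env b r (B : seq T) (raw : seq (T * S)) :
  dp_ctx env -> R env b (enc B) -> R env r (enc raw) ->
  R env (tcanon b r) (enc (canon Lam B raw)).
Proof.
move=> H Hb Hr; apply: R_filter; first by apply: R_pairs => //; case: H.
by enter; apply: R_mem.
Qed.

Lemma R_upd env s p (sig : seq (T * S)) (q : T * S) : dp_ctx env -> R env s (enc sig) -> R env p (enc q) ->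
  R env (tupd s p) (enc (upd_status ed marks und dom sig q)).
Proof.
move=> H Hs Hp; have q2 := R_snd Hp; apply: R_if => [|_|_] //; last by case: H.
apply: R_and; first by apply: R_eq => //; case: H.
apply: R_has => //; enter; apply: R_and.
  by apply: R_adj; [case: H|exact: R_fst|exact: R_fst].
by apply: R_mem; [exact: R_snd|case: H].
Qed.

Lemma R_lift env b s s' (B : seq T) (sig sig' : seq (T * S)) :
  dp_ctx env -> R env b (enc B) -> R env s (enc sig) ->
  R env s' (enc sig') -> R env (tlift b s s') (enc (lift_sig ed V marks und dom B sig sig')).
Proof.
move=> H Hb Hs Hs'; apply: R_map => //; enter; apply: R_pair; last exact: R_upd.
by apply: R_rep => //; [case: H|exact: R_fst].
Qed.

Lemma R_compat env s s' (sig sig' : seq (T * S)) :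
  dp_ctx env -> R env s (enc sig) -> R env s' (enc sig') ->
  R env (tcompat s s') (enc (compat ed forb sig sig')).
Proof.
move=> H Hs Hs'; apply: R_all => //; enter; apply: R_all => //; enter.
apply: R_not; apply: R_mem; last by case: H.
apply: R_pair; last by apply: R_pair; exact: R_snd.
by apply: R_adj; [case: H|exact: R_fst|exact: R_fst].
Qed.

Lemma R_merge_entry env b a a' (B : seq T) (e e' : seq (T * S) * seq T) : dp_ctx env -> R env b (enc B) ->
  R env a (enc e) -> R env a' (enc e') ->
  R env (tmerge_entry b a a') (enc (merge_entry ed V Lam marks und dom B e e')).
Proof.
move=> H Hb Ha Ha'; have h1 := R_fst Ha; have h2 := R_fst Ha'.
have h3 := R_snd Ha; have h4 := R_snd Ha'.
rewrite /merge_entry; apply: R_pair; last exact: R_cat.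
by apply: R_canon => //; apply: R_cat; apply: R_lift.
Qed.

Lemma R_dedup env a (t : seq (seq (T * S) * seq T)) : R env a (enc t) ->
  (forall i, P (enc (dedup (take i t)))) -> R env (tdedup a) (enc (dedup t)).
Proof.
move=> Ha HP; apply: R_fold => // i e _ _.
enter; apply: R_if => [|_|_] //; last exact: R_cons.
apply: R_has => //; enter; apply: R_and; first by apply: R_eq; exact: R_fst.
by apply: R_eq; apply: R_length; exact: R_snd.
Qed.

Lemma R_merge_table env b a a' (B : seq T) (t t' : seq (seq (T * S) * seq T)) :
  dp_ctx env -> R env b (enc B) ->
  R env a (enc t) -> R env a' (enc t') ->
  (forall s, suffix s (merge_table ed V Lam forb marks und dom B t t') -> P (enc s)) ->
  R env (tmerge_table b a a') (enc (merge_table ed V Lam forb marks und dom B t t')).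
Proof.
move=> H Hb Ha Ha' HP; apply: R_dedup => [|i]; last by apply: HP; apply: suffix_dedup.
apply: R_for => //; enter; apply: R_for => //; enter; apply: R_if => [|_|_].
- by apply: R_compat => //; apply: R_fst.
- by apply: R_sing; apply: R_merge_entry.
- exact: R_nil.
Qed.

Lemma R_leaf_table env x (v : T) : dp_ctx env -> R env x (enc v) ->
  R env (tleaf_table x) (enc (leaf_table Lam marks init v)).
Proof.
move=> H Hx; apply: R_for; first by case: H.
enter; apply: R_if => [|_|_]; last exact: R_nil.
  by apply: R_eq => //; apply: R_fst.
apply: R_sing; apply: R_pair.
  apply: R_canon => //; first exact: R_sing.
  by apply: R_sing; apply: R_pair => //; apply: R_snd.
apply: R_if => [|_|_]; [|exact: R_sing|exact: R_nil].
by apply: R_mem; [exact: R_snd|case: H].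
Qed.

Local Notation dp_step := (dp_step ed V Lam forb marks und dom init).

Lemma R_dp_step env s a (st : seq (seq T * seq (seq (T * S) * seq T))) (tok : seq T) :
  dp_ctx env -> R env s (enc st) -> R env a (enc tok) ->
  (forall t B st', dp_step st tok = (B, t) :: st' -> forall t', suffix t' t -> P (enc t')) ->
  R env (tdp_step s a) (enc (dp_step st tok)).
Proof.
move=> H Hs Ha HP; rewrite /dp_step.
apply: (R_caseseq Ha (g := fun v _ => _) (x := if st is x :: st1 then _ else _)) => [tok0|v tok' _].
  rewrite tok0 in HP.
  apply: (R_caseseq Hs (g := fun x st1 => if st1 is y :: st2 then _ else st)) => // x st1 Est.
  move=> w tx ts1 Htx Hts1; enter.
  apply: (R_caseseq (s := st1) (g := fun y st2 => _)) => // y st2 Est1 w' ty ts2 Hty Hts2.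
  enter.
  have Hy := R_fst Hty; have Hx := R_fst Htx.
  apply: R_cons => //; apply: R_pair; first exact: R_cat.
  apply: R_merge_table => //; [exact: R_cat|exact: R_snd|exact: R_snd|].
  by move: HP; rewrite Est Est1 => HP t' /(HP _ _ _ erefl).
by enter; apply: R_cons => //; apply: R_pair; [exact: R_sing|exact: R_leaf_table].
Qed.

Lemma R_dp env a (ts : seq (seq T)) : dp_ctx env -> R env a (enc ts) ->
  (forall i, P (enc (foldl dp_step [::] (take i ts)))) ->
  (forall i t B st', foldl dp_step [::] (take i ts) = (B, t) :: st' ->
     forall t', suffix t' t -> P (enc t')) ->
  R env (tdp a) (enc (dp ed V Lam forb marks und dom init ts)).
Proof.
move=> H Ha HP HP'; apply: R_fold => // i tok Hi Etok.
enter; apply: R_dp_step => // t B st' E; apply: (HP' i.+1).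
by rewrite (take_nth tok) // foldl_rcons Etok E.
Qed.

End DP.

Ltac enter := rewrite /bound1 /bound2; intros; cbv beta;
  match goal with |- realizes _ (?env ++ ?w) _ _ =>
    repeat match goal with
    | H : realizes _ env _ _ |- _ => apply (R_mono w) in H
    | H : graph_ctx _ _ _ _ _ env |- _ => apply (graph_mono w) in H
    end end.

Fixpoint tnat (m : nat) : term := if m is m'.+1 then tcons tnil (tnat m') else tnil.
Definition tdead (p : nat) : term := tcons (tnat p) (tcons tnil tnil).
Definition tdot (a b : term) : term :=
  tfold (tfilter a (fun x => tmem x b)) tnil (fun p _ => tnot p).
Definition tpset (a : term) : term :=
  tfold a (tsing tnil) (fun acc x => tcat acc (tmap acc (fun u => tcons x u))).
Definition tiota (a : term) : term :=
  tfold a tnil (fun acc _ => tcat acc (tsing (tlength acc))).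
Definition tall_status (vs : term) : term :=
  tfor (tcons (tnat 0) (tcons (tnat 1) (tsing (tnat 2)))) (fun p =>
    tfor vs (fun a => tmap vs (fun b => tcons p (tcons a b)))).
Definition tfits (e s t : term) : term :=
  tand (tor (teq (teq (tfst s) (tnat 1)) (teq (tfst t) (tnat 1)))
            (teq e (tdot (tfst (tsnd s)) (tfst (tsnd t)))))
       (tor (teq (teq (tfst s) (tnat 2)) (teq (tfst t) (tnat 2)))
            (teq e (tdot (tsnd (tsnd s)) (tsnd (tsnd t))))).
Definition tforbidden (als : term) : term :=
  tfor (tcons ttrue (tsing tnil)) (fun e => tfor als (fun s => tfor als (fun t =>
    tif (tfits e s t) tnil (tsing (tcons e (tcons s t)))))).
Definition tpart1 (als : term) : term := tfilter als (fun s => teq (tfst s) (tnat 1)).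
Definition tsplit_init (als V B : term) : term :=
  tfor V (fun v => tmap (tfilter als (fun s =>
    teq (tmem v B) (tnot (teq (tfst s) (tnat 0))))) (fun s => tcons v s)).
Definition thalves (B w : term) : term :=
  tcase (tfilter B (fun x => tmem x w)) tnil (fun _ _ =>
    tcase (tfilter B (fun x => tnot (tmem x w))) tnil (fun _ _ =>
      tsing (tcons (tfilter B (fun x => tmem x w)) (tfilter B (fun x => tnot (tmem x w)))))).
Definition tsplit_dp (ed r V B ts : term) : term :=
  let als := tall_status (tpset (tiota r)) in
  tdp ed V als (tforbidden als) (tpart1 als) (tdead 3) (tdead 4) (tsplit_init als V B) ts.
Definition tsplit_set (ed r V ts B : term) : term :=
  tcase (tsplit_dp ed r V B ts) tnil (fun x _ => tfor (tsnd x) (fun e => thalves B (tsnd e))).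
Definition tbuild_step (ed r V ts st : term) : term :=
  tcase (tfst st) st (fun B wl =>
    tcase B (tcons wl (tcons B (tsnd st))) (fun _ B' =>
      tcase B' (tcons wl (tcons B (tsnd st))) (fun _ _ =>
        tcase (tsplit_set ed r V ts B) (tcons tnil tnil) (fun p _ =>
          tcons (tcons (tfst p) (tcons (tsnd p) wl)) (tcons tnil (tsnd st)))))).
Definition tbuild (ed r V ts : term) : term :=
  tsnd (tfold (tcat V V) (tcons (tsing V) tnil) (fun st _ => tbuild_step ed r V ts st)).
Definition tinsert_layout (v ts : term) : term :=
  tcase ts (tsing (tsing v)) (fun _ _ => tcat ts (tcons (tsing v) (tsing tnil))).
Definition tinsert (ed rs st v : term) : term :=
  tcons (tcons v (tfst st)) (tfold rs tnil (fun acc r => tcase acc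
    (tbuild ed r (tcons v (tfst st)) (tinsert_layout v (tsnd st))) (fun _ _ => acc))).
Definition tdecompose (ed V rs : term) : term :=
  tfold V (tcons tnil tnil) (tinsert ed rs).
Definition twc_dp (ed V ts : term) : term :=
  tdp ed V (tcons (tdead 0) (tcons (tdead 1) (tsing (tdead 2))))
    (tsing (tcons ttrue (tcons (tdead 0) (tdead 0)))) (tsing (tdead 0)) (tdead 2) (tdead 1)
    (tfor V (fun v => tmap (tcons (tdead 0) (tsing (tdead 2))) (fun s => tcons v s))) ts.
Definition tclosed_entry (e : term) : term :=
  tall (tfst e) (fun p => tnot (teq (tsnd p) (tdead 2))).
Definition timp (a b : term) : term := tif a b ttrue.
Definition twc_test (ed V ts : term) : term :=
  tcase (twc_dp ed V ts) ttrue (fun x _ => tall (tsnd x) (fun e => tall (tsnd x) (fun e' =>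
    timp (tclosed_entry e) (timp (tclosed_entry e')
      (teq (tlength (tsnd e)) (tlength (tsnd e'))))))).
Definition twell_covered (ed V rs : term) : term :=
  twc_test ed V (tsnd (tdecompose ed V rs)).

Section Programs.
Variable P : tree -> Prop.
Local Notation R := (realizes P).
Hypothesis P_bool : forall b : bool, P (enc b).

Lemma R_nat env m : R env (tnat m) (enc m).
Proof. by elim: m => [|m IH]; [exact: R_zero|exact: R_succ]. Qed.

Lemma R_dead env p : R env (tdead p) (enc (dead p)).
Proof. by apply: R_pair; [exact: R_nat|apply: R_pair; exact: R_nil]. Qed.

Lemma R_imp env a b (p q : bool) : R env a (enc p) -> R env b (enc q) ->
  R env (timp a b) (enc (p ==> q)).
Proof. by move=> Ha Hb; apply: (R_if (eA := enc_b) (x := q) (y := true)). Qed.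

Lemma R_dot env a b (u v : seq nat) : R env a (enc u) -> R env b (enc v) ->
  R env (tdot a b) (enc (dot u v)).
Proof.
move=> Ha Hb; apply: (R_fold (g := fun p (_ : nat) => ~~ p)) => // [|i y _ _].
  by apply: R_filter => //; enter; apply: R_mem.
by enter; apply: R_not.
Qed.

Lemma R_pset env a (s : seq nat) : R env a (enc s) -> (forall i, P (enc (pset (take i s)))) ->
  R env (tpset a) (enc (pset s)).
Proof.
move=> Ha HP; apply: R_fold => // i x _ _.
by enter; apply: R_cat => //; apply: R_map => //; enter; apply: R_cons.
Qed.

Lemma R_iota env a r : R env a (enc r) -> (forall i, i <= r -> P (enc (iota 0 i))) ->
  R env (tiota a) (enc (iota 0 r)).
Proof.
move=> Ha HP.
have Ea : enc r = enc (nseq r N) by elim: (r) => //= m IH; rewrite /enc /= -[X in C _ X]/(enc _) IH.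
have F m : foldl (fun acc (_ : tree) => acc ++ [:: size acc]) [::] (nseq m N) = iota 0 m.
  by elim: m => // m IH; rewrite -addn1 nseqD foldl_cat IH /= size_iota iotaD.
rewrite -F; apply: R_fold; rewrite -?Ea // => i.
  have -> : take i (nseq r N) = nseq (minn i r) N.
    by elim: (r) (i) => [|m IH] [|l] //=; rewrite minnSS /= IH.
  by rewrite F; apply: HP; rewrite geq_minr.
by move=> y _ _; enter; apply: R_cat => //; apply: R_sing; apply: R_length.
Qed.

Lemma R_all_status env a r : R env a (enc (vecs r)) ->
  R env (tall_status a) (enc (all_status r)).
Proof.
move=> Ha; apply: R_for.
  by repeat (apply: R_cons; first exact: R_nat); apply: R_nil.
enter; apply: R_for => //; enter; apply: R_map => //; enter.
by apply: R_pair => //; apply: R_pair.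
Qed.

Lemma R_fits env a b c (e : bool) (s t : status_t) : R env a (enc e) -> R env b (enc s) ->
  R env c (enc t) -> R env (tfits a b c) (enc (fits e s t)).
Proof.
move=> Ha Hb Hc; have b1 := R_fst Hb; have c1 := R_fst Hc; have b2 := R_snd Hb; have c2 := R_snd Hc.
have N1 := R_nat env 1; have N2 := R_nat env 2.
apply: R_and; apply: R_or; apply: R_eq => //; try (by apply: R_eq);
  by apply: R_dot; [apply: R_fst|apply: R_fst] || apply: R_dot; apply: R_snd.
Qed.

Lemma R_forbidden env a r : R env a (enc (all_status r)) ->
  R env (tforbidden a) (enc (forbidden r)).
Proof.
move=> Ha; apply: R_for.
  by apply: R_cons; [exact: R_true|apply: R_sing; exact: R_false].
enter; apply: R_for => //; enter; apply: R_for => //; enter.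
apply: R_if => [|_|_]; [exact: R_fits|exact: R_nil|].
by apply: R_sing; apply: R_pair => //; apply: R_pair.
Qed.

Lemma R_part1 env a r : R env a (enc (all_status r)) -> R env (tpart1 a) (enc (part1 r)).
Proof.
move=> Ha; apply: R_filter => //; enter.
by apply: R_eq; [exact: R_fst|exact: R_nat].
Qed.

Definition small_rank r : Prop := forall i, i <= r -> P (enc (iota 0 i)) /\ P (enc (vecs i)).

Lemma R_vecs env a r : R env a (enc r) -> small_rank r -> R env (tpset (tiota a)) (enc (vecs r)).
Proof.
move=> Ha HP; apply: R_pset => [|i]; first by apply: R_iota => // i /HP[].
by rewrite take_iota; case: (HP (minn i r)) => //; rewrite geq_minr.
Qed.

Section Typed.
Context {T : eqType} {eT : Enc T} {iT : EncInj eT}.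
Variables (ed : seq (T * T)) (ted : term).

(** The accumulators of a run are the stacks between tokens and, during a join, the partially
    deduplicated tables, which are suffixes of the table on top of the next stack. *)
Definition dp_fine {S : eqType} {eS : Enc S} V (Lam : seq S) forb marks und dom init
    (ts : seq (seq T)) : Prop := forall i,
  P (enc (foldl (dp_step ed V Lam forb marks und dom init) [::] (take i ts))) /\
  forall t B st', foldl (dp_step ed V Lam forb marks und dom init) [::] (take i ts) = (B, t) :: st' ->
     forall t', suffix t' t -> P (enc t').

Definition split_fine r V B ts : Prop := dp_fine V (all_status r) (forbidden r)
  (part1 r) (dead 3) (dead 4) (split_init r V B) ts.

Lemma R_split_init env als v b r V (B : seq T) : R env als (enc (all_status r)) ->
  R env v (enc V) -> R env b (enc B) ->
  R env (tsplit_init als v b) (enc (split_init r V B)).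
Proof.
move=> Hals Hv Hb; apply: R_for => //; enter; apply: R_map; last by enter; apply: R_pair.
apply: R_filter => //; enter; apply: R_eq; first exact: R_mem.
by apply: R_not; apply: R_eq; [exact: R_fst|exact: R_nat].
Qed.

Lemma R_split_set env a v t b r V ts (B : seq T) : R env ted (enc ed) -> R env a (enc r) ->
  R env v (enc V) -> R env t (enc ts) -> R env b (enc B) -> small_rank r ->
  split_fine r V B ts ->
  R env (tsplit_set ted a v t b) (enc (split_set ed r V ts B)).
Proof.
move=> He Ha Hv Ht Hb Hr HP; have Hals := R_all_status (R_vecs Ha Hr).
have Hdp : R env (tsplit_dp ted a v b t) (enc (split_dp ed r V B ts)).
  apply: R_dp => //; try by move=> i; case: (HP i).
  split; [by split|exact: Hals|exact: R_forbidden|exact: R_part1|exact: R_dead|exact: R_dead|].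
  exact: R_split_init.
apply: (R_caseseq Hdp (g := fun x _ => _) (x := [::])) => [_|x s _]; first exact: R_nil.
move=> w tx ts' Htx _; enter; apply: R_for; first exact: R_snd.
enter; have Hw := R_snd H.
have H1 : R ((env ++ w) ++ w0) (tfilter b (fun x => tmem x (tsnd a0)))
    (enc [seq x <- B | x \in y.2]).
  by apply: R_filter => //; enter; apply: R_mem.
have H2 : R ((env ++ w) ++ w0) (tfilter b (fun x => tnot (tmem x (tsnd a0))))
    (enc [seq x <- B | x \notin y.2]).
  by apply: R_filter => //; enter; apply: R_not; apply: R_mem.
apply: (R_caseseq H1 (g := fun _ _ => _) (x := [::])) => [_|x1 s1 _]; first exact: R_nil.
enter; apply: (R_caseseq H2 (g := fun _ _ => _) (x := [::])) => [_|x2 s2 _]; first exact: R_nil.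
by enter; apply: R_sing; apply: R_pair.
Qed.

Definition step_fine r V ts (st : seq (seq T) * seq (seq T)) : Prop :=
  if st.1 is B :: _ then split_fine r V B ts else True.

Lemma R_build_step env a v t s r V ts (st : seq (seq T) * seq (seq T)) : R env ted (enc ed) ->
  R env a (enc r) -> R env v (enc V) -> R env t (enc ts) -> R env s (enc st) ->
  small_rank r -> step_fine r V ts st ->
  R env (tbuild_step ted a v t s) (enc (build_step ed r V ts st)).
Proof.
move=> He Ha Hv Ht Hs Hr; rewrite /step_fine /build_step => HP; have s1 := R_fst Hs.
have s2 := R_snd Hs.
apply: (R_caseseq s1 (g := fun B wl => _) (x := st)) => // B wl EB w b wl' Hb Hwl.
rewrite EB in HP; enter.
have base : R (env ++ w) (tcons wl' (tcons b (tsnd s))) (enc (wl, B :: st.2)).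
  by apply: R_pair => //; apply: R_cons.
apply: (R_caseseq Hb (g := fun _ B' => _) (x := (wl, B :: st.2))) => // x B' _ w1 _tx tB' _ HB'.
enter; apply: (R_caseseq HB' (g := fun _ _ => _) (x := (wl, B :: st.2))) => // x' B'' _.
enter; have Hsp := R_split_set (b := b) (v := v) (t := t) He Ha Hv Ht Hb Hr HP.
apply: (R_caseseq Hsp (g := fun p _ => _) (x := ([::], [::]))) => [_|p s' _ w2 tp _ts Hp _].
  by apply: R_pair; exact: R_nil.
enter; apply: R_pair; last by apply: R_cons => //; exact: R_nil.
by apply: R_cons; [exact: R_fst|apply: R_cons => //; exact: R_snd].
Qed.

Definition build_fine r V ts : Prop := small_rank r /\ forall i,
  let st := foldl (fun st (_ : T) => build_step ed r V ts st) ([:: V], [::]) (take i (V ++ V)) in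
  P (enc st) /\ step_fine r V ts st.

Lemma R_build env a v t r V (ts : seq (seq T)) : R env ted (enc ed) -> R env a (enc r) ->
  R env v (enc V) -> R env t (enc ts) -> build_fine r V ts ->
  R env (tbuild ted a v t) (enc (build ed r V ts)).
Proof.
move=> He Ha Hv Ht [Hr HP]; apply: R_snd; apply: R_fold.
- exact: R_cat.
- by apply: R_pair; [exact: R_sing|exact: R_nil].
- by move=> i; case: (HP i).
by move=> i y _ _; enter; apply: R_build_step => //; case: (HP i).
Qed.

Lemma R_insert_layout env x t (v : T) ts : R env x (enc v) -> R env t (enc ts) ->
  R env (tinsert_layout x t) (enc (insert_layout v ts)).
Proof.
move=> Hx Ht; apply: (R_caseseq Ht (g := fun _ _ => _)) => [_|y s _].
  by apply: R_sing; apply: R_sing.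
enter; apply: R_cat => //; apply: R_cons; first exact: R_sing.
by apply: R_sing; exact: R_nil.
Qed.

Definition tries (rs : seq nat) (V : seq T) ts : seq (seq T) :=
  foldl (fun acc r => if acc is _ :: _ then acc else build ed r V ts) [::] rs.

(** Runs of [build] are constrained only while no earlier rank has succeeded. Larger ranks, whose
    tables have no bound in terms of [k], are skipped by the fold. *)
Definition insert_fine (rs : seq nat) (st : seq T * seq (seq T)) v : Prop := forall i r,
  let acc := tries (take i rs) (v :: st.1) (insert_layout v st.2) in
  P (enc acc) /\ (i < size rs -> nth r rs i = r -> acc = [::] ->
    build_fine r (v :: st.1) (insert_layout v st.2)).

Lemma R_insert env trs s x rs st (v : T) : R env ted (enc ed) -> R env trs (enc rs) ->
  R env s (enc st) -> R env x (enc v) -> insert_fine rs st v ->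
  R env (tinsert ted trs s x) (enc (insert ed rs st v)).
Proof.
move=> He Hrs Hs Hx HP; have s1 := R_fst Hs; have s2 := R_snd Hs.
have HV : R env (tcons x (tfst s)) (enc (v :: st.1)) by apply: R_cons.
apply: R_pair => //.
apply: (R_fold (g := fun acc r => if acc is _ :: _ then acc else
  build ed r (v :: st.1) (insert_layout v st.2))) => //.
  by move=> i; case: (HP i 0).
move=> i r Hi Er w acc tr Hacc Htr; enter.
apply: (R_caseseq Hacc (g := fun _ _ => _)) => [acc0|]; last by enter.
have Hl := R_insert_layout Hx s2.
by apply: R_build => //; case: (HP i r) => _; apply.
Qed.

Lemma R_decompose env trs v rs (V : seq T) : R env ted (enc ed) -> R env trs (enc rs) ->
  R env v (enc V) ->
  (forall i, P (enc (decompose ed (take i V) rs))) ->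
  (forall i x, i < size V -> nth x V i = x -> insert_fine rs (decompose ed (take i V) rs) x) ->
  R env (tdecompose ted v trs) (enc (decompose ed V rs)).
Proof.
move=> He Hrs Hv HP HP'; apply: R_fold => // i x Hi Ex.
by enter; apply: R_insert => //; apply: HP'.
Qed.

Definition wc_fine V ts : Prop := dp_fine V [:: dead 0; dead 1; dead 2]
  [:: (true, (dead 0, dead 0))] [:: dead 0] (dead 2) (dead 1)
  (flatten [seq [seq (v, s) | s <- [:: dead 0; dead 2]] | v <- V]) ts.

Lemma R_closed env a (e : seq (T * status_t) * seq T) : R env a (enc e) ->
  R env (tclosed_entry a) (enc (closed_entry e)).
Proof.
move=> Ha; apply: R_all; first exact: R_fst.
by enter; apply: R_not; apply: R_eq; [exact: R_snd|exact: R_dead].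
Qed.

Lemma R_wc_test env v t V (ts : seq (seq T)) : R env ted (enc ed) -> R env v (enc V) ->
  R env t (enc ts) -> wc_fine V ts -> R env (twc_test ted v t) (enc (wc_test ed V ts)).
Proof.
move=> He Hv Ht HP.
have D w p : R w (tdead p) (enc (dead p)) by apply: R_dead.
have Hdp : R env (twc_dp ted v t) (enc (wc_dp ed V ts)).
  apply: R_dp => //; try by move=> i; case: (HP i).
  split; [by split|..|exact: D|exact: D|].
  - by repeat (apply: R_cons; first exact: D); apply: R_nil.
  - by apply: R_sing; apply: R_pair; [exact: R_true|apply: R_pair].
  - by apply: R_sing.
  - apply: R_for => //; enter; apply: R_map; last by enter; apply: R_pair.
    by apply: R_cons => //; apply: R_sing.
apply: (R_caseseq Hdp (g := fun x _ => _) (x := true)) => [_|x s _]; first exact: R_true.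
move=> w tx _ts Hx _; enter; have Hx2 := R_snd Hx.
apply: R_all => //; move=> e w1 te Hte; enter; apply: R_all => //; move=> e' w2 te' Hte'; enter.
apply: R_imp; first exact: R_closed.
apply: R_imp; first exact: R_closed.
by apply: R_eq; apply: R_length; apply: R_snd.
Qed.

End Typed.
End Programs.

(** * Reading the encoded graph *)

Definition parse_step (st : bool * (seq nat * seq bool)) (b : bool) :=
  if st.1 then if b then (true, (st.2.1 ++ [:: size st.2.1], st.2.2)) else (false, st.2)
  else (false, (st.2.1, st.2.2 ++ [:: b])).
Definition parse (w : seq bool) := foldl parse_step (true, ([::], [::])) w.

Lemma parse_ones n : parse (nseq n true) = (true, (iota 0 n, [::])).
Proof.
elim: n => // n IH; rewrite -addn1 nseqD /parse foldl_cat -/(parse _) IH /=.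
by rewrite /parse_step /= size_iota iotaD.
Qed.

Lemma parse_header n bits : parse (nseq n true ++ false :: bits) = (false, (iota 0 n, bits)).
Proof.
rewrite /parse foldl_cat -/(parse _) parse_ones.
change (foldl parse_step (false, (iota 0 n, [::])) bits = (false, (iota 0 n, bits))).
suff H out : foldl parse_step (false, (iota 0 n, out)) bits = (false, (iota 0 n, out ++ bits)) by [].
elim: bits out => [|b s IH] out /=; first by rewrite cats0.
by rewrite IH -catA.
Qed.

Section Edges.
Variable T : eqType.

Definition edge_step (st : seq bool * seq (T * T)) (p : T * T) :=
  (behead st.1, if head false st.1 then p :: st.2 else st.2).

Lemma edges_map (e : pred (T * T)) s out :
  foldl edge_step (map e s, out) s = ([::], rev (filter e s) ++ out).
Proof.
elim: s out => //= p s IH out; rewrite /edge_step /= IH.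
by case: (e p) => //; rewrite rev_cons cat_rcons.
Qed.

Lemma edges_prefix bits s out : let st := foldl edge_step (bits, out) s in
  [/\ size st.1 <= size bits, size st.2 <= size out + size s & {subset st.2 <= out ++ s}].
Proof.
elim: s bits out => [|p s IH] bits out /=.
  by rewrite addn0 cats0; split.
have [h1 h2 h3] := IH (behead bits) (if head false bits then p :: out else out).
split; first by apply: leq_trans h1 _; rewrite size_behead leq_pred.
  by apply: leq_trans h2 _; case: (head _ _) => /=; lia.
move=> x /h3; rewrite !mem_cat !inE; case: (head _ _); rewrite ?inE;
  by case: (x \in out); case: (x == p); case: (x \in s).
Qed.

End Edges.

Definition tbehead (a : term) : term := tcase a tnil (fun _ s => s).
Definition tparse (a : term) : term :=
  tfold a (tcons ttrue (tcons tnil tnil)) (fun st b =>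
    tif (tfst st)
      (tif b (tcons ttrue (tcons (tcat (tfst (tsnd st)) (tsing (tlength (tfst (tsnd st)))))
                                 (tsnd (tsnd st))))
             (tcons tnil (tsnd st)))
      (tcons tnil (tcons (tfst (tsnd st)) (tcat (tsnd (tsnd st)) (tsing b))))).
Definition tedges (bits s : term) : term :=
  tsnd (tfold s (tcons bits tnil) (fun st p =>
    tcons (tbehead (tfst st)) (tif (thead_or tnil (tfst st)) (tcons p (tsnd st)) (tsnd st)))).
Definition tvertices (w : term) : term := tfst (tsnd (tparse w)).
Definition tbits (w : term) : term := tsnd (tsnd (tparse w)).
Definition tmain (w : term) : term :=
  twell_covered (tedges (tbits w) (tpairs (tvertices w) (tvertices w)))
    (tvertices w) (tvertices w).

Section Programs.
Variable P : tree -> Prop.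
Local Notation R := (realizes P).

Lemma R_parse env a w : R env a (enc w) -> (forall i, P (enc (parse (take i w)))) ->
  R env (tparse a) (enc (parse w)).
Proof.
move=> Ha HP; apply: R_fold => // i b _ _.
move=> v st tb Hst Hb; enter; have h1 := R_fst Hst; have h2 := R_snd Hst.
have h3 := R_fst h2; have h4 := R_snd h2.
apply: R_if => // _.
  apply: R_if => // _; apply: R_pair => //; apply: R_pair => //.
  by apply: R_cat => //; apply: R_sing; apply: R_length.
apply: R_pair; first exact: R_false.
by apply: R_pair => //; apply: R_cat => //; apply: R_sing.
Qed.

Lemma R_edges (T : eqType) (eT : Enc T) env a b bits (s : seq (T * T)) :
  R env a (enc bits) -> R env b (enc s) ->
  (forall i, P (enc (foldl (@edge_step T) (bits, [::]) (take i s)))) ->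
  R env (tedges a b) (enc (foldl (@edge_step T) (bits, [::]) s).2).
Proof.
move=> Ha Hb HP; apply: R_snd; apply: R_fold => // [|i p _ _].
  by apply: R_pair => //; exact: R_nil.
move=> v st tp Hst Hp; enter; have h1 := R_fst Hst; have h2 := R_snd Hst.
apply: R_pair.
  have -> : behead (foldl (@edge_step T) (bits, [::]) (take i s)).1 =
    if (foldl (@edge_step T) (bits, [::]) (take i s)).1 is _ :: s' then s' else [::] by case: (_.1).
  apply: (R_caseseq h1 (g := fun _ s' => s')) => [_|y s' _]; first exact: R_nil.
  by move=> v' x y' _ Hy; exact: Hy.
by apply: R_if => // [|_]; [apply: R_head => //; exact: R_false|apply: R_cons].
Qed.

(** Vertices are encoded by their values, so the list read from the header is at once the vertex
    list and the list of ranks to try. *)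
Lemma enc_enum n : enc (enum 'I_n) = enc (iota 0 n).
Proof. by rewrite /enc /enc_seq -val_enum_ord -map_comp. Qed.

Variables (n : nat) (E : rel 'I_n).
Let V := enum 'I_n.
Let pairs := [seq (i, j) | i <- V, j <- V].
Let bits := [seq E p.1 p.2 | p <- pairs].
Definition edges_of := rev [seq p <- [seq (i, j) | i <- enum 'I_n, j <- enum 'I_n] | E p.1 p.2].

Lemma adj_edges_of x y : adj edges_of x y = E x y.
Proof. by rewrite /adj mem_rev mem_filter mem_pairs !mem_enum !andbT. Qed.

Lemma encode_bits : encode_graph E = nseq n true ++ false :: bits.
Proof. by rewrite /encode_graph /bits /pairs map_allpairs. Qed.

Lemma R_main : (forall b : bool, P (enc b)) ->
  (forall i, P (enc (parse (take i (encode_graph E))))) ->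
  (forall i, P (enc (foldl (@edge_step 'I_n) (bits, [::]) (take i pairs)))) ->
  (forall i, P (enc (decompose edges_of (take i V) (iota 0 n)))) ->
  (forall i x, i < size V -> nth x V i = x ->
     insert_fine P edges_of (iota 0 n) (decompose edges_of (take i V) (iota 0 n)) x) ->
  wc_fine P edges_of V (decompose edges_of V (iota 0 n)).2 ->
  R [:: enc_bits (encode_graph E)] (tmain (tvar 0))
    (enc (well_covered_alg edges_of V (iota 0 n))).
Proof.
move=> Pb P1 P2 P3 P4 P5; set env := [:: _].
have Hp : R env (tparse (tvar 0)) (enc (parse (encode_graph E))).
  by apply: R_parse => //; apply: R_var.
rewrite encode_bits parse_header in Hp.
have Hrs : R env (tvertices (tvar 0)) (enc (iota 0 n)) by have := R_fst (R_snd Hp).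
have HV : R env (tvertices (tvar 0)) (enc V) by rewrite enc_enum.
have Hb : R env (tbits (tvar 0)) (enc bits) by have := R_snd (R_snd Hp).
have He : R env (tedges (tbits (tvar 0)) (tpairs (tvertices (tvar 0)) (tvertices (tvar 0))))
    (enc edges_of).
  have := R_edges Hb (R_pairs HV HV) P2; rewrite edges_map cats0.
  exact.
apply: R_wc_test => //.
by apply: R_snd; apply: R_decompose.
Qed.

End Programs.

(** * Size bounds for the algorithm *)

Lemma tsz_nat (i : nat) : tsz (enc i) = (2 * i).+1.
Proof. by elim: i => //= i IH; rewrite -[enc _]/(C N (enc i)) tsz_C IH /tsz /=; lia. Qed.

Section Degrees.
Variable X : nat.
Hypothesis X3 : 3 <= X.

Lemma deg_mono a b m : a <= b -> m <= X ^ a -> m <= X ^ b.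
Proof. by move=> ab /leq_trans; apply; rewrite leq_exp2l //; lia. Qed.

(** Sizes are measured by exponents of [X]. The exponents of the elements and of the length add up,
    and one more pays for the list cells, since the base is at least 3. *)
Lemma deg_seq (A : eqType) (eA : Enc A) (s : seq A) a b : size s <= X ^ b ->
  (forall x, x \in s -> tsz (enc x) <= X ^ a) -> tsz (enc s) <= X ^ (a + b).+1.
Proof.
move=> ss H; rewrite tsz_lst -map_comp.
have h : sumn [seq (tsz (enc x)).+1 | x <- s] <= X ^ b * (X ^ a).+1.
  apply: leq_trans (sumn_le (M := (X ^ a).+1) _) _; first by move=> x /H.
  by rewrite leq_mul2r ss orbT.
have p0 : 0 < X ^ a by rewrite expn_gt0; lia.
have q0 : 0 < X ^ b by rewrite expn_gt0; lia.
rewrite expnS expnD; move: h p0 q0; rewrite -[[seq _ | x <- s]]/(map _ s).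
move: (sumn _) (X ^ a) (X ^ b) => m p q; clear - X3; nia.
Qed.

Lemma deg_pair (A A' : Type) (eA : Enc A) (eA' : Enc A') (x : A * A') a :
  tsz (enc x.1) <= X ^ a -> tsz (enc x.2) <= X ^ a -> tsz (enc x) <= X ^ a.+1.
Proof.
case: x => x y /= hx hy; rewrite -[enc _]/(C (enc x) (enc y)) tsz_C expnS.
have p0 : 0 < X ^ a by rewrite expn_gt0; lia.
by move: hx hy p0; move: (tsz _) (tsz _) (X ^ a) => u v p; clear - X3; nia.
Qed.

Lemma deg_bool (b : bool) : tsz (enc b) <= X ^ 1.
Proof. by case: b; rewrite expn1 /tsz /=; lia. Qed.

Lemma deg_nat (i : nat) : 2 * i < X -> tsz (enc i) <= X ^ 1.
Proof. by rewrite tsz_nat expn1. Qed.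

Lemma deg_nats (s : seq nat) m : size s <= m -> {in s, forall i, i <= m} -> 2 * m < X ->
  tsz (enc s) <= X ^ 3.
Proof.
move=> ss H mX; apply: (deg_seq (a := 1) (b := 1)) => [|i /H im].
  by rewrite expn1; apply: leq_trans ss _; lia.
by apply: deg_nat; move: im mX; clear; lia.
Qed.

End Degrees.

Section Bounds.
Variables (n : nat) (E : rel 'I_n) (ed : seq ('I_n * 'I_n)) (k : nat).
Hypothesis Esym : forall x y, E x y = E y x.
Hypothesis Eirr : forall x, E x x = false.
Hypothesis edE : forall x y, adj ed x y = E x y.

Let R0 := (rmax n k).+1.
Let L0 := 3 * (2 ^ R0 * 2 ^ R0).
(** The number of sets of pairs of a twin class and a status, times the number of witness sizes.
    [R0] is one above [rmax], since splitting runs on the layout with a new leaf at the root; [L0]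
    is the number of statuses for rank [R0]. *)
Definition table_bound : nat := 2 ^ (2 ^ R0 * L0) * n.+1.
Definition base_bound : nat := table_bound + 2 * n + 2 * R0 + 9.
Local Notation X := base_bound.
(** The exponent belongs to the largest accumulator, the stack of the dynamic program: 5 for a
    status, 6 with its vertex, 9 for a signature, 10 for an entry, 12 for a table, 13 for a stack
    cell, 15 for the stack. *)
Definition modest (t : tree) : Prop := tsz t <= X ^ 15.

Lemma X3 : 3 <= X. Proof. by rewrite /base_bound; lia. Qed.
Lemma nX : 2 * n + 9 <= X. Proof. by rewrite /base_bound; lia. Qed.
Lemma rX r : r <= R0 -> 2 * r + 9 <= X. Proof. by rewrite /base_bound; lia. Qed.
Lemma tableX : table_bound <= X. Proof. by rewrite /base_bound; lia. Qed.

Lemma modestW a t : a <= 15 -> tsz t <= X ^ a -> modest t.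
Proof. by move=> /(deg_mono X3); apply. Qed.

Lemma L0_table : 2 ^ R0 * L0 * n.+1 <= table_bound.
Proof. by rewrite leq_mul2r ltnW ?orbT // ltn_expl. Qed.

Lemma exp_R0 : 0 < 2 ^ R0. Proof. by rewrite expn_gt0. Qed.

Lemma L0X : L0 <= X.
Proof.
have h1 := L0_table; have h2 := tableX; have h3 := exp_R0.
apply: leq_trans (leq_trans h1 h2); rewrite -mulnA -{1}[L0]mul1n.
by apply: leq_mul => //; rewrite leq_pmulr.
Qed.

Lemma nL0 : n * L0 <= table_bound.
Proof.
have h1 := L0_table; have h3 := exp_R0; apply: leq_trans h1.
by rewrite mulnC; apply: leq_mul => //; rewrite leq_pmull.
Qed.

Lemma pow_X r : r <= R0 -> 2 ^ r <= X.
Proof.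
move=> rR; apply: leq_trans L0X; apply: (@leq_trans (2 ^ R0)); first by rewrite leq_exp2l.
by rewrite /L0 mulnA leq_pmull // muln_gt0 exp_R0.
Qed.

Lemma modest_bool (b : bool) : modest (enc b).
Proof. by apply: (modestW (a := 1)) => //; apply: deg_bool X3 _. Qed.

Lemma deg_vertex (x : 'I_n) : tsz (enc x) <= X ^ 1.
Proof.
rewrite -[enc x]/(enc (val x)); apply: deg_nat.
by have h : val x < n := ltn_ord x; have := nX; lia.
Qed.

Lemma deg_vertices (s : seq 'I_n) : size s <= n -> tsz (enc s) <= X ^ 3.
Proof.
move=> sn; apply: (deg_seq X3 (a := 1) (b := 1)) => [|x _]; last exact: deg_vertex.
by rewrite expn1; apply: leq_trans sn _; have := nX; lia.
Qed.

Lemma deg_toks (s : seq (seq 'I_n)) : size s <= 2 * n -> {in s, forall tok, size tok <= 1} ->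
  tsz (enc s) <= X ^ 4.
Proof.
move=> sn H; apply: (deg_seq X3 (a := 2) (b := 1)) => [|tok /H h].
  by rewrite expn1; apply: leq_trans sn _; have := nX; lia.
by apply: (deg_seq X3 (a := 1) (b := 0)) => // x _; apply: deg_vertex.
Qed.

Lemma vecs_bound r a : a \in vecs r -> r <= R0 -> tsz (enc a) <= X ^ 3.
Proof.
move=> /pset_subseq sa rR; apply: (deg_nats X3 (m := r)); last by have := rX rR; lia.
  by have := size_subseq sa; rewrite size_rev size_iota.
by move=> i; rewrite -mem_rev => /(mem_subseq sa); rewrite mem_iota add0n => /andP[_ /ltnW].
Qed.

Lemma small_rank_ok r : r <= R0 -> small_rank modest r.
Proof.
move=> rR i ir; have iR := leq_trans ir rR; split.
  apply: (modestW (a := 3)) => //; apply: (deg_nats X3 (m := i)); rewrite ?size_iota //.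
    by move=> j; rewrite mem_iota add0n => /andP[_ /ltnW].
  by have := rX iR; lia.
apply: (modestW (a := 5)) => //; apply: (deg_seq X3 (a := 3) (b := 1)) => [|a ai].
  by rewrite expn1 size_pset size_iota; apply: pow_X.
exact: vecs_bound ai iR.
Qed.

Lemma deg_dead p : p <= 4 -> tsz (enc (dead p)) <= X ^ 5.
Proof.
move=> p4; apply: (deg_mono X3 (a := 3)) => //.
have N1 : tsz (enc ([::] : seq nat)) <= X ^ 1 by rewrite expn1; have := X3; rewrite /tsz /=; lia.
apply: (deg_pair X3) => /=; last exact: (deg_pair X3 (a := 1)).
by apply: (deg_mono X3 (a := 1)) => //; apply: deg_nat; have := nX; lia.
Qed.

Lemma deg_status r (s : status_t) : s \in all_status r -> r <= R0 -> tsz (enc s) <= X ^ 5.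
Proof.
rewrite mem_all_status => /and3P[p3 ha hb] rR; apply: (deg_pair X3).
  by apply: (deg_mono X3 (a := 1)) => //; apply: deg_nat; have := nX; lia.
by apply: (deg_pair X3); apply: vecs_bound rR.
Qed.

Section Tree.
Variables (S : eqType) (eS : Enc S) (V : seq 'I_n) (Lam : seq S).
Variables (forb : seq (bool * (S * S))) (marks : seq S) (und dom : S) (init : seq ('I_n * S)).
Variables (r : nat) (t0 : layout 'I_n).
Hypothesis rR : r <= R0.
Hypothesis Vn : size V <= n.
Hypothesis t0V : {subset leaves t0 <= V}.
Hypothesis t0u : uniq (leaves t0).
Hypothesis t0w : wide E r V t0.
Hypothesis Lam_size : size Lam <= L0.
Hypothesis Lam_deg : forall s, s \in Lam -> tsz (enc s) <= X ^ 5.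
Hypothesis init_size : size init <= n * L0.
Local Notation table := (table ed V Lam forb marks und dom init).
Local Notation dp_step := (dp_step ed V Lam forb marks und dom init).

Let ok (t : layout 'I_n) : Prop := [/\ uniq (leaves t), wide E r V t & {subset leaves t <= V}].

Lemma ok_node a b : ok (Node a b) -> ok a /\ ok b.
Proof.
case=> /=; rewrite cat_uniq => /and3P[ua _ ub] /andP[_ /andP[wa wb]] sub.
by split; split=> // x xa; apply: sub; rewrite mem_cat xa ?orbT.
Qed.

Lemma leaves_gt0 (t : layout 'I_n) : 0 < size (leaves t).
Proof. by elim: t => //= a Ha b Hb; rewrite size_cat addn_gt0 Ha. Qed.

(** Between tokens the stack holds the tables of disjoint subtrees, hence at most as many as there
    are leaves, and each subtree inherits the low width. *)
Lemma dp_prefix t i st : ok t -> exists2 zs, size zs <= size (leaves t) &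
  foldl dp_step st (take i (toks t)) = zs ++ st /\
  forall z, z \in zs -> exists2 t', ok t' & z = (leaves t', table t').
Proof.
elim: t i st => [v|a IHa b IHb] i st okt.
  case: i => [|i]; first by exists [::].
  exists [:: (leaves (Leaf v), table (Leaf v))] => //; split; first by rewrite /=; case: (i).
  by move=> z; rewrite inE => /eqP ->; exists (Leaf v).
have [oka okb] := ok_node okt; rewrite /= size_cat.
have ga := leaves_gt0 a; have gb := leaves_gt0 b.
rewrite take_cat; case: ltnP => ia.
  have [zs sz [-> Hz]] := IHa i st oka; exists zs => //.
  by apply: leq_trans sz _; apply: leq_addr.
rewrite foldl_cat dp_toks take_cat; case: ltnP => ib.
  have [zs sz [-> Hz]] := IHb (i - size (toks a)) ((leaves a, table a) :: st) okb.
  exists (rcons zs (leaves a, table a)); first by rewrite size_rcons -add1n leq_add.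
  split; first by rewrite cat_rcons.
  by move=> z; rewrite mem_rcons inE => /orP[/eqP ->|/Hz //]; exists a.
rewrite foldl_cat dp_toks; case: (i - _ - _) => [|j].
  exists [:: (leaves b, table b); (leaves a, table a)]; first exact: leq_add ga gb.
  by split=> // z; rewrite !inE => /orP[]/eqP ->; [exists b|exists a].
exists [:: (leaves (Node a b), table (Node a b))]; first by rewrite addn_gt0 ga.
by split; [rewrite /=; case: (j)|move=> z; rewrite inE => /eqP ->; exists (Node a b)].
Qed.

Lemma size_ok t : ok t -> size (leaves t) <= n.
Proof. by case=> u _ sub; apply: leq_trans (uniq_leq_size u sub) Vn. Qed.

Lemma table_sig_size t e : e \in table t -> size e.1 <= size (leaves t) * size Lam.
Proof.
have canon_size (B : seq 'I_n) raw : size (canon Lam B raw) <= size B * size Lam.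
  by rewrite size_filter (leq_trans (count_size _ _)) // size_allpairs.
case: t => [v|a b] /=.
  by case/flatten_mapP => p _; case: ifP => // _; rewrite inE => /eqP ->; apply: canon_size.
move/mem_dedup => /flatten_mapP[e1 _ /flatten_mapP[e2 _]].
by case: ifP => // _; rewrite inE => /eqP ->; apply: canon_size.
Qed.

Lemma deg_table t s : ok t -> size s <= size (table t) -> {subset s <= table t} ->
  tsz (enc s) <= X ^ 12.
Proof.
move=> okt ss sub; have tn := size_ok okt; have [u w tV] := okt.
apply: (deg_seq X3 (a := 10) (b := 1)).
  apply: leq_trans ss _; have h := size_table edE Lam forb marks und dom init u w tV.
  apply: leq_trans h _.
  rewrite expn1; apply: leq_trans tableX; rewrite geq_max (leq_trans init_size nL0) /=.
  by apply: leq_mul => //; rewrite leq_exp2l // leq_mul // leq_exp2l.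
move=> e /sub et; have [m1 m2] := table_entry et.
apply: (deg_pair X3); last first.
  by apply: (deg_mono X3 (a := 3)) => //; apply: deg_vertices; apply: leq_trans m2 tn.
apply: (deg_seq X3 (a := 6) (b := 2)).
  apply: leq_trans (table_sig_size et) _; rewrite -mulnn; apply: leq_mul; last exact: leq_trans L0X.
  by have := nX; lia.
move=> p /m1[_ pL]; apply: (deg_pair X3); last exact: Lam_deg.
by apply: (deg_mono X3 (a := 1)) => //; apply: deg_vertex.
Qed.

Lemma dp_fine_ok : dp_fine modest ed V Lam forb marks und dom init (toks t0).
Proof.
have okt : ok t0 by [].
move=> i; have [zs sz [-> Hz]] := dp_prefix i [::] okt; rewrite cats0; split.
  apply: (modestW (a := 15)) => //; apply: (deg_seq X3 (a := 13) (b := 1)).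
    by rewrite expn1; apply: leq_trans sz _; apply: leq_trans (size_ok okt) _; have := nX; lia.
  move=> z /Hz[t ot ->]; apply: (deg_pair X3); last exact: deg_table ot _ _.
  by apply: (deg_mono X3 (a := 3)) => //; apply: deg_vertices; apply: size_ok.
move=> tb B st' Ezs t' /suffixP[u Eu].
have [|t ot [_ Et]] := Hz (B, tb); first by rewrite Ezs mem_head.
apply: (modestW (a := 12)) => //; apply: (deg_table ot); rewrite -Et Eu.
  by rewrite size_cat leq_addl.
by move=> e; rewrite mem_cat => ->; rewrite orbT.
Qed.

End Tree.

Section Split.
Variables (V : seq 'I_n) (t0 : layout 'I_n).
Hypothesis Vn : size V <= n.
Hypothesis t0V : {subset leaves t0 <= V}.
Hypothesis t0u : uniq (leaves t0).

Lemma split_fine_ok r B : r <= R0 -> wide E R0 V t0 -> split_fine modest ed r V B (toks t0).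
Proof.
move=> rR w; have Lr : size (all_status r) <= L0.
  by rewrite size_all_status leq_mul2l leq_mul // leq_exp2l.
apply: (@dp_fine_ok _ _ V _ _ _ _ _ _ R0 t0) => // [s sr|]; first exact: deg_status sr rR.
apply: (@leq_trans (size V * L0)); last by rewrite leq_mul2r Vn orbT.
rewrite /split_init size_flatten /shape -map_comp; apply: sumn_le => v _ /=.
by rewrite size_map size_filter (leq_trans (count_size _ _)).
Qed.

Lemma wc_fine_ok : wide E (rmax n k) V t0 -> wc_fine modest ed V (toks t0).
Proof.
have L3 : 3 <= L0 by rewrite /L0 -{1}[3]muln1 leq_mul2l /= muln_gt0 exp_R0.
move=> w; apply: (@dp_fine_ok _ _ V _ _ _ _ _ _ (rmax n k) t0) => // [s|].
  by rewrite !inE => /or3P[] /eqP ->; apply: deg_dead.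
apply: (@leq_trans (size V * L0)); last by rewrite leq_mul2r Vn orbT.
rewrite size_flatten /shape -map_comp; apply: sumn_le => v _ /=.
exact: ltnW.
Qed.

End Split.

Lemma split_set_sizes r V ts (B : seq 'I_n) p s : split_set ed r V ts B = p :: s ->
  [/\ p.1 != [::], p.2 != [::] & size p.1 + size p.2 = size B].
Proof.
move=> Ep; have : p \in split_set ed r V ts B by rewrite Ep mem_head.
rewrite /split_set; case: (split_dp _ _ _ _ _) => // x _ /flatten_mapP[e _].
rewrite /halves; set l := [seq _ <- _ | _]; set l' := [seq _ <- _ | _].
have El : size l + size l' = size B by rewrite /l /l' !size_filter count_predC.
by case: l El => // a l El; case: l' El => // a' l' El; rewrite inE => /eqP ->.
Qed.

(** A failing run belongs to no layout, so its states are bounded by this invariant and not through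
    the final result. *)
Definition build_inv (N m : nat) (st : seq (seq 'I_n) * seq (seq 'I_n)) : Prop :=
  [/\ sumn (map size st.1) <= N, all (fun B => 0 < size B) st.1, size st.2 <= m &
    all (fun tok => size tok <= 1) st.2].

Lemma build_step_inv r V ts N m st : build_inv N m st ->
  build_inv N m.+1 (build_step ed r V ts st).
Proof.
case: st => -[|B wl] out [/= h1 h2 h3 h4]; first by split=> //=; apply: leqW.
case: B h1 h2 => [|x [|x' B]] //= h1 h2.
  by split=> //=; apply: leq_trans h1; rewrite leq_addl.
rewrite /build_step /=; case Es: (split_set _ _ _ _ (x :: x' :: B)) => [|p s] /=; first by split.
have [p1 p2 p12] := split_set_sizes Es.
split=> //=; first by apply: leq_trans h1; rewrite addnA p12.
by rewrite !lt0n !size_eq0 p1 p2.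
Qed.

Lemma build_inv_iter r V ts N (s : seq 'I_n) m st : build_inv N m st ->
  build_inv N (m + size s) (foldl (fun st _ => build_step ed r V ts st) st s).
Proof.
elim: s m st => [|x s IH] m st H /=; first by rewrite addn0.
by rewrite addnS -addSn; apply: IH; apply: build_step_inv.
Qed.

Lemma deg_build_state st N : N <= n -> build_inv N (2 * n) st -> tsz (enc st) <= X ^ 6.
Proof.
case: st => wl out Nn [/= h1 h2 h3 h4]; apply: (deg_pair X3); last first.
  by apply: (deg_mono X3 (a := 4)) => //; apply: deg_toks => //; apply/allP.
have h5 : size wl <= n.
  apply: leq_trans Nn; apply: leq_trans h1; elim: wl h2 => //= B wl IH /andP[B0 /IH h].
  by rewrite -add1n leq_add.
apply: (deg_seq X3 (a := 3) (b := 1)) => [|B Bw].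
  by rewrite expn1; apply: leq_trans h5 _; have := nX; lia.
apply: deg_vertices; apply: leq_trans Nn; apply: leq_trans h1.
elim: wl Bw {h2 h5} => //= B' wl IH; rewrite inE => /orP[/eqP ->|/IH h].
  exact: leq_addr.
by apply: leq_trans h _; apply: leq_addl.
Qed.

Lemma build_fine_ok r V t0 : r <= R0 -> size V <= n -> 0 < size V -> {subset leaves t0 <= V} ->
  uniq (leaves t0) -> wide E R0 V t0 -> build_fine modest ed r V (toks t0).
Proof.
move=> rR Vn V0 tV tu w; split=> [|i]; first exact: small_rank_ok.
split; last first.
  by rewrite /step_fine; case: (_.1) => // B _; apply: split_fine_ok.
apply: (modestW (a := 6)) => //; apply: (deg_build_state Vn).
have H0 : build_inv (size V) 0 ([:: V], [::]) by split=> //=; rewrite ?addn0 ?V0.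
have [h1 h2 h3 h4] := build_inv_iter r V (toks t0) (take i (V ++ V)) H0.
split=> //; apply: leq_trans h3 _; rewrite add0n.
apply: (@leq_trans (size (V ++ V))); first by rewrite size_take_min geq_minr.
by rewrite size_cat mul2n -addnn leq_add.
Qed.

Lemma size_tok (T : eqType) (t : layout T) : {in toks t, forall tok, size tok <= 1}.
Proof.
elim: t => [v|a IHa b IHb] tok /=; first by rewrite inE => /eqP ->.
by rewrite !mem_cat inE => /or3P[/IHa|/IHb|/eqP ->].
Qed.

Lemma deg_toks_tree (t : layout 'I_n) : size (leaves t) <= n -> tsz (enc (toks t)) <= X ^ 4.
Proof.
move=> tn; apply: deg_toks; last exact: size_tok.
have := size_toks t; move: tn; move: (size _) (size _) => u v; clear; lia.
Qed.

Lemma tries_cases (f : nat -> seq (seq 'I_n)) s :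
  let acc := foldl (fun acc r => if acc is _ :: _ then acc else f r) [::] s in
  (acc = [::] /\ forall r, r \in s -> f r = [::]) \/
  (exists r, acc = f r /\ f r <> [::]).
Proof.
elim/last_ind: s => [|s r IH] /=; first by left.
rewrite foldl_rcons; case: IH => [[-> H]|[r' [-> nz]]].
  case Er: (f r) => [|x l]; last by right; exists r; rewrite Er.
  left; split=> // r'; rewrite mem_rcons inE => /orP[/eqP ->|/H] //.
by right; exists r'; split=> //; case: (f r') nz.
Qed.

Lemma deg_decomposition V ts : size V <= n -> decomposition E k V ts ->
  tsz (enc ts) <= X ^ 4.
Proof.
case: V => [_ ->|v V Vn [t [-> P _]]]; last by apply: deg_toks_tree; rewrite (perm_size P).
exact: deg_toks.
Qed.

Hypothesis cwk : 0 < n -> cw_le E k.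

Lemma size_uniq_ord (s : seq 'I_n) : uniq s -> size s <= n.
Proof.
move=> us; rewrite -[n in _ <= n]card_ord cardE.
by apply: uniq_leq_size => // x; rewrite mem_enum.
Qed.

Lemma insert_fine_ok V ts v : uniq (v :: V) -> decomposition E k V ts ->
  insert_fine modest ed (iota 0 n) (V, ts) v.
Proof.
move=> uV D i r /=; have n0 : 0 < n by apply: leq_ltn_trans (ltn_ord v).
have [t0 [-> u0 m0 w0]] := insert_layoutP Esym uV D.
have b0 := build_rmax Esym Eirr edE (cwk n0) m0 u0 uV isT.
have := tries_cases (fun r => build ed r (v :: V) (toks t0)) (take i (iota 0 n)).
rewrite -/(tries _ _ _ _) /=; have Vn := size_uniq_ord uV.
case=> [[-> H]|[r' [-> nz]]]; last first.
  split; last by move=> _ _ /nz.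
  have [t [-> P W]] := build_sound Esym Eirr edE m0 u0 uV isT nz.
  by apply: (modestW (a := 4)) => //; apply: deg_toks_tree; rewrite (perm_size P).
split; first by apply: (modestW (a := 4)) => //; apply: deg_toks.
rewrite size_iota => Hi; rewrite nth_iota // add0n => <- _.
apply: build_fine_ok => //; last by move=> x; rewrite m0.
(* A rank above [R0] is tried only after [rmax] has failed, which [build_rmax] excludes. *)
rewrite leqNgt; apply/negP => Ri; apply: b0; apply: H.
by rewrite take_iota mem_iota add0n leq0n ltn_min (ltn_trans _ Hi) ?(ltn_trans _ Ri) //=.
Qed.

Let vs := enum 'I_n.

(** Every expression creates a vertex, so there is none for [n = 0], and this case is treated
    apart. *)
Lemma decompose_ok i : (decompose ed (take i vs) (iota 0 n)).1 = rev (take i vs) /\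
  decomposition E k (rev (take i vs)) (decompose ed (take i vs) (iota 0 n)).2.
Proof.
have [n0|n0] := posnP n.
  have -> : take i vs = [::] by apply/size0nil; rewrite size_take_min size_enum_ord; lia.
  by [].
have := decompose_prefix Esym Eirr edE (cwk n0) (V := [::]) (ts := [::]) (s := take i vs).
by rewrite cats0; apply=> //; rewrite rev_uniq take_uniq ?enum_uniq.
Qed.

Lemma decompose_modest i : modest (enc (decompose ed (take i vs) (iota 0 n))).
Proof.
have [E1 D] := decompose_ok i; apply: (modestW (a := 5)) => //.
have sn : size (rev (take i vs)) <= n by rewrite size_rev size_take_min size_enum_ord geq_minr.
apply: (deg_pair X3); last exact: deg_decomposition sn D.
by rewrite E1; apply: (deg_mono X3 (a := 3)) => //; apply: deg_vertices.
Qed.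

Lemma insert_modest i x : i < size vs -> nth x vs i = x ->
  insert_fine modest ed (iota 0 n) (decompose ed (take i vs) (iota 0 n)) x.
Proof.
move=> Hi Ex; have [E1 D] := decompose_ok i; rewrite [decompose _ _ _]surjective_pairing E1.
apply: insert_fine_ok => //=; rewrite mem_rev rev_uniq take_uniq ?enum_uniq // andbT.
have := take_uniq i.+1 (enum_uniq 'I_n); rewrite -/vs (take_nth x) // Ex.
by rewrite rcons_uniq => /andP[].
Qed.

Lemma wc_modest : wc_fine modest ed vs (decompose ed vs (iota 0 n)).2.
Proof.
have [_] := decompose_ok (size vs); rewrite take_size.
case Ev : (rev vs) => [|v s] /=.
  by move=> -> i /=; split=> //; rewrite /modest expn_gt0 (leq_trans _ X3).
case=> t [-> P W]; rewrite -Ev in P W.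
have Vn : size vs <= n by rewrite size_enum_ord.
apply: (wc_fine_ok Vn) => //.
- by move=> x _; rewrite mem_enum.
- by rewrite (perm_uniq P) rev_uniq enum_uniq.
- have eg B : good E (rmax n k) (rev vs) B = good E (rmax n k) vs B.
    by apply: eq_good => // x; rewrite mem_rev.
  by elim: (t) W => [x|a IHa b IHb] /=; rewrite eg // => /andP[-> /andP[/IHa -> /IHb ->]].
Qed.

Lemma size_pairs : size [seq (i, j) | i <- vs, j <- vs] = n ^ 2.
Proof. by rewrite size_allpairs size_enum_ord mulnn. Qed.

Lemma n2X : n ^ 2 <= X ^ 2.
Proof. by rewrite leq_exp2r //; have := nX; lia. Qed.

Lemma deg_bits (s : seq bool) : size s <= n ^ 2 -> tsz (enc s) <= X ^ 4.
Proof.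
move=> sn; apply: (deg_seq X3 (a := 1) (b := 2)) => [|b _]; last exact: deg_bool X3 b.
exact: leq_trans n2X.
Qed.

Lemma parse_modest i : modest (enc (parse (take i (encode_graph E)))).
Proof.
have H (b : bool) m (s : seq bool) : m <= n -> size s <= n ^ 2 -> modest (enc (b, (iota 0 m, s))).
  move=> mn sn; apply: (modestW (a := 6)) => //; apply: (deg_pair X3) => /=.
    by apply: (deg_mono X3 (a := 1)) => //; apply: (deg_bool X3).
  apply: (deg_pair X3) => /=; last exact: deg_bits.
  apply: (deg_mono X3 (a := 3)) => //; apply: (deg_nats X3 (m := n)); rewrite ?size_iota //.
    by move=> j; rewrite mem_iota add0n => /andP[_ /ltnW /leq_trans]; apply.
  by have := nX; lia.
rewrite encode_bits take_cat size_nseq; case: ltnP => ni.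
  have -> : take i (nseq n true) = nseq i true.
    by elim: (i) (n) ni => [|j IH] [|m] //= jm; rewrite IH.
  by rewrite parse_ones; apply: H => //; apply: ltnW.
case: (i - n) => [|j] /=.
  by rewrite cats0 parse_ones; apply: H.
rewrite parse_header; apply: H => //.
by rewrite size_take_min size_map size_pairs geq_minr.
Qed.

Lemma edges_modest i : modest (enc (foldl (@edge_step 'I_n)
  ([seq E p.1 p.2 | p <- [seq (i, j) | i <- vs, j <- vs]], [::])
  (take i [seq (i, j) | i <- vs, j <- vs]))).
Proof.
have [h1 h2 _] := edges_prefix [seq E p.1 p.2 | p <- [seq (i, j) | i <- vs, j <- vs]]
  (take i [seq (i, j) | i <- vs, j <- vs]) [::].
rewrite size_map size_pairs in h1; apply: (modestW (a := 6)) => //; apply: (deg_pair X3).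
  by apply: (deg_mono X3 (a := 4)) => //; apply: deg_bits.
apply: (deg_seq X3 (a := 2) (b := 2)) => [|p _]; last by apply: (deg_pair X3); apply: deg_vertex.
apply: leq_trans h2 _; rewrite add0n; apply: leq_trans n2X.
by rewrite size_take_min size_pairs geq_minr.
Qed.

End Bounds.

(** * The whole program on an encoded graph *)

Section Correctness.
Variables (n : nat) (E : rel 'I_n) (k : nat).
Hypothesis Esym : forall x y, E x y = E y x.
Hypothesis Eirr : forall x, E x x = false.
Hypothesis cwk : 0 < n -> cw_le E k.

Lemma R_main_modest : realizes (modest n k) [:: enc_bits (encode_graph E)] (tmain (tvar 0))
  (enc (well_covered_alg (edges_of E) (enum 'I_n) (iota 0 n))).
Proof.
have edE := adj_edges_of E; apply: R_main.
- exact: modest_bool.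
- exact: parse_modest.
- exact: edges_modest.
- by move=> i; apply: (decompose_modest Esym Eirr edE cwk).
- by move=> i x; apply: (insert_modest Esym Eirr edE cwk).
- exact: (wc_modest Esym Eirr edE cwk).
Qed.

Lemma well_covered_algP :
  well_covered_alg (edges_of E) (enum 'I_n) (iota 0 n) <-> well_covered E.
Proof.
have edE := adj_edges_of E.
have [n0|n0] := posnP n.
  split=> [_ S S' _ _|_]; first by rewrite !eq_card0 // => x; have := ltn_ord x; rewrite [X in _ < X]n0.
  have -> : enum 'I_n = [::] by apply/size0nil; rewrite size_enum_ord.
  by [].
have [_] := decompose_ok Esym Eirr edE cwk (size (enum 'I_n)); rewrite take_size.
case Ev : (rev (enum 'I_n)) => [|v s] /=.
  by move/(congr1 size): Ev; rewrite size_rev size_enum_ord /=; lia.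
case=> t [Et P _]; rewrite -Ev in P; rewrite /well_covered_alg Et.
apply: (wc_correct Esym Eirr edE).
- by move=> x; rewrite (perm_mem P) mem_rev.
- by rewrite (perm_uniq P) rev_uniq enum_uniq.
- by move=> x; rewrite mem_enum.
Qed.

End Correctness.

(** * The parameter bound *)

Definition tpow2 (a : term) : term := tfold a (tsing tnil) (fun acc _ => tcat acc acc).
Definition tmul (c : nat) (a : term) : term := tfor a (fun _ => tnat c).
(** The input for [computable], [k] ones, a zero and [m] ones, has the shape of an encoded graph, so
    the same parser yields a list of length [k] and one of length [m]. *)
Definition tbound (c : nat) (w : term) : term :=
  teq (tpow2 (tpow2 (tmul c (tcons tnil (tlength (tvertices w)))))) (tlength (tbits w)).

Lemma enc_nseq (m : nat) : enc m = enc (nseq m N).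
Proof. by elim: m => //= m IH; rewrite /enc /= -[X in C _ X]/(enc _) IH. Qed.

Section Bound.
Local Notation R := (realizes (fun=> True)).

Lemma R_pow2 env a m : R env a (enc m) -> R env (tpow2 a) (enc (2 ^ m)).
Proof.
rewrite !enc_nseq => Ha.
have <- : foldl (fun acc (_ : tree) => acc ++ acc) [:: N] (nseq m N) = nseq (2 ^ m) N.
  elim: m {Ha} => // m IH.
  by rewrite -addn1 nseqD foldl_cat IH /= addn1 expnS mul2n -addnn nseqD.
apply: R_fold => // i y _ _ w acc u Hacc _; exact: R_cat.
Qed.

Lemma R_mul env c a m : R env a (enc m) -> R env (tmul c a) (enc (c * m)).
Proof.
rewrite !enc_nseq => Ha.
have -> : nseq (c * m) N = flatten [seq nseq c N | _ <- nseq m N].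
  by elim: m {Ha} => [|m IH]; rewrite ?muln0 // mulnS nseqD /= -IH.
by apply: R_for => // y w u _; rewrite -enc_nseq; apply: R_nat.
Qed.

Lemma tbound_correct c k m :
  ev (tbound c (tvar 0) 1) [:: enc_bits (nseq k true ++ false :: nseq m true)] =
    enc (2 ^ 2 ^ (c * k.+1) == m).
Proof.
set w := _ ++ _.
have Hp : R [:: enc_bits w] (tparse (tvar 0)) (enc (parse w)).
  by apply: R_parse => //; apply: R_var.
rewrite parse_header in Hp.
have Hk := R_length (R_fst (R_snd Hp)); have Hm := R_length (R_snd (R_snd Hp)).
rewrite /= size_iota size_nseq in Hk Hm.
have : R [:: enc_bits w] (tbound c (tvar 0)) (enc (2 ^ 2 ^ (c * k.+1) == m)).
  apply: R_eq; last exact: Hm.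
  by apply: R_pow2; apply: R_pow2; apply: R_mul; apply: R_succ.
by move=> /(_ [::])[].
Qed.

End Bound.

(** [computable] sets no time limit, so no size estimate is made: the time is taken from the actual
    size of the values on the given input. *)
Lemma computable_bound c : computable (fun k => 2 ^ 2 ^ (c * k.+1)).
Proof.
have [M [d H]] := compile (tbound c (tvar 0) 1).
exists M => k m; set w := _ ++ _.
pose s := size w + sz (tbound c (tvar 0) 1) [:: enc_bits w].
exists ((s + 2) ^ d).
have := H w s _ (leq_addr _ _) (leq_addl _ _) (leqnn _).
by rewrite tbound_correct; case: (2 ^ _ == m) => Hr; exact: Hr.
Qed.

Lemma tsz_bits (w : seq bool) : tsz (enc_bits w) <= 4 * size w + 1.
Proof.
elim: w => // b w IH; rewrite -[enc_bits _]/(C (enc_bool b) (enc_bits w)) tsz_C /=.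
have : tsz (enc_bool b) <= 3 by case: b.
by move: IH; move: (tsz _) (tsz _) => u v; clear; lia.
Qed.

Lemma size_encode n (E : rel 'I_n) : size (encode_graph E) = n + 1 + n ^ 2.
Proof.
by rewrite /encode_graph size_cat size_nseq /= size_allpairs size_enum_ord mulnn; lia.
Qed.

Lemma lt_exp2 m : m < 2 ^ m. Proof. exact: ltn_expl. Qed.

(** The inner exponent is [3 * 2 ^ (3 * r)] with [r <= 3 * k + 2]. With slack for the smaller terms
    it is at most [2 ^ (9 * k + 10)], which the factor 13 covers. *)
Lemma base_bound_le n k : base_bound n k <= 2 ^ 2 ^ (13 * k.+1) * (n + 1).
Proof.
rewrite /base_bound /table_bound; set r := (rmax n k).+1.
have rk : r <= 3 * k + 2 by rewrite /r /rmax; have := geq_minl (3 * k).+1 n.-1; lia.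
set e := 2 ^ r * (3 * (2 ^ r * 2 ^ r)).
have e8 : e + 6 <= 2 ^ (13 * k.+1).
  have -> : e = 3 * 2 ^ (3 * r) by rewrite /e !mulnA [_ * 3]mulnC -!mulnA -!expnD; congr (_ * 2 ^ _); lia.
  apply: (@leq_trans (9 * 2 ^ (3 * r))).
    by have := lt_exp2 (3 * r); move: (2 ^ _) => u; lia.
  apply: (@leq_trans (2 ^ 4 * 2 ^ (3 * r))); first by rewrite leq_mul2r orbT.
  by rewrite -expnD leq_exp2l //; lia.
have re : r <= e.
  apply: leq_trans (ltnW (lt_exp2 r)) _; rewrite /e -{1}[2 ^ r]muln1 leq_mul2l.
  by rewrite !muln_gt0 !expn_gt0 orbT.
have h : 2 ^ e + 2 * e + 11 <= 2 ^ 2 ^ (13 * k.+1).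
  apply: (@leq_trans (2 ^ (e + 6))); last by rewrite leq_exp2l.
  by rewrite expnD; have := lt_exp2 e; move: (2 ^ e) => u; lia.
apply: leq_trans (leq_mul h (leqnn _)); move: re; rewrite -addn1.
by move: (2 ^ e) => u; clear; nia.
Qed.

(** [a] comes from the sizes of the values and [b] from the compiled machine. One [d] serves as the
    exponent of the input size and as the coefficient in the function of the parameter. *)
Lemma time_bound a b : exists d, forall n k s, n + 1 <= s ->
  (s + (4 * s + 2 + base_bound n k ^ 15 + 2) ^ a + 2) ^ b <= 2 ^ 2 ^ (d * k.+1) * s ^ d.
Proof.
pose d := (19 * a + 3) * b; exists (13 + d) => n k s s1.
set K := 2 ^ 2 ^ (13 * k.+1); pose Y := K * s.
have s0 : 0 < s by apply: leq_trans s1; rewrite addn1.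
have K2 : 2 <= K by rewrite -{1}[2]expn1 leq_exp2l // expn_gt0.
have Y2 : 2 <= Y by rewrite -{1}[2]muln1 leq_mul.
have sY : s <= Y by rewrite leq_pmull // (leq_trans _ K2).
have XY : base_bound n k <= Y.
  by apply: leq_trans (base_bound_le n k) _; rewrite leq_mul2l s1 orbT.
have pw m j : 2 ^ j * Y ^ m <= Y ^ (m + j).
  by rewrite addnC expnD leq_mul2r; apply/orP; right; apply: exp_mono.
have Y1 m : Y <= Y ^ m.+1 by rewrite expnS leq_pmulr // expn_gt0 (leq_trans _ Y2).
have h1 : 4 * s + 2 + base_bound n k ^ 15 + 2 <= Y ^ 19.
  apply: leq_trans (pw 15 4); have := exp_mono 15 XY; have := Y1 14.
  by move: (_ ^ 15) (_ ^ 15) sY Y2; clear; lia.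
have h2 : s + (4 * s + 2 + base_bound n k ^ 15 + 2) ^ a + 2 <= Y ^ (19 * a + 3).
  rewrite (_ : 19 * a + 3 = (19 * a).+1 + 2); last by lia.
  apply: leq_trans (pw (19 * a).+1 2); have := exp_mono a h1; rewrite -expnM.
  have h : Y ^ (19 * a) <= Y ^ (19 * a).+1 by rewrite leq_exp2l.
  by have := Y1 (19 * a); move: (_ ^ a) (Y ^ (19 * a)) (Y ^ _.+1) h sY Y2; clear; lia.
apply: leq_trans (exp_mono b h2) _; rewrite -expnM -/d /Y expnMn; apply: leq_mul; last first.
  by case: (s) s0 => // s' _; apply: leq_pexp2l => //; apply: leq_addl.
(* The power of [K] is absorbed by the double exponential, since [d <= 2 ^ d]. *)
rewrite /K -expnM leq_exp2l // mulnDl expnD leq_mul2l; apply/orP; right.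
apply: leq_trans (ltnW (ltn_expl d (ltnSn 1))) _; rewrite leq_exp2l //.
by rewrite leq_pmulr.
Qed.

(* Well-Covered Graph is FPT parameterized by clique-width: a single TM
   decides well-coveredness in time f(cw(G)) * |x|^c, f computable. *)
Theorem theorem6 :
  exists (M : TM) (f : nat -> nat) (c : nat), computable f /\
    forall (n : nat) (E : rel 'I_n) (k : nat),
      simple_graph E -> is_cliquewidth E k ->
      exists b : bool,
        runs_within M (encode_graph E) (f k * size (encode_graph E) ^ c) b /\
        (b = true <-> well_covered E).
Proof.
have [M [b HM]] := compile (tmain (tvar 0) 1).
have [a Ha] := tame_sz (tmain (tvar 0) 1).
have [d Hd] := time_bound a b.
exists M, (fun k => 2 ^ 2 ^ (d * k.+1)), d; split; first exact: computable_bound.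
move=> n E k [Esym Eirr] cw.
have cwk : 0 < n -> cw_le E k by move: cw; rewrite /is_cliquewidth; case: posnP => // _ [].
have [Ev tm] := R_main_modest Esym Eirr cwk [::].
exists (well_covered_alg (edges_of E) (enum 'I_n) (iota 0 n)).
split; last exact: well_covered_algP cwk.
have := HM (encode_graph E) _ _ _ _ (Hd n k _ (leq_addr (n ^ 2) (n + 1))); rewrite size_encode [ev _ _]Ev.
have -> : (enc (well_covered_alg (edges_of E) (enum 'I_n) (iota 0 n)) != N) =
  well_covered_alg (edges_of E) (enum 'I_n) (iota 0 n) by case: (well_covered_alg _ _ _).
apply; first exact: leq_addr.
have := Ha _ _ tm => h; apply: leq_trans h _; apply: leq_trans (leq_addl _ _).
(* The environment holds only the encoded word, whose tree has size linear in the length of the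
   word. *)
apply: exp_mono; rewrite leq_add2r leq_add2r /tot /= addn0.
have := tsz_bits (encode_graph E); rewrite size_encode.
by move: (tsz _) (n + 1 + n ^ 2) => u v; clear; lia.
Qed.
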